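(* Let $d\ge 1$ and let $\mathbf{F}_d$ be the free group on $d$ generators. The space $\Xi_{\mathrm{min}}(\mathbf{F}_d)$ has a comeager conjugacy class, the elements of which are isomorphic to the Fraïssé limit of the sofic minimal $\mathbf{F}_d$-subshifts.
   Context: $\Omega$ denotes the Cantor space; $\mathrm{Homeo}(\Omega)$ carries the uniform convergence topology. For a countable group $G$, $\Xi(G)=\mathrm{Hom}(G,\mathrm{Homeo}(\Omega))$ is the Polish space of actions of $G$ on $\Omega$ by homeomorphisms, a closed subspace of $\mathrm{Homeo}(\Omega)^G$. $\mathrm{Homeo}(\Omega)$ acts on it by conjugation, $(f\cdot\xi)(g)=f\xi(g)f^{-1}$, and orbits are called conjugacy classes. An action on a compact space is minimal if it has no proper non-empty closed invariant subset. $\Xi_{\mathrm{min}}(G)$ is the ($G_\delta$, hence Polish) subspace of minimal actions. For a finite (non-empty) alphabet $A$, $G$ acts on $A^G$ by $(g\cdot x)(h)=x(g^{-1}h)$. A subshift is a non-empty closed $G$-invariant subset of $A^G$. A pattern is a function $p\colon F\to A$ with $F\subseteq G$ finite, and $C_p=\{x\in A^G:x|_F=p\}$. A subshift is an SFT if it is of the form $A^G\setminus\bigcup_{p\in P}\bigcup_{g\in G}g\cdot C_p$ for a finite set $P$ of patterns. A subshift is sofic if it is the image of an SFT (over some finite alphabet) under a continuous $G$-equivariant map. Fraïssé limit: a Boolean $G$-algebra is a Boolean algebra with an action of $G$ by automorphisms. By Stone duality, zero-dimensional compact $G$-flows $Z$ correspond to Boolean $G$-algebras $\mathcal{B}(Z)$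 (clopen subsets of $Z$), factor maps correspond to embeddings, and subshifts correspond to finitely generated Boolean $G$-algebras. The Fraïssé limit of the sofic minimal subshifts is the Fraïssé limit (in the classical sense) of the class of Boolean $G$-algebras isomorphic to $\mathcal{B}(X)$ for $X$ a sofic minimal $G$-subshift (over any finite alphabet). That is, it is the unique (up to isomorphism) countable Boolean $G$-algebra $\mathcal{M}$ such that the finitely generated $G$-subalgebras of $\mathcal{M}$ are, up to isomorphism, exactly the algebras $\mathcal{B}(X)$ with $X$ sofic minimal, and every isomorphism between finitely generated $G$-subalgebras of $\mathcal{M}$ extends to an automorphism of $\mathcal{M}$. An action of $G$ on $\Omega$ is isomorphic to this Fraïssé limit if $\mathcal{B}(\Omega)$ with the induced action is isomorphic to $\mathcal{M}$. Part of the claim is that this Fraïssé limit exists. *)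

(* Defs.v *)
From HB Require Import structures.
From mathcomp Require Import all_boot all_order finmap.
From mathcomp Require Import all_classical all_reals topology cantor.

Set Implicit Arguments.
Unset Strict Implicit.
Unset Printing Implicit Defensive.

Import Order.Theory.
Local Open Scope classical_set_scope.
Local Open Scope group_scope.

(* The free group on 'I_d, as the group of reduced words: the letter (i, false)
   stands for the i-th generator and (i, true) for its inverse. *)
Section FreeGroup.
Variable d : nat.

Definition letter : Type := ('I_d * bool)%type.
Implicit Types (a b : letter) (u v w : seq letter).

Definition inv_letter a : letter := (a.1, ~~ a.2).

Definition reduced w := sorted (fun a b => b != inv_letter a) w.

Lemma inv_letterK : involutive inv_letter.
Proof. by case=> i b; rewrite /inv_letter /= negbK. Qed.

Definition cons_reduced a w : seq letter :=
  if w is b :: w' then if b == inv_letter a then w' else a :: w else [:: a].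

Definition act_word v w := foldr cons_reduced w v.

Lemma reduced_behead a w : reduced (a :: w) -> reduced w.
Proof. exact: path_sorted. Qed.

Lemma cons_reducedP a w : reduced w -> reduced (cons_reduced a w).
Proof.
case: w => [|b w] //= bw; case: eqP => [_|/eqP ba]; first exact: path_sorted bw.
by rewrite /= ba.
Qed.

Lemma act_wordP v w : reduced w -> reduced (act_word v w).
Proof. by move=> rw; elim: v => //= a v; apply: cons_reducedP. Qed.

Lemma cons_reducedK a w :
  reduced w -> cons_reduced a (cons_reduced (inv_letter a) w) = w.
Proof.
case: w => [|b w] /=; first by rewrite eqxx.
rewrite inv_letterK; case: eqP => [->|_] /=; last by rewrite eqxx.
by case: w => [|c w] //= /andP[/negPf->].
Qed.

Lemma act_cons_reduced a v w : reduced v -> reduced w ->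
  act_word (cons_reduced a v) w = cons_reduced a (act_word v w).
Proof.
case: v => [|b v] //= rv rw; case: eqP => [->|//].
by rewrite cons_reducedK //; apply: act_wordP.
Qed.

Lemma act_wordA u v w : reduced v -> reduced w ->
  act_word (act_word u v) w = act_word u (act_word v w).
Proof.
move=> rv rw; elim: u => //= a u IHu.
by rewrite act_cons_reduced ?IHu //; apply: act_wordP.
Qed.

Lemma act_word_nil w : reduced w -> act_word w [::] = w.
Proof.
elim: w => //= a w IHw raw; rewrite IHw ?(reduced_behead raw) //.
by case: w raw {IHw} => [|b w] //= /andP[/negPf->].
Qed.

Definition inv_word w := map inv_letter (rev w).

Lemma inv_wordP w : reduced w -> reduced (inv_word w).
Proof.
rewrite /reduced /inv_word => rw; rewrite sorted_map rev_sorted.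
apply: sub_sorted rw => a b ba /=.
by rewrite inv_letterK eq_sym; apply: contra ba => /eqP->; rewrite eqxx.
Qed.

Lemma inv_wordK : involutive inv_word.
Proof.
by move=> w; rewrite /inv_word -map_rev revK -map_comp map_id_in // => a _;
   rewrite /= inv_letterK.
Qed.

Lemma act_inv_word u w : reduced w -> act_word (inv_word u) (act_word u w) = w.
Proof.
move=> rw; elim: u => //= a u IHu.
rewrite /inv_word rev_cons map_rcons /act_word foldr_rcons -/(act_word _ _).
have rx : reduced (act_word u w) by apply: act_wordP.
have := cons_reducedK (inv_letter a) rx; rewrite inv_letterK => ->.
exact: IHu.
Qed.

Record free_group := FreeGroup { word : seq letter; _ : reduced word }.

HB.instance Definition _ := [isSub for word].
HB.instance Definition _ := [Countable of free_group by <:].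

Lemma wordP (x : free_group) : reduced (word x).
Proof. exact: valP x. Qed.

Definition free_one : free_group := @FreeGroup [::] isT.
Definition free_mul (x y : free_group) : free_group :=
  FreeGroup (act_wordP (word x) (wordP y)).
Definition free_inv (x : free_group) : free_group :=
  FreeGroup (inv_wordP (wordP x)).

Lemma free_mulA : associative free_mul.
Proof.
by move=> x y z; apply/val_inj; rewrite /= act_wordA //; apply: wordP.
Qed.

Lemma free_1mul : left_id free_one free_mul.
Proof. by move=> x; apply/val_inj. Qed.

Lemma free_mul1 : right_id free_one free_mul.
Proof. by move=> x; apply/val_inj; rewrite /= act_word_nil //; apply: wordP. Qed.

Lemma free_mulV : left_inverse free_one free_inv free_mul.
Proof.
move=> x; apply/val_inj => /=.
by rewrite -{2}(act_word_nil (wordP x)) act_inv_word.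
Qed.

Lemma free_Vmul : right_inverse free_one free_inv free_mul.
Proof.
move=> x; have := free_mulV (free_inv x).
by have -> : free_inv (free_inv x) = x by apply/val_inj/inv_wordK.
Qed.

HB.instance Definition _ := isGroup.Build free_group
  free_mulA free_1mul free_mul1 free_mulV free_Vmul.

End FreeGroup.

(* Homeomorphisms are presented with their inverse, which they determine
   (homeoP). *)
Record homeo (T : topologicalType) := Homeo {
  homeo_fun :> T -> T;
  homeo_inv : T -> T;
  homeoK : cancel homeo_fun homeo_inv;
  homeoVK : cancel homeo_inv homeo_fun;
  homeo_cont : continuous homeo_fun;
  homeoV_cont : continuous homeo_inv }.

HB.instance Definition _ (T : topologicalType) := gen_eqMixin (homeo T).
HB.instance Definition _ (T : topologicalType) := gen_choiceMixin (homeo T).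

Section HomeoGroup.
Variable T : topologicalType.
Implicit Types f g h : homeo T.

Lemma homeoP f g : f =1 g -> f = g.
Proof.
case: f g => [f f' fK f'K cf cf'] [g g' gK g'K cg cg'] /= fg.
have {}fg : f = g by apply: funext.
subst g; have f'g' : f' = g'.
  by apply: funext => x; rewrite -{1}(g'K x) fK.
by subst g'; congr Homeo; apply: Prop_irrelevance.
Qed.

Definition homeo_one : homeo T :=
  @Homeo T id id (fun=> erefl) (fun=> erefl) (fun=> cvg_id) (fun=> cvg_id).

Definition homeo_inverse f : homeo T :=
  Homeo (@homeoVK T f) (@homeoK T f)
        (@homeoV_cont T f) (@homeo_cont T f).

Definition homeo_mul f g : homeo T :=
  @Homeo T (f \o g) (homeo_inv g \o homeo_inv f)
    (can_comp (@homeoK T f) (@homeoK T g))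
    (can_comp (@homeoVK T g) (@homeoVK T f))
    (fun x => continuous_comp (@homeo_cont T g x) (@homeo_cont T f (g x)))
    (fun x => continuous_comp (@homeoV_cont T f x)
                (@homeoV_cont T g (homeo_inv f x))).

Lemma homeo_mulA : associative homeo_mul.
Proof. by move=> f g h; apply: homeoP. Qed.
Lemma homeo_1mul : left_id homeo_one homeo_mul.
Proof. by move=> f; apply: homeoP. Qed.
Lemma homeo_mul1 : right_id homeo_one homeo_mul.
Proof. by move=> f; apply: homeoP. Qed.
Lemma homeo_mulV : left_inverse homeo_one homeo_inverse homeo_mul.
Proof. by move=> f; apply: homeoP => x /=; apply: homeoK. Qed.
Lemma homeo_Vmul : right_inverse homeo_one homeo_inverse homeo_mul.
Proof. by move=> f; apply: homeoP => x /=; apply: homeoVK. Qed.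

HB.instance Definition _ := isGroup.Build (homeo T)
  homeo_mulA homeo_1mul homeo_mul1 homeo_mulV homeo_Vmul.

End HomeoGroup.

(* The topology of uniform convergence; on a compact Hausdorff space the inverses
   then converge uniformly as well. *)
HB.instance Definition _ (T : uniformType) := Uniform.copy (homeo T)
  (initial_topology (fun f : homeo T => (f : T -> T) : {uniform T -> T})).

Section Topology.

Definition comeager (T : topologicalType) (A : set T) :=
  exists2 U : nat -> set T,
    (forall n, open (U n) /\ dense (U n)) & \bigcap_n U n `<=` A.

Lemma initial_continuousP (X Z : topologicalType) (S : choiceType)
  (p : S -> Z) (f : X -> S) :
  continuous (p \o f) -> continuous (f : X -> initial_topology p).
Proof.
move=> cpf; apply/continuousP => A [B oB <-]; rewrite -comp_preimage.
by move/continuousP : cpf; apply.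
Qed.

Lemma prod_continuousP (X : topologicalType) (I : choiceType)
  (K : I -> topologicalType) (f : X -> prod_topology K) :
  (forall i, continuous (fun x => f x i)) -> continuous f.
Proof.
move=> cf x; apply/cvg_sup => i.
exact: (@initial_continuousP _ _ _ (fun h : prod_topology K => h i)).
Qed.

End Topology.

Section Flows.
Variable G : groupType.

Record flow := Flow {
  flow_space :> topologicalType;
  flow_act : G -> flow_space -> flow_space;
  flow_cont : forall g, continuous (flow_act g);
  flow_act1 : forall x, flow_act 1 x = x;
  flow_actM : forall g h x, flow_act (g * h) x = flow_act g (flow_act h x) }.

Definition minimal (Z : flow) := forall C : set Z,
  closed C -> C !=set0 -> (forall g, flow_act g @` C `<=` C) -> C = setT.

Definition full_shift (A : finType) :=
  prod_topology (fun _ : G => discrete_topology A).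

HB.instance Definition _ (A : finType) := Topological.on (full_shift A).

Definition shift (A : finType) (g : G) (x : full_shift A) : full_shift A :=
  fun h => x (g^-1 * h).

Lemma shift_cont (A : finType) g : continuous (@shift A g).
Proof.
apply: prod_continuousP => h.
exact: (@proj_continuous G (fun=> discrete_topology A) (g^-1 * h)).
Qed.

Lemma shift1 (A : finType) (x : full_shift A) : shift 1 x = x.
Proof. by apply: funext => h; rewrite /shift invg1 mul1g. Qed.

Lemma shiftM (A : finType) g h (x : full_shift A) :
  shift (g * h) x = shift g (shift h x).
Proof. by apply: funext => k; rewrite /shift invgM mulgA. Qed.

(* The alphabet is automatically non-empty, since the subshift is. *)
Record subshift (A : finType) := Subshift {
  subshift_set :> set (full_shift A);
  subshift_closed : closed subshift_set;
  subshift_neq0 : subshift_set !=set0;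
  subshift_inv : forall g, shift g @` subshift_set `<=` subshift_set }.

Section SubshiftFlow.
Variables (A : finType) (X : subshift A).

Definition subshift_act (g : G) (x : X) : X :=
  exist _ (shift g (val x))
    (mem_set (subshift_inv (imageP (shift g) (set_mem (valP x))))).

Lemma subshift_act_cont g : continuous (subshift_act g).
Proof.
apply: initial_continuousP => x.
apply: (@continuous_comp _ _ _ set_val (@shift A g)).
  exact: initial_continuous.
exact: shift_cont.
Qed.

Lemma subshift_act1 x : subshift_act 1 x = x.
Proof. by apply/val_inj; rewrite /= shift1. Qed.

Lemma subshift_actM g h x :
  subshift_act (g * h) x = subshift_act g (subshift_act h x).
Proof. by apply/val_inj; rewrite /= shiftM. Qed.

Definition subshift_flow : flow :=
  Flow subshift_act_cont subshift_act1 subshift_actM.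

End SubshiftFlow.

Definition pattern (A : finType) : Type := {fmap G -> A}.

Definition cylinder (A : finType) (p : pattern A) : set (full_shift A) :=
  [set x | forall h : domf p, x (val h) = p h].

Definition is_SFT (A : finType) (X : subshift A) :=
  exists2 P : set (pattern A), finite_set P &
    subshift_set X =
      ~` \bigcup_(p in P) \bigcup_(g in [set: G]) shift g @` cylinder p.

Definition sofic (A : finType) (X : subshift A) :=
  exists (B : finType) (Y : subshift B) (f : Y -> full_shift A),
    [/\ is_SFT Y, continuous f,
        forall g y, f (subshift_act g y) = shift g (f y) & range f = X].

End Flows.

Local Open Scope order_scope.

Definition bool_morphism d d' (M : ctbDistrLatticeType d)
    (N : ctbDistrLatticeType d') (f : M -> N) : Prop :=
  [/\ {morph f : x y / x `&` y}, {morph f : x y / x `|` y},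
      {morph f : x / ~` x}, f \bot = \bot & f \top = \top].

Section BoolAlgebras.
Variable G : groupType.

Record boolGalg := BoolGalg {
  balg_disp : Order.disp_t;
  balg_sort :> ctbDistrLatticeType balg_disp;
  balg_act : G -> balg_sort -> balg_sort;
  balg_act_morph : forall g, bool_morphism (balg_act g);
  balg_act1 : forall x, balg_act 1 x = x;
  balg_actM : forall g h x, balg_act (g * h)%g x = balg_act g (balg_act h x) }.

Definition is_balg_iso (M N : boolGalg) (f : M -> N) : Prop :=
  [/\ bool_morphism f, forall g x, f (balg_act g x) = balg_act g (f x)
    & bijective f].

Definition balg_iso (M N : boolGalg) : Prop :=
  exists f : M -> N, is_balg_iso f.

Definition is_subalg (M : boolGalg) (S : set M) : Prop :=
  [/\ (forall x y, S x -> S y -> S (x `&` y)),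
      (forall x y, S x -> S y -> S (x `|` y)),
      (forall x, S x -> S (~` x)),
      S \bot /\ S \top &
      forall g x, S x -> S (balg_act g x)].

Record subalg (M : boolGalg) := Subalg {
  subalg_set :> set M;
  subalgP : is_subalg subalg_set }.

Definition finitely_generated (M : boolGalg) (S : subalg M) : Prop :=
  exists2 E : set M, finite_set E & subalg_set S = smallest (@is_subalg M) E.

Section SubalgStructure.
Variables (M : boolGalg) (S : subalg M).

Definition subalg_type : Type := set_type S.

HB.instance Definition _ := SubChoice.on subalg_type.

Lemma subalgI : {in (S : set M) &, forall x y, x `&` y \in (S : set M)}.
Proof.
by case: (subalgP S) => SI _ _ _ _ x y; rewrite !inE; apply: SI.
Qed.

Lemma subalgU : {in (S : set M) &, forall x y, x `|` y \in (S : set M)}.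
Proof.
by case: (subalgP S) => _ SU _ _ _ x y; rewrite !inE; apply: SU.
Qed.

Lemma subalg0 : \bot \in (S : set M).
Proof. by case: (subalgP S) => _ _ _ [S0 _] _; rewrite inE. Qed.

Lemma subalg1 : \top \in (S : set M).
Proof. by case: (subalgP S) => _ _ _ [_ S1] _; rewrite inE. Qed.

HB.instance Definition _ := Order.SubChoice_isTBSubLattice.Build
  _ _ _ (balg_disp M) subalg_type subalgI subalgU subalg0 subalg1.

Lemma subalg_meetUl :
  @left_distributive subalg_type subalg_type Order.meet Order.join.
Proof. by move=> x y z; apply/val_inj; rewrite /= meetUl. Qed.

HB.instance Definition _ := Order.Lattice_Meet_isDistrLattice.Build
  (balg_disp M) subalg_type subalg_meetUl.

Lemma subalg_compl_subproof (x : subalg_type) : ~` (val x) \in (S : set M).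
Proof.
by case: (subalgP S) => _ _ SC _ _; rewrite inE; apply/SC/set_mem/valP.
Qed.

Definition subalg_compl (x : subalg_type) : subalg_type :=
  exist _ (~` (val x)) (subalg_compl_subproof x).

Lemma subalg_joinxC (x : subalg_type) : x `|` subalg_compl x = \top.
Proof. by apply/val_inj; rewrite /= joinxC. Qed.

Lemma subalg_meetxC (x : subalg_type) : x `&` subalg_compl x = \bot.
Proof. by apply/val_inj; rewrite /= meetxC. Qed.

HB.instance Definition _ := Order.TBDistrLattice_hasComplement.Build
  (balg_disp M) subalg_type subalg_joinxC subalg_meetxC.

Lemma subalg_act_subproof g (x : subalg_type) : balg_act g (val x) \in (S : set M).
Proof.
by case: (subalgP S) => _ _ _ _ SG; rewrite inE; apply/SG/set_mem/valP.
Qed.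

Definition subalg_act g (x : subalg_type) : subalg_type :=
  exist _ (balg_act g (val x)) (subalg_act_subproof g x).

Lemma subalg_act_morph g : bool_morphism (subalg_act g).
Proof.
have [gI gU gC g0 g1] := @balg_act_morph M g.
by split=> [x y|x y|x||]; apply/val_inj => /=.
Qed.

Lemma subalg_act1 x : subalg_act 1 x = x.
Proof. by apply/val_inj; rewrite /= balg_act1. Qed.

Lemma subalg_actM g h x :
  subalg_act (g * h)%g x = subalg_act g (subalg_act h x).
Proof. by apply/val_inj; rewrite /= balg_actM. Qed.

Definition balg_of_subalg : boolGalg :=
  BoolGalg subalg_act_morph subalg_act1 subalg_actM.

End SubalgStructure.

(* The power set of a flow Z, with g acting on U by
   gU = {z | g^-1 z \in U}, and its subalgebra B(Z) of clopen sets. *)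
Section Clopens.
Variable Z : flow G.

Definition powerset_act (g : G) (U : set Z) : set Z := flow_act g^-1 @^-1` U.

Lemma powerset_actE g U : powerset_act g U = flow_act g @` U.
Proof.
apply/seteqP; split=> [z Uz|_ [z Uz <-]].
  by exists (flow_act g^-1 z) => //; rewrite -flow_actM mulgV flow_act1.
by rewrite /powerset_act /= -flow_actM mulVg flow_act1.
Qed.

Lemma powerset_act_morph g : bool_morphism (powerset_act g).
Proof. by []. Qed.

Lemma powerset_act1 U : powerset_act 1 U = U.
Proof.
rewrite powerset_actE; under eq_imagel do rewrite flow_act1.
by rewrite image_id.
Qed.

Lemma powerset_actM g h U :
  powerset_act (g * h)%g U = powerset_act g (powerset_act h U).
Proof. by apply/seteqP; split=> z; rewrite /powerset_act /= invgM flow_actM. Qed.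

Definition powerset_balg : boolGalg :=
  BoolGalg powerset_act_morph powerset_act1 powerset_actM.

Lemma clopen_subalg : @is_subalg powerset_balg (@clopen Z).
Proof.
split=> [||||g U cU]; [exact: clopenI|exact: clopenU| | |].
- by move=> U; apply: clopenC.
- by split; [exact: clopen0|exact: clopenT].
- by apply: preimage_clopen => //; apply: flow_cont.
Qed.

Definition clopen_balg : boolGalg := balg_of_subalg (Subalg clopen_subalg).

End Clopens.

Definition fraisse_limit (K : boolGalg -> Prop) (M : boolGalg) : Prop :=
  [/\ countable [set: M],
      (forall S : subalg M, finitely_generated S -> K (balg_of_subalg S)),
      (forall B, K B -> exists2 S : subalg M,
         finitely_generated S & balg_iso B (balg_of_subalg S)) &
      forall S T : subalg M, finitely_generated S -> finitely_generated T ->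
        forall f : balg_of_subalg S -> balg_of_subalg T, is_balg_iso f ->
        exists2 F : M -> M, is_balg_iso F &
          forall x : balg_of_subalg S, F (val x) = val (f x)].

Definition sofic_minimal_balg (B : boolGalg) : Prop :=
  exists (A : finType) (X : subshift G A),
    [/\ sofic X, minimal (subshift_flow X) &
        balg_iso B (clopen_balg (subshift_flow X))].

End BoolAlgebras.

Section Actions.
Variable G : groupType.

Definition Xi : set (prod_topology (fun _ : G => homeo cantor_space)) :=
  [set xi | {morph xi : g h / (g * h)%g}].

Section ActionFlow.
Variable xi : Xi.

Definition cantor_act (g : G) : cantor_space -> cantor_space := val xi g.

Lemma cantor_act_cont g : continuous (cantor_act g).
Proof. exact: homeo_cont. Qed.

Lemma cantor_actM g h x :
  cantor_act (g * h) x = cantor_act g (cantor_act h x).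
Proof. by rewrite /cantor_act (set_mem (valP xi)). Qed.

Lemma cantor_act1 x : cantor_act 1 x = x.
Proof.
have := cantor_actM 1 1 x; rewrite mulg1 => /(congr1 (homeo_inv (val xi 1%g))).
by rewrite /cantor_act !homeoK.
Qed.

Definition action_flow : flow G := Flow cantor_act_cont cantor_act1 cantor_actM.

End ActionFlow.

Definition Xi_min : set Xi := [set xi | minimal (action_flow xi)].

Definition conj_class (xi : Xi) : set Xi :=
  [set eta | exists f : homeo cantor_space,
     forall g, val eta g = (f * val xi g * f^-1)%g].

End Actions.

Arguments Xi G : clear implicits.
Arguments Xi_min G : clear implicits.
Arguments sofic_minimal_balg G : clear implicits.

(* Main.v *)
(* Let nearest neighbour tiles be given on the Cayley tree of the free group, and
   orient the tree towards one of its ends.  Letting each node determine its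
   children through a finite deterministic automaton produces tilings in which every
   finite pattern is determined by its top node; restricting the automaton to a
   strongly connected component makes the resulting system of tilings minimal.
   Hence every nonempty tile system receives a map from a minimal one.  Applied to
   recoded subshifts of finite type, this makes each minimal sofic subshift a factor
   of a minimal tile system; applied to fibre products, it yields amalgamation.

   Call a minimal flow good when each of its finite clopen partitions is refined by
   one coded by minimal tiles, and when such codings lift along maps between minimal
   tile systems.  A back-and-forth argument shows that the clopen algebra of a good
   flow is the Fraisse limit, and that good actions on the Cantor space are
   conjugate.  A good action is the inverse limit of a chain of minimal tile systems
   handling all lifting problems.  Goodness is a countable intersection of open
   conditions on the action; its conjugacy class is dense since every minimal action
   is approximated by minimal tiles, which code the good action by liftability. *)
Require Import Defs.
From mathcomp Require Import all_boot all_order finmap.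
From mathcomp Require Import all_classical topology cantor.

Set Implicit Arguments.
Unset Strict Implicit.
Unset Printing Implicit Defensive.

Import Order.Theory.
Local Open Scope classical_set_scope.
Local Open Scope group_scope.

(** * Terms over Boolean G-algebras and the back-and-forth argument *)

(** The fibre product of two minimal systems need not be minimal, and a minimal subsystem of a tile
    system might not be given by finitely many local rules. Trees remove this obstacle: each edge
    separates the tree, so once a node and the direction of its parent are fixed, its branches
    impose nothing on each other, and a finite-state choice of children copied from an existing
    tiling never gets stuck. The price is that the new tiles map to the old ones without being a
    subset of them. Hence lifting along maps of minimal tile systems, rather than inclusion, is the
    notion that runs through the argument. It is also stable under perturbation: codings are locally
    constant, being tiled involves the generators only, and tile systems with maps on their symbols
    are countable in number. On the algebraic side a partial isomorphism is a finite list of pairs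
    on which the same terms vanish; for clopen sets a nonvanishing term is a pattern realised by the
    itinerary of some point, and two codings onto the same minimal tile system realise the same
    patterns. *)

Section Terms.
Local Open Scope order_scope.
Variable G : groupType.
Implicit Types M N : boolGalg G.

(** Join and bottom are derived, which shortens inductions. A variable beyond the list evaluates to
    bottom, a value that embeddings preserve. *)
Inductive term :=
  | TVar of nat | TTop | TMeet of term & term | TCompl of term
  | TAct of G & term.

Fixpoint term_eval M (xs : seq M) t : M :=
  match t with
  | TVar n => nth \bot xs n
  | TTop => \top
  | TMeet t1 t2 => term_eval xs t1 `&` term_eval xs t2
  | TCompl t1 => ~` term_eval xs t1
  | TAct g t1 => balg_act g (term_eval xs t1)
  end.

Definition TBot := TCompl TTop.
Definition TJoin t1 t2 := TCompl (TMeet (TCompl t1) (TCompl t2)).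

Lemma term_eval_bot M (xs : seq M) : term_eval xs TBot = \bot.
Proof. by rewrite /= compl1. Qed.

Lemma term_eval_join M (xs : seq M) t1 t2 :
  term_eval xs (TJoin t1 t2) = term_eval xs t1 `|` term_eval xs t2.
Proof. by rewrite /= complI !complK. Qed.

(** Symmetric difference: it turns an equation between terms into the vanishing of one term. *)
Definition TDist t1 t2 := TJoin (TMeet t1 (TCompl t2)) (TMeet t2 (TCompl t1)).

Lemma term_eval_dist M (xs : seq M) t1 t2 :
  term_eval xs (TDist t1 t2) = \bot <-> term_eval xs t1 = term_eval xs t2.
Proof.
rewrite /TDist term_eval_join /=; split=> [/eqP|->]; last by rewrite meetxC joinxx.
rewrite join_eq0 => /andP[/eqP h1 /eqP h2].
set u := term_eval xs t1 in h1 h2 *; set v := term_eval xs t2 in h1 h2 *.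
have -> : u = u `&` v by rewrite -[LHS]meetx1 -(joinxC v) meetUr h1 joinx0.
by rewrite -[RHS]meetx1 -(joinxC u) meetUr h2 joinx0 meetC.
Qed.

(* Both lists then generate isomorphic subalgebras, through the matching of
   their entries. *)
Definition pequiv M N (p : seq (M * N)) :=
  forall t, term_eval (unzip1 p) t = \bot <-> term_eval (unzip2 p) t = \bot.

(** In a clopen algebra a term fails to vanish exactly when some point satisfies it, so the negated
    form is the convenient one to verify. *)
Lemma pequiv_neq M N (p : seq (M * N)) :
  (forall t, term_eval (unzip1 p) t <> \bot <-> term_eval (unzip2 p) t <> \bot) -> pequiv p.
Proof.
move=> h t; have [h1 h2] := h t; split=> e; apply: contrapT => /[dup].
  by move=> /h2.
by move=> /h1.
Qed.

Lemma pequiv_eq M N (p : seq (M * N)) : pequiv p -> forall t1 t2,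
  term_eval (unzip1 p) t1 = term_eval (unzip1 p) t2 <->
  term_eval (unzip2 p) t1 = term_eval (unzip2 p) t2.
Proof. by move=> pe t1 t2; rewrite -!term_eval_dist; exact: pe. Qed.

Definition swapp M N (p : seq (M * N)) := [seq (x.2, x.1) | x <- p].

Lemma unzip1_swapp M N (p : seq (M * N)) : unzip1 (swapp p) = unzip2 p.
Proof. by rewrite /unzip1 /swapp -map_comp. Qed.

Lemma unzip2_swapp M N (p : seq (M * N)) : unzip2 (swapp p) = unzip1 p.
Proof. by rewrite /unzip2 /swapp -map_comp. Qed.

Lemma swappK M N : cancel (@swapp M N) (@swapp N M).
Proof. by move=> p; rewrite /swapp -map_comp map_id_in // => -[]. Qed.

Lemma pequiv_swapp M N (p : seq (M * N)) : pequiv p -> pequiv (swapp p).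
Proof. by move=> pe t; rewrite unzip1_swapp unzip2_swapp; have [] := pe t. Qed.

Definition extendable M N := forall p : seq (M * N), pequiv p ->
  forall a, exists b, pequiv ((a, b) :: p).

Lemma pequiv_var M N (p : seq (M * N)) a b : (a, b) \in p ->
  exists t, term_eval (unzip1 p) t = a /\ term_eval (unzip2 p) t = b.
Proof.
move=> abp; exists (TVar (index (a, b) p)) => /=; split.
  by rewrite (nth_map (a, b)) ?index_mem // nth_index.
by rewrite (nth_map (a, b)) ?index_mem // nth_index.
Qed.

Section BackForth.
Variables M N : boolGalg G.
Hypotheses (cM : countable [set: M]) (cN : countable [set: N]).
Hypotheses (eMN : extendable M N) (eNM : extendable N M).
Variable p0 : seq (M * N).
Hypothesis pe0 : pequiv p0.

Let chain : exists P : nat -> seq (M * N), [/\ P 0%N = p0, forall n, pequiv (P n),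
   forall n x, x \in P n -> x \in P n.+1,
   forall a, exists n b, (a, b) \in P n & forall b, exists n a, (a, b) \in P n].
Proof.
have [f injf] := countable_injP _ cM; have [g injg] := countable_injP _ cN.
(* Stage [n] adds the elements that the two injections number [n], if there are any, so each element
   is treated at the stage given by its number. *)
have stepE n p : exists q, pequiv p -> [/\ pequiv q, {subset p <= q},
    forall a, f a = n -> exists b, (a, b) \in q &
    forall b, g b = n -> exists a, (a, b) \in q].
  have [pe|] := pselect (pequiv p); last by exists p.
  have [q [qe pq qf]] : exists q, [/\ pequiv q, {subset p <= q} &
      forall a, f a = n -> exists b, (a, b) \in q].
    have [[a fa]|na] := pselect (exists a, f a = n).
      have [b peb] := eMN pe a; exists ((a, b) :: p); split=> //.
        by move=> x xp; rewrite inE xp orbT.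
      move=> a' fa'; exists b; rewrite inE; apply/orP; left; apply/eqP.
      by congr pair; apply: injf; rewrite ?inE // fa fa'.
    by exists p; split=> // a fa; case: na; exists a.
  have [[b gb]|nb] := pselect (exists b, g b = n).
    have [a pea] := eNM (pequiv_swapp qe) b.
    exists ((a, b) :: q) => _; split=> //.
    - by have := pequiv_swapp pea; rewrite /= -/(swapp _) swappK.
    - by move=> x /pq xq; rewrite inE xq orbT.
    - by move=> a' /qf[b' ab']; exists b'; rewrite inE ab' orbT.
    - move=> b' gb'; exists a; rewrite inE; apply/orP; left; apply/eqP.
      by congr pair; apply: injg; rewrite ?inE // gb gb'.
  by exists q => _; split=> // b gb; case: nb; exists b.
have [st stP] := choice (fun np => stepE np.1 np.2).
pose P := fix P n := if n is m.+1 then st (m, P m) else p0.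
have PE n : pequiv (P n).
  by elim: n => // n IH /=; have [] := stP (n, P n) IH.
exists P; split=> //.
- by move=> n x xP; have [_ + _ _] := stP (n, P n) (PE n); apply.
- move=> a; have [_ _ /(_ a erefl)[b ab] _] := stP (f a, P (f a)) (PE (f a)).
  by exists (f a).+1, b.
- move=> b; have [_ _ _ /(_ b erefl)[a ab]] := stP (g b, P (g b)) (PE (g b)).
  by exists (g b).+1, a.
Qed.

(** An identity in [M] involves finitely many elements, so it lives in one list of the chain, where
    it is an equality of terms and passes to [N]. *)
Lemma back_forth : exists2 F : M -> N, is_balg_iso F &
  forall a b, (a, b) \in p0 -> F a = b.
Proof.
have [P [P0 PE Pm Pl Pr]] := chain.
have mono m n x : (m <= n)%N -> x \in P m -> x \in P n.
  by elim: n => [|n IH]; [rewrite leqn0 => /eqP->|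
     rewrite leq_eqVlt => /orP[/eqP->//|/IH mn /mn /Pm]].
have Rex a : exists b, exists n, (a, b) \in P n by have [n [b]] := Pl a; exists b, n.
have [F FP] := choice Rex.
have Fn (s : seq M) : exists n, forall a, a \in s -> (a, F a) \in P n.
  elim: s => [|a s [n IH]]; first by exists 0%N.
  have [m am] := FP a; exists (maxn m n) => c; rewrite inE => /orP[/eqP->|/IH].
    by apply: mono am; exact: leq_maxl.
  by apply: mono; exact: leq_maxr.
have uniq n a b c : (a, b) \in P n -> (a, c) \in P n -> b = c.
  move=> /pequiv_var[t [ta tb]] /pequiv_var[t' [t'a t'c]].
  by rewrite -tb -t'c; apply/(pequiv_eq (PE n)); rewrite ta t'a.
have FE a b n : (a, b) \in P n -> F a = b.
  move=> ab; have [m am] := FP a.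
  apply: (@uniq (maxn m n) a); first by apply: mono am; exact: leq_maxl.
  by apply: mono ab; exact: leq_maxr.
have inj : injective F.
  move=> a b Fab; have [n Pn] := Fn [:: a; b].
  have /pequiv_var[t [ta tb]] := Pn a (mem_head _ _).
  have /pequiv_var[t' [t'a t'b]] : (b, F b) \in P n by apply: Pn; rewrite !inE eqxx orbT.
  by rewrite -ta -t'a; apply/(pequiv_eq (PE n)); rewrite tb t'b.
exists F; last by move=> a b; rewrite -P0 => /FE.
split.
- split.
  + move=> a b; have [n Pn] := Fn [:: a; b; a `&` b].
    have /pequiv_var[t [ta tb]] := Pn a (mem_head _ _).
    have /pequiv_var[t' [t'a t'b]] : (b, F b) \in P n
      by apply: Pn; rewrite !inE eqxx !orbT.
    have /pequiv_var[u [ua ub]] : (a `&` b, F (a `&` b)) \in P n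
      by apply: Pn; rewrite !inE eqxx !orbT.
    rewrite -ub -tb -t'b -[RHS]/(term_eval _ (TMeet t t')).
    by apply/(pequiv_eq (PE n)); rewrite /= ta t'a.
  + move=> a b; have [n Pn] := Fn [:: a; b; a `|` b].
    have /pequiv_var[t [ta tb]] := Pn a (mem_head _ _).
    have /pequiv_var[t' [t'a t'b]] : (b, F b) \in P n
      by apply: Pn; rewrite !inE eqxx !orbT.
    have /pequiv_var[u [ua ub]] : (a `|` b, F (a `|` b)) \in P n
      by apply: Pn; rewrite !inE eqxx !orbT.
    rewrite -ub -tb -t'b -term_eval_join.
    by apply/(pequiv_eq (PE n)); rewrite term_eval_join ta t'a.
  + move=> a; have [n Pn] := Fn [:: a; ~` a].
    have /pequiv_var[t [ta tb]] := Pn a (mem_head _ _).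
    have /pequiv_var[u [ua ub]] : (~` a, F (~` a)) \in P n
      by apply: Pn; rewrite !inE eqxx !orbT.
    rewrite -ub -tb -[RHS]/(term_eval _ (TCompl t)).
    by apply/(pequiv_eq (PE n)); rewrite /= ta.
  + have [n Pn] := Fn [:: \bot]; have /pequiv_var[t [ta <-]] := Pn \bot (mem_head _ _).
    by apply/(PE n).
  + have [n Pn] := Fn [:: \top]; have /pequiv_var[t [ta <-]] := Pn \top (mem_head _ _).
    by rewrite -[RHS]/(term_eval (unzip2 (P n)) TTop); apply/(pequiv_eq (PE n)).
- move=> g a; have [n Pn] := Fn [:: a; balg_act g a].
  have /pequiv_var[t [ta tb]] := Pn a (mem_head _ _).
  have /pequiv_var[u [ua ub]] : (balg_act g a, F (balg_act g a)) \in P n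
    by apply: Pn; rewrite !inE eqxx !orbT.
  rewrite -ub -tb -[RHS]/(term_eval _ (TAct g t)).
  by apply/(pequiv_eq (PE n)); rewrite /= ta.
- rewrite -setTT_bijective; split=> //; first by move=> a b _ _; exact: inj.
  by move=> b _; have [n [a ab]] := Pr b; exists a => //; exact: FE ab.
Qed.

End BackForth.
End Terms.

(** * Words in the free group, tile systems and tree automata *)

Section FreeGroupWords.
Variable d : nat.
Local Notation G := (free_group d).
Implicit Types (a b s t : letter d) (g h w : G).

Definition gen a : G := @FreeGroup d [:: a] isT.

Lemma word_gen a g : word (gen a * g) = cons_reduced a (word g).
Proof. by []. Qed.

Lemma gen_inv a : gen (inv_letter a) = (gen a)^-1.
Proof. exact/val_inj. Qed.

Lemma genKV a g : gen a * (gen (inv_letter a) * g) = g.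
Proof. by rewrite gen_inv mulVKg. Qed.

Definition wmul (ws : seq (letter d)) g := foldr (fun a g => gen a * g) g ws.

Lemma wmul_word w g : wmul (word w) g = w * g.
Proof.
have wmulE ws : wmul ws g = wmul ws 1 * g.
  by elim: ws => [|a ws IH] /=; rewrite ?mul1g // IH mulgA.
rewrite wmulE; congr (_ * _); apply/val_inj; case: w => w /= rw.
elim: w rw => //= a w IH raw; rewrite IH ?(reduced_behead raw) //.
by case: w raw {IH} => [|b w] //= /andP[/negPf->].
Qed.

Lemma word_ind (P : G -> Prop) : P 1 ->
  (forall a w, size (word (gen a * w)) = (size (word w)).+1 ->
     word (gen a * w) = a :: word w -> P w -> P (gen a * w)) ->
  forall w, P w.
Proof.
move=> P1 PS [w rw]; elim: w rw => [|a w IH] raw.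
  by have -> : FreeGroup raw = 1 by exact/val_inj.
have rw := reduced_behead raw.
have waE : word (gen a * FreeGroup rw) = a :: w.
  by rewrite word_gen /=; case: w raw {IH rw} => [|b w] //= /andP[/negPf->].
have -> : FreeGroup raw = gen a * FreeGroup rw by exact/val_inj.
by apply: PS => //; rewrite waE.
Qed.

Fixpoint wball n : seq G :=
  if n is m.+1
  then wball m ++ [seq gen a * g | a <- enum {: 'I_d * bool}, g <- wball m]
  else [:: 1].

Lemma size_cons_reduced a (ws : seq (letter d)) :
  size (cons_reduced a ws) <= (size ws).+1 /\ size ws <= (size (cons_reduced a ws)).+1.
Proof.
by case: ws => [|b ws] //=; case: ifP => _ //=; split=> //; exact: leqW.
Qed.

Lemma size_genM a g : size (word (gen a * g)) <= (size (word g)).+1.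
Proof. by rewrite word_gen; have [] := size_cons_reduced a (word g). Qed.

Lemma mem_wball n w : (w \in wball n) = (size (word w) <= n).
Proof.
apply/idP/idP.
  elim: n w => [|n IH] w /=; first by rewrite inE => /eqP->.
  rewrite mem_cat => /orP[/IH/leqW//|/allpairsP[[a g] /= [_ /IH gn ->]]].
  exact: leq_trans (size_genM _ _) _.
elim/word_ind: w n => [|a w saw waE IH] n.
  by move=> _; elim: n => [|n IH] /=; rewrite ?inE // mem_cat IH.
rewrite saw; case: n => // n /IH wn /=; rewrite mem_cat; apply/orP; right.
by apply/allpairsP; exists (a, w); rewrite mem_enum.
Qed.

Lemma size_mulg g h : size (word (g * h)) <= size (word g) + size (word h).
Proof.
elim/word_ind: g => [|a g sag _ IH]; first by rewrite mul1g.
by rewrite sag -mulgA addSn; apply: leq_trans (size_genM _ _) _.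
Qed.

(* [okw s ws]: the path spelled by [ws], read from its last letter on, does not
   start in the direction [s]. *)
Definition okw s (ws : seq (letter d)) :=
  if ws is a :: ws' then last a ws' != s else true.

(** Cancellation in [v * w] consumes [w] from its first letter on, and [v] is too short to reach the
    last letter, which is the first step of the path. *)
Lemma okw_cancel s w v : size (word v) < size (word w) -> okw s (word w) ->
  okw s (word (v * w)).
Proof.
have [->|] := eqVneq (word w) [::]; first by rewrite ltn0.
move=> wn sv okww.
suff : [/\ word (v * w) != [::], okw s (word (v * w)) &
    size (word w) <= size (word (v * w)) + size (word v)] by move=> [].
elim/word_ind: v sv => [_|a v sav waE IH].
  by rewrite mul1g addn0.
rewrite sav => sv; have [nn ok sz] := IH (ltnW sv).
rewrite -mulgA word_gen.
(* With at least two letters present, losing the first one keeps the last. *)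
have : 1 < size (word (v * w)).
  rewrite -(ltn_add2r (size (word v))); apply: leq_trans sz; by rewrite add1n.
case: (word (v * w)) ok sz {nn IH} => [|b [|c u]] //= ok sz _.
case: ifP => _ /=; split=> //.
  by move: sz; rewrite !addnS !addSn.
by apply: leq_trans sz _; rewrite !addSn addnS !ltnS; apply: leqW; exact: leqnSn.
Qed.

Lemma inv_letter_neq a : inv_letter a != a.
Proof. by case: a => i []; rewrite /inv_letter xpair_eqE /= andbF. Qed.

(** Repeating [inv_letter s] never cancels and never starts in the direction [s]. *)
Lemma far_path s n : exists w, size (word w) = n.+1 /\ okw s (word w).
Proof.
have rw : reduced (nseq n.+1 (inv_letter s)).
  elim: n => //= n IH; rewrite /= inv_letterK IH andbT.
  exact: inv_letter_neq.
exists (FreeGroup rw) => /=; rewrite size_nseq; split=> //.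
have -> : last (inv_letter s) (nseq n (inv_letter s)) = inv_letter s.
  by elim: n {rw}.
exact: inv_letter_neq.
Qed.

End FreeGroupWords.

Section Tiles.
Variable d : nat.
Local Notation G := (free_group d).
Implicit Types (a b s t : letter d) (g h w : G).

(* A finite list of allowed adjacencies, [(i, (u, v))] allowing [u] at [g] and
   [v] at [s_i g].  The alphabet is [nat], but when [d > 0] only the finitely many
   symbols listed can occur in a configuration.  Adjacency is along left
   multiplication: a point [y] of the full shift corresponds to [fun g => y g^-1]. *)
Definition tiles := seq ('I_d * (nat * nat)).
Implicit Types (T : tiles) (x y : G -> nat).

Definition conf T x := forall g i, (i, (x g, x (gen (i, false) * g))) \in T.

Definition adj T a u v := if a.2 then (a.1, (v, u)) \in T else (a.1, (u, v)) \in T.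

Lemma adjV T a u v : adj T (inv_letter a) u v = adj T a v u.
Proof. by case: a => i []. Qed.

Lemma confP T x : conf T x <-> forall a g, adj T a (x g) (x (gen a * g)).
Proof.
split=> [cx [i [|]] g|h g i]; last exact: (h (i, false)).
  by rewrite /adj /= -{2}(genKV (i, false) g); exact: cx.
exact: cx.
Qed.

Definition translate h x : G -> nat := fun g => x (g * h).

Lemma conf_translate T x h : conf T x -> conf T (translate h x).
Proof. by move=> cx g i; rewrite /translate -mulgA; apply: cx. Qed.

Definition agree n x y := forall w, size (word w) <= n -> x w = y w.

Definition min_tiles T := (exists x, conf T x) /\
  forall x y, conf T x -> conf T y -> forall n, exists g, agree n (translate g x) y.

Definition tiles_map T' T (pi : nat -> nat) := forall y, conf T' y -> conf T (pi \o y).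

Definition symbols T := flatten [seq [:: e.2.1; e.2.2] | e <- T].

Variable i0 : 'I_d.

Lemma conf_symbols T x g : conf T x -> x g \in symbols T.
Proof.
move=> /(_ g i0) xT; apply/flattenP; exists [:: x g; x (gen (i0, false) * g)].
  by apply/mapP; exists (i0, (x g, x (gen (i0, false) * g))).
exact: mem_head.
Qed.

End Tiles.

Section Automaton.
Variable d : nat.
Variable i0 : 'I_d.
Local Notation G := (free_group d).
Implicit Types (a b s t : letter d) (g h w : G).

(* A deterministic tree automaton: a node in state [q] has its parent in the
   direction [par q], and its child in any other direction [t] is in the state
   [delta q t].  A configuration is determined below each node by its state, so
   that strong connectedness implies minimality. *)
Variables (Q : finType) (par : Q -> letter d) (delta : Q -> letter d -> Q).
Hypothesis par_delta : forall q t, t != par q -> par (delta q t) = inv_letter t.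

Definition child : rel Q := [rel q r |
  [exists t : 'I_d * bool, (t != par q) && (delta q t == r)]].

(** One endpoint of an edge is the child of the other; the disjuncts are the two orientations. *)
Definition trans a q r := ((a != par q) && (r == delta q a)) ||
  ((inv_letter a != par r) && (q == delta r (inv_letter a))).

Definition qconf (x : G -> Q) := forall a g, trans a (x g) (x (gen a * g)).

Lemma transV a q r : trans (inv_letter a) q r = trans a r q.
Proof. by rewrite /trans inv_letterK orbC. Qed.

Lemma childP q a : a != par q -> child q (delta q a).
Proof. by move=> aq; apply/existsP; exists a; rewrite aq eqxx. Qed.

(** Otherwise [g] would be the child across this edge and would have its parent in the direction
    [a]. *)
Lemma qconf_down x a g : qconf x -> a != par (x g) -> x (gen a * g) = delta (x g) a.
Proof.
move=> cx aq; have /orP[/andP[_ /eqP//]|/andP[ar /eqP qE]] := cx a g.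
by move: aq; rewrite qE par_delta // inv_letterK eqxx.
Qed.

(** A reduced path that does not leave through the parent descends at every step, since turning back
    would be a cancellation. Its states are therefore computed from the first one by [delta]. *)
Lemma qconf_below x y g h ws : qconf x -> qconf y -> x g = y h -> reduced ws ->
  okw (par (x g)) ws -> x (wmul ws g) = y (wmul ws h) /\
  (if ws is a :: _ then par (x (wmul ws g)) = inv_letter a else True).
Proof.
move=> cx cy xgh; elim: ws => // a ws IH raws ok.
have {IH} [] := IH (reduced_behead raws); first by case: ws ok raws.
case: ws ok raws => [/= ok _|b ws ok raws] e p.
  by rewrite !qconf_down // -?xgh // par_delta.
have ab : a != par (x (wmul (b :: ws) g)).
  rewrite p; move: raws => /= /andP[+ _]; apply: contra => /eqP->.
  by rewrite inv_letterK.
have ab' : a != par (y (wmul (b :: ws) h)) by rewrite -e.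
have -> : x (wmul [:: a, b & ws] g) = delta (x (wmul (b :: ws) g)) a.
  exact: qconf_down cx ab.
have -> : y (wmul [:: a, b & ws] h) = delta (y (wmul (b :: ws) h)) a.
  exact: qconf_down cy ab'.
by rewrite e par_delta.
Qed.

Lemma qconf_reach x g q : qconf x -> connect child (x g) q -> exists h, x h = q.
Proof.
move=> cx /connectP[p]; elim: p g => [|r p IH] g /=; first by move=> _ ->; exists g.
move=> /andP[/existsP[t /andP[tp /eqP tr]] pp] ql.
by apply: (IH (gen t * g)); rewrite qconf_down // tr.
Qed.

(** A state that reaches as few states as possible works: whatever it reaches reaches a subset of
    the same size, hence the same set. *)
Lemma strong_component (q0 : Q) : exists q1, forall q, connect child q1 q ->
  connect child q q1.
Proof.
have [q1 _ q1P] := @arg_minnP _ q0 predT (fun q => #|connect child q|) isT.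
exists q1 => q q1q.
have sub : connect child q \subset connect child q1.
  by apply/fintype.subsetP => r; rewrite !unfold_in; exact: connect_trans.
have cE : #|connect child q| = #|connect child q1|.
  by apply/eqP; rewrite eqn_leq q1P // andbT subset_leq_card.
have /(subset_cardP cE)/(_ q1) := sub.
by rewrite /in_mem /= connect0.
Qed.

Lemma automaton_min_tiles (q0 : Q) : exists T : tiles d, min_tiles T /\
  forall y, conf T y -> exists2 z : G -> Q, y = choice.pickle \o z &
    qconf z /\ forall g q, connect child (z g) q -> exists h, z h = q.
Proof.
have [q1 q1P] := strong_component q0.
pose C := [pred q | connect child q1 q].
have CC p q : p \in C -> q \in C -> connect child p q.
  by rewrite !inE => /q1P; exact: connect_trans.
have Cdelta q a : q \in C -> a != par q -> delta q a \in C.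
  rewrite !inE => qC aq; apply: connect_trans qC _; apply: connect1; exact: childP.
pose T : tiles d := [seq (e.1, (choice.pickle e.2.1, choice.pickle e.2.2)) |
  e <- enum [pred e : 'I_d * (Q * Q) | [&& e.2.1 \in C, e.2.2 \in C &
             trans (e.1, false) e.2.1 e.2.2]]].
have TP i u v : (i, (u, v)) \in T -> exists q r,
    [/\ u = choice.pickle q, v = choice.pickle r, q \in C, r \in C & trans (i, false) q r].
  case/mapP => -[j [q r]]; rewrite mem_enum unfold_in /= => /and3P[qC rC tr].
  by move=> [-> -> ->]; exists q, r.
have TE i q r : q \in C -> r \in C -> trans (i, false) q r ->
    (i, (choice.pickle q, choice.pickle r)) \in T.
  move=> qC rC tr; apply/mapP; exists (i, (q, r)) => //.
  by rewrite mem_enum unfold_in /=; apply/and3P.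
have confT (z : G -> Q) : qconf z -> (forall g, z g \in C) -> conf T (choice.pickle \o z).
  by move=> cz zC g i; apply: TE.
have Tconf y : conf T y -> exists2 z : G -> Q, y = choice.pickle \o z &
    qconf z /\ forall g, z g \in C.
  move=> cy.
  have zex g : exists q, y g = choice.pickle q /\ q \in C.
    by have [q [r [-> _ qC _ _]]] := TP _ _ _ (cy g i0); exists q.
  have [z zP] := choice zex.
  exists z; first by apply: funext => g /=; have [] := zP g.
  split; last by move=> g; have [] := zP g.
  move=> [i e] g.
  have cz h : trans (i, false) (z h) (z (gen (i, false) * h)).
    have [q [r [yq yr _ _]]] := TP _ _ _ (cy h i).
    have [zh _] := zP h; have [zh' _] := zP (gen (i, false) * h).
    have inj : injective (@choice.pickle Q) by exact: pcan_inj choice.pickleK.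
    by rewrite (inj _ _ (etrans (esym zh) yq)) (inj _ _ (etrans (esym zh') yr)).
  case: e; last exact: cz.
  by rewrite -(transV (i, true)) -{2}(genKV (i, false) g); exact: cz.
exists T; split; last first.
  move=> y /Tconf[z yz [cz zC]]; exists z => //; split=> // g q; exact: qconf_reach.
split.
  (* The automaton has no rule for going up. A child of [q] leads back to [q] inside [C], and the
     last step of that return provides a parent state for [q]. *)
  have predE q : exists p, q \in C ->
      [/\ p \in C, inv_letter (par q) != par p & delta p (inv_letter (par q)) = q].
    have [qC|] := boolP (q \in C); last by exists q.
    pose t := inv_letter (par q).
    have tq : t != par q by exact: inv_letter_neq.
    have /connectP[p pp ql] := CC _ _ (Cdelta _ _ qC tq) qC.
    have ch := childP tq.
    have [r rC] : exists2 r, r \in C & child r q.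
      case/lastP: p pp ql => [|p r] pp ql; first by exists q; rewrite // {2}ql.
      move: pp; rewrite rcons_path last_rcons in ql *; rewrite -ql => /andP[pp ?].
      exists (last (delta q t) p) => //.
      have := Cdelta _ _ qC tq; rewrite !inE => /connect_trans; apply.
      by apply/connectP; exists p.
    case/existsP => s /andP[sr /eqP sE].
    by exists r => _; rewrite -sE par_delta // inv_letterK.
  have [pr prP] := choice predE.
  pose nb q a := if a != par q then delta q a else pr q.
  have nbC q a : q \in C -> nb q a \in C.
    by rewrite /nb => qC; case: ifP => aq; [exact: Cdelta|have [] := prP _ qC].
  have nbT q a : q \in C -> trans a q (nb q a).
    move=> qC; rewrite /nb; case: ifP => [aq|/negbFE/eqP ->].
      by rewrite /trans aq eqxx.
    by have [_ h1 h2] := prP _ qC; rewrite /trans h1 h2 !eqxx orbT.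
  pose z g := foldr (fun a q => nb q a) q1 (word g).
  have zC g : z g \in C.
    rewrite /z; elim: (word g) => [|a ws IH] /=; last exact: nbC.
    by rewrite inE connect0.
  exists (choice.pickle \o z); apply: confT => // a g.
  have foldC ws : foldr (fun a q => nb q a) q1 ws \in C.
    elim: ws => [|b ws IH] /=; last exact: nbC.
    by rewrite inE connect0.
  rewrite /z word_gen; case: (word g) => [|b ws] /=.
    by apply: nbT; rewrite inE connect0.
  case: eqP => [->|_] /=; first by rewrite -transV; apply: nbT.
  exact/nbT/nbC.
move=> x y /Tconf[{}x -> [cx xC]] /Tconf[{}y -> [cy yC]] n.
suff [g gP] : exists g, forall w, size (word w) <= n -> x (w * g) = y w.
  by exists g => w wn; rewrite /translate /= gP.
elim: n y cy yC => [|n IH] y cy yC.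
  have [g xg] := qconf_reach (g := 1) cx (CC _ _ (xC 1) (yC 1)).
  exists g => w; rewrite leqn0 size_eq0 => /eqP w1.
  by have -> : w = 1 by [exact/val_inj]; rewrite mul1g.
(* The induction hypothesis is centred at the parent of the root. A path of length at most [n.+1]
   either starts towards the parent and ends in that smaller ball, or runs below the root, where the
   state decides. *)
pose p := par (y 1).
have [||g' g'P] := IH (fun w => y (w * gen p)).
- by move=> a g; rewrite -mulgA; exact: cy.
- by move=> g.
have xg' : x g' = y (gen p) by have := g'P 1 isT; rewrite !mul1g.
have [pp yp] : inv_letter p != par (y (gen p)) /\ y 1 = delta (y (gen p)) (inv_letter p).
  have /orP[/andP[]|/andP[h1 /eqP h2]] := cy p 1; first by rewrite eqxx.
  by rewrite mulg1 in h1 h2.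
have xg : x (gen (inv_letter p) * g') = y 1.
  by rewrite qconf_down // xg' // -yp.
exists (gen (inv_letter p) * g') => w wn.
have [ok|] := boolP (okw p (word w)).
  have [] := qconf_below (ws := word w) cx cy xg (wordP w); first by rewrite xg.
  by rewrite !wmul_word mulg1.
move=> nok.
have {nok} [w' [ww' w'n]] : exists w', w = w' * gen p /\ (size (word w')) <= n.
  case: w wn nok => ws rws /= wn.
  case/lastP: ws rws wn => // ws a rws; rewrite size_rcons ltnS => wn nok.
  have rws' : reduced ws by case: (ws) rws => //= b u; rewrite rcons_path => /andP[].
  exists (FreeGroup rws'); split=> //.
  have -> : p = a.
    by case: (ws) nok => [|b u] /=; rewrite ?last_rcons negbK => /eqP.
  rewrite -[LHS](etrans (wmul_word (FreeGroup rws) 1) (mulg1 _)).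
  rewrite /= /wmul foldr_rcons mulg1; exact: (wmul_word (FreeGroup rws') (gen a)).
rewrite ww' -mulgA genKV; exact: g'P.
Qed.
End Automaton.

(** * Locally constant functions and compactness *)

Section LocallyConstant.

(** Continuity into a discrete space, without a topology on the target. *)
Definition locconst (X : topologicalType) (W : Type) (f : X -> W) :=
  forall x, nbhs x [set y | f y = f x].

Lemma locconst_open (X : topologicalType) W (f : X -> W) (A : set W) :
  locconst f -> open (f @^-1` A).
Proof.
by move=> lf; rewrite openE => x Ax; apply: filterS (lf x) => y /= ->.
Qed.

Lemma locconst_clopen (X : topologicalType) W (f : X -> W) (A : set W) :
  locconst f -> clopen (f @^-1` A).
Proof.
move=> lf; split; first exact: locconst_open.
by rewrite -openC; exact: (locconst_open (~` A)).
Qed.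

Lemma locconst_comp (X : topologicalType) W W' (f : X -> W) (h : W -> W') :
  locconst f -> locconst (h \o f).
Proof. by move=> lf x; apply: filterS (lf x) => y /= ->. Qed.

Lemma locconst_pair (X : topologicalType) W W' (f : X -> W) (f' : X -> W') :
  locconst f -> locconst f' -> locconst (fun x => (f x, f' x)).
Proof.
move=> lf lf' x; apply: filterS (filterI (lf x) (lf' x)) => y [/= -> ->]; exact: erefl.
Qed.

Lemma locconst_map (X : topologicalType) (I : eqType) W (f : I -> X -> W) (s : seq I) :
  (forall i, locconst (f i)) -> locconst (fun x => [seq f i x | i <- s]).
Proof.
move=> lf x; elim: s => [|i s IH] /=; first exact: filterE.
by apply: filterS (filterI (lf i x) IH) => y /= [-> ->].
Qed.

Lemma locconst_cont (X Y : topologicalType) W (f : Y -> W) (h : X -> Y) :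
  locconst f -> continuous h -> locconst (f \o h).
Proof. by move=> lf ch x; have := ch x _ (lf (h x)). Qed.

Lemma clopen_locconst (X : topologicalType) (U : set X) :
  clopen U -> locconst (fun x => `[< U x >]).
Proof.
move=> [oU cU] x; have [Ux|nUx] := asboolP (U x).
  have : nbhs x U by apply: open_nbhs_nbhs.
  by apply: filterS => y Uy /=; apply/asboolP.
have : nbhs x (~` U) by apply: open_nbhs_nbhs; split=> //; rewrite openC.
by apply: filterS => y Uy /=; apply/asboolP.
Qed.

Lemma coord_locconst (I : choiceType) (K : I -> discreteTopologicalType) i :
  locconst (fun x : prod_topology K => x i).
Proof.
move=> x; have := @proj_continuous I K i x [set x i].
by apply; exact: discrete_set1.
Qed.

Lemma compact_nested (X : topologicalType) (C : set X) (A : nat -> set X) :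
  compact C -> (forall n, closed (A n)) -> (forall n, A n.+1 `<=` A n) ->
  (forall n, C `&` A n !=set0) -> exists2 x, C x & forall n, A n x.
Proof.
move=> cC cA dA neA; have [u uP] := choice neA.
have [|x [Cx clx]] := cC (u @ \oo) _; first by exists 0%N => // n _; have [] := uP n.
exists x => // n; rewrite (iffLR (closure_id _) (cA n)) => B.
suff Fn : (u @ \oo) (A n) by move=> nB; exact: clx Fn nB.
have mono m : (n <= m)%N -> A m `<=` A n.
  elim: m => [|m IH]; first by rewrite leqn0 => /eqP->.
  rewrite leq_eqVlt => /orP[/eqP->//|/IH]; exact: subset_trans.
by exists n => // m /= nm; apply: (mono _ nm); have [] := uP m.
Qed.

Lemma compact_locconst (X : topologicalType) (f : X -> nat) :
  compact [set: X] -> locconst f -> exists k, forall x, (f x < k)%N.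
Proof.
move=> cX lf; apply/not_existsP => nk.
have [|||x _ /(_ (f x).+1)/=] := @compact_nested X setT (fun n => f @^-1` [set m | n <= m]%N) cX.
- by move=> n; have [] := locconst_clopen [set m | n <= m]%N lf.
- by move=> n x /= /ltnW.
- by move=> n; have /existsNP[x /negP] := nk n; rewrite -leqNgt => nx; exists x.
- by rewrite ltnn.
Qed.

(** Tychonoff for finite sets of symbols; dependence on finitely many coordinates makes each
    condition closed. *)
Lemma box_nested (I : choiceType) (K : I -> seq nat) (A : nat -> set (I -> nat)) :
  (forall n, A n.+1 `<=` A n) ->
  (forall n, exists s : seq I, forall f f', (forall i, i \in s -> f i = f' i) ->
     A n f -> A n f') ->
  (forall n, exists2 f, forall i, f i \in K i & A n f) ->
  exists2 f, forall i, f i \in K i & forall n, A n f.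
Proof.
move=> dA fA neA.
pose X := prod_topology (fun _ : I => discrete_topology nat).
have cK : compact [set f : X | forall i, [set` K i] (f i)].
  apply: (@tychonoff I (fun _ => discrete_topology nat) (fun i => [set` K i])) => i.
  by apply: finite_compact; exact: finite_seq.
have [||n|f fK fA'] := compact_nested (A := A : nat -> set X) cK.
- move=> n; have [s sP] := fA n.
  have lf : locconst (fun x : X => [seq x i | i <- s]).
    apply: locconst_map => i; exact: (@coord_locconst I (fun _ => discrete_topology nat)).
  have [_] := locconst_clopen [set u | exists2 f, A n f & u = [seq f i | i <- s]] lf.
  congr closed; apply/seteqP; split=> f /=.
    by case=> f' Af' /esym/eq_in_map fE; apply: sP Af' => i /fE.
  by move=> Af; exists f.
- exact: dA.
- by have [f fK Af] := neA n; exists f.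
- by exists f.
Qed.

End LocallyConstant.

(** * Minimal tile systems: existence, refinement, fibre products *)

Section MinimalTiles.
Variable d : nat.
Variable i0 : 'I_d.
Local Notation G := (free_group d).
Implicit Types (a s t : letter d) (g h w : G) (T : tiles d).

(* The automaton copies [x], the states being positions in a finite union of balls
   around representatives of the symbols; leaving it, one jumps to the
   representative of the symbol just read. *)
Lemma minimal_tiles T x N : conf T x -> exists T' pi,
  [/\ min_tiles T', tiles_map T' T pi &
    forall b, (forall g s, exists w, [/\ size (word w) <= N, okw s (word w) &
                 x (w * g) = b]) ->
      forall y, conf T' y -> exists h, pi (y h) = b].
Proof.
move=> cx.
have repE u : exists g, (exists h, x h = u) -> x g = u.
  by have [[h hu]|n] := pselect (exists h, x h = u); [exists h | exists 1].
have [rep repP] := choice repE.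
have {}repP g : x (rep (x g)) = x g by apply: repP; exists g.
(* Radius [N] lets a copy that starts at a representative follow any word of length at most [N]
   without a jump; this is what makes [b] appear. *)
pose B : seq G := [seq v * rep u | v <- wball d N, u <- symbols T].
have BP g v : size (word v) <= N -> v * rep (x g) \in B.
  move=> vN; apply/allpairsP; exists (v, x g) => /=.
  by rewrite mem_wball vN; split=> //; exact: conf_symbols.
have repB g : rep (x g) \in B by have := BP g 1 isT; rewrite mul1g.
pose Q : finType := (seq_sub B * ('I_d * bool))%type.
pose target (q : Q) t : G :=
  if gen t * val q.1 \in B then gen t * val q.1 else rep (x (gen t * val q.1)).
pose par (q : Q) : letter d := q.2.
pose delta (q : Q) t : Q := (insubd q.1 (target q t), inv_letter t).
have targetB q t : target q t \in B by rewrite /target; case: ifP.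
have valD q t : val (delta q t).1 = target q t by rewrite /= val_insubd targetB.
pose lab (q : Q) := x (val q.1).
(* A jump lands on a representative of the symbol just read, so labels continue as in [x] and
   adjacent labels stay allowed. *)
have labD q t : lab (delta q t) = x (gen t * val q.1).
  by rewrite /lab valD /target; case: ifP.
have parD q t : t != par q -> par (delta q t) = inv_letter t := fun _ => erefl.
pose q0 : Q := (SeqSub (repB 1), (i0, false)).
have [T' [mT' T'P]] := automaton_min_tiles i0 parD q0.
have [pi piE] : exists pi : nat -> nat, forall q, pi (choice.pickle q) = lab q.
  exists (fun u => if choice.unpickle u is Some q then lab q else 0) => q.
  by rewrite choice.pickleK.
exists T', pi; split=> //.
- move=> y /T'P[z -> [cz _]]; apply/confP => a g.
  have yE h : (pi \o (choice.pickle \o z)) h = lab (z h) by exact: piE.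
  rewrite !yE.
  have cxa := (confP T x).1 cx.
  have /orP[/andP[_ /eqP->]|/andP[_ /eqP zE]] := cz a g; first by rewrite labD; exact: cxa.
  by rewrite zE -adjV labD; exact: cxa.
- move=> b bP y /T'P[z -> [cz _]].
  (* The descent along [ws] shadows the path in [x] unless a jump occurs. A jump shows that a
     representative is visited and that a word no longer than [ws] leaves [B], which cannot happen
     within [N] letters of a representative. *)
  have follow h ws : reduced ws -> okw (par (z h)) ws ->
      [/\ val (z (wmul ws h)).1 = wmul ws (val (z h).1) &
          if ws is a :: _ then par (z (wmul ws h)) = inv_letter a else True] \/
      ((exists h' g, val (z h').1 = rep (x g)) /\
       exists2 v, size v <= size ws & wmul v (val (z h).1) \notin B).
    elim: ws => [|a ws IH] raws ok; first by left.
    have [||[zE pE]|[r [v vs vB]]] := IH.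
    - exact: reduced_behead raws.
    - by case: (ws) ok raws.
    - have down : z (wmul (a :: ws) h) = delta (z (wmul ws h)) a.
        apply: (qconf_down parD cz).
        case: ws pE ok raws {IH zE} => [_ /= ->//|c ws -> _ /= /andP[+ _]].
        by apply: contra => /eqP->; rewrite inv_letterK.
      have [aB|aB] := boolP (gen a * val (z (wmul ws h)).1 \in B).
        left; rewrite down valD /target aB; split=> //.
        by rewrite zE.
      right; split.
        exists (wmul (a :: ws) h), (gen a * val (z (wmul ws h)).1).
        by rewrite down valD /target (negPf aB).
      by exists (a :: ws) => //; rewrite /= -zE.
    - by right; split=> //; exists v => //; exact: leq_trans vs (leqnSn _).
  have root g h : val (z h).1 = rep (x g) -> exists h', lab (z h') = b.
    move=> zh; have [w [wN okww xb]] := bP (rep (x g)) (par (z h)).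
    have [[zE _]|[_ [v vs]]] := follow h _ (wordP w) okww.
      by exists (wmul (word w) h); rewrite /lab zE zh wmul_word.
    rewrite zh; case/negP.
    have -> : wmul v (rep (x g)) = wmul v 1 * rep (x g).
      by elim: (v) => [|a u IH] /=; rewrite ?mul1g // IH mulgA.
    apply: BP; apply: leq_trans wN; apply: leq_trans vs.
    elim: (v) => //= a u IH; exact: leq_trans (size_genM _ _) _.
  have [w [wN okww xb]] := bP (val (z 1).1) (par (z 1)).
  have [h hb] : exists h, lab (z h) = b.
    have [[zE _]|[[h [g hg]] _]] := follow 1 _ (wordP w) okww.
      by exists (wmul (word w) 1); rewrite /lab zE wmul_word.
    exact: root hg.
  by exists h; rewrite -hb -piE.
Qed.

(** Configurations use finitely many symbols, so by compactness the image of [conf T] under a map of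
    symbols is closed. *)
Lemma conf_compact T (phi : nat -> nat) (x : G -> nat) :
  (forall n, exists2 y, conf T y & agree n (phi \o y) x) ->
  exists2 y, conf T y & phi \o y = x.
Proof.
move=> yP.
pose A n := [set y : G -> nat | forall w, w \in wball d n ->
  phi (y w) = x w /\ forall i, (i, (y w, y (gen (i, false) * w))) \in T].
have [|||y _ yA] := @box_nested G (fun _ => symbols T) A.
- by move=> n y yA w wn; apply: yA; move: wn; rewrite !mem_wball => /leqW.
- move=> n; exists (wball d n.+1) => f f' ff' fA w wn.
  have [e fT] := fA w wn; rewrite -ff'; last by move: wn; rewrite !mem_wball => /leqW.
  split=> // i; rewrite -ff'; first exact: fT.
  by move: wn; rewrite !mem_wball -ltnS; exact: leq_trans (size_genM _ _).
- move=> n; have [y cy yx] := yP n; exists y; first by move=> g; exact: conf_symbols.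
  move=> w; rewrite mem_wball => wn; split; last by move=> i; exact: cy.
  exact: yx.
- have yw w n : size (word w) <= n -> w \in wball d n by rewrite mem_wball.
  exists y; first by move=> g i; have [_ ->] := yA _ g (yw _ _ (leqnn _)).
  by apply: funext => g; have [] := yA _ g (yw _ _ (leqnn _)).
Qed.

(** The image is closed and contains every translate of [pi \o y]; these accumulate at every [x] by
    minimality of [T]. *)
Lemma tiles_map_onto T' T pi : min_tiles T -> tiles_map T' T pi -> (exists y, conf T' y) ->
  forall x, conf T x -> exists2 y, conf T' y & pi \o y = x.
Proof.
move=> [_ mT] pm [y cy] x cx; apply: conf_compact => n.
have [g gP] := mT _ _ (pm _ cy) cx n.
by exists (translate g y); first exact: conf_translate.
Qed.

Definition code_window n (x : G -> nat) : nat := choice.pickle [seq x w | w <- wball d n].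

Lemma code_windowP n x y : code_window n x = code_window n y <-> agree n x y.
Proof.
split=> [/(pcan_inj choice.pickleK)/eq_in_map e w wn|e].
  by apply: e; rewrite mem_wball.
by congr choice.pickle; apply/eq_in_map => w; rewrite mem_wball; exact: e.
Qed.

(** The higher-block recoding of symbolic dynamics. *)
Definition block n x g := code_window n (translate g x).

Lemma translateM g h (x : G -> nat) : translate g (translate h x) = translate (g * h) x.
Proof. by apply: funext => w; rewrite /translate mulgA. Qed.

Lemma word_rev_ind (P : G -> Prop) : P 1 ->
  (forall a w, size (word (w * gen a)) = (size (word w)).+1 -> P w -> P (w * gen a)) ->
  forall w, P w.
Proof.
move=> P1 PS w; have -> : w = (w^-1)^-1 by rewrite invgK.
have szV v : size (word v^-1) = size (word v) by rewrite /= size_map size_rev.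
elim/word_ind: (w^-1) => [|a v sav _ IH]; first by rewrite invg1.
rewrite invgM -gen_inv; apply: PS IH.
by rewrite gen_inv -invgM !szV.
Qed.

(** The allowed adjacencies are those seen in [Y], so neighbouring windows come from a common point
    and overlap coherently; their centres then spell [y]. Such a [y] looks like [Y] on each ball of
    radius [n] but need not belong to it. *)
Lemma block_tiles (Y : set (G -> nat)) n k :
  (forall y h, Y y -> Y (translate h y)) -> (forall y g, Y y -> y g < k) ->
  exists T, (forall y, Y y -> conf T (block n y)) /\
    forall c, conf T c -> exists y, c = block n y /\
      forall g, exists2 y', Y y' & agree n (translate g y) y'.
Proof.
move=> Yh Yk.
pose codes := [seq choice.pickle [seq val u | u <- val t] |
  t : (size (wball d n)).-tuple 'I_k <- enum {: (size (wball d n)).-tuple 'I_k}].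
have codesP y : Y y -> code_window n y \in codes.
  move=> yY; have lt w : y w < k by exact: Yk.
  pose t := [seq Ordinal (lt w) | w <- wball d n].
  have st : size t == size (wball d n) by rewrite size_map.
  apply/mapP; exists (Tuple st); first by rewrite mem_enum.
  by rewrite /= -map_comp.
pose E := [set e : 'I_d * (nat * nat) | exists2 y, Y y &
  e.2 = (code_window n y, code_window n (translate (gen (e.1, false)) y))].
have /finite_seqP[T TE] : finite_set E.
  apply: (@sub_finite_set _ _ [set` [seq (i, uv) | i <- enum 'I_d, uv <-
    [seq (u, v) | u <- codes, v <- codes]]]); last exact: finite_seq.
  move=> [i [u v]] [y yY /= [-> ->]]; apply/allpairsP.
  exists (i, (code_window n y, code_window n (translate (gen (i, false)) y))) => /=.
  rewrite mem_enum; split=> //; apply/allpairsP.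
  exists (code_window n y, code_window n (translate (gen (i, false)) y)).
  by split=> //; apply: codesP => //; exact: Yh.
have TP e : e \in T <-> E e by rewrite TE.
exists T; split.
  move=> y yY g i; apply/TP; exists (translate g y); first exact: Yh.
  by rewrite /block translateM.
move=> c cc.
have nb a g : exists2 y, Y y & c g = code_window n y /\
    c (gen a * g) = code_window n (translate (gen a) y).
  have nbf i h : exists2 y, Y y & c h = code_window n y /\
      c (gen (i, false) * h) = code_window n (translate (gen (i, false)) y).
    by have /TP[y yY [e1 e2]] := cc h i; exists y.
  case: a => i [|]; last exact: nbf.
  have [y yY [e1 e2]] := nbf i (gen (i, true) * g).
  exists (translate (gen (i, false)) y); first exact: Yh.
  rewrite translateM (gen_inv (i, false)) mulVg.
  move: e2; rewrite (genKV (i, false)) => ->; split=> //.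
  by rewrite e1; congr code_window; apply: funext => w; rewrite /translate mulg1.
have witE g : exists y, Y y /\ c g = code_window n y.
  by have [y yY []] := nb (i0, false) g; exists y.
have [wit witP] := choice witE.
(* Peel off the first step [a] of the path: one point of [Y] shows the windows at [g] and at
   [gen a * g], which carries the comparison over to a shorter path. *)
have key g w : size (word w) <= n -> wit g w = wit (w * g) 1.
  elim/word_rev_ind: w g => [|a w saw IH] g; first by rewrite mul1g.
  rewrite saw => wn.
  have [y yY [e1 e2]] := nb a g.
  have /code_windowP agy : code_window n (wit g) = code_window n y.
    by have [_ <-] := witP g.
  have /code_windowP agy' : code_window n (wit (gen a * g)) = code_window n (translate (gen a) y).
    by have [_ <-] := witP (gen a * g).
  rewrite agy ?saw // -mulgA -IH ?(ltnW wn) //.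
  by rewrite agy' ?(ltnW wn).
exists (fun g => wit g 1); split.
  apply: funext => g; have [_ ->] := witP g.
  by apply/code_windowP => w wn; rewrite key.
move=> g; exists (wit g); first by have [] := witP g.
by move=> w wn; rewrite [RHS]key.
Qed.

Lemma symbols_bound T : exists k, forall y g, conf T y -> y g < k.
Proof.
have [k kP] : exists k, forall u, u \in symbols T -> u < k.
  elim: (symbols T) => [|u s [k kP]]; first by exists 0.
  exists (maxn u.+1 k) => v; rewrite inE leq_max => /orP[/eqP->|/kP->].
    by rewrite ltnSn.
  by rewrite orbT.
by exists k => y g cy; apply: kP; exact: conf_symbols.
Qed.

Lemma unblockE n : exists f : nat -> G -> nat, forall x, agree n (f (code_window n x)) x.
Proof.
have fE u : exists y, forall x, code_window n x = u -> agree n y x.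
  have [[x xu]|nu] := pselect (exists x, code_window n x = u).
    by exists x => x' x'u; apply/code_windowP; rewrite xu.
  by exists (fun _ => 0) => x xu; case: nu; exists x.
by have [f fP] := choice fE; exists f => x; exact: fP.
Qed.

Lemma min_tiles_refine T n : min_tiles T -> exists T' phi, [/\ min_tiles T', tiles_map T' T phi &
  forall y y', conf T' y -> conf T' y' -> y 1 = y' 1 -> agree n (phi \o y) (phi \o y')].
Proof.
move=> [[x cx] mT]; have [k kP] := symbols_bound T.
(* The radius is [n.+1] because a window has to contain the neighbours of its centre; windows seen
   in [conf T] then enforce the rules of [T]. *)
have [T1 [T1E T1P]] := block_tiles (Y := conf T) n.+1
  (fun y h => @conf_translate _ T y h) (fun y g cy => kP y g cy).
have [T' [pi [mT' pim _]]] := minimal_tiles 0 (T1E _ cx).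
have [f fP] := unblockE n.+1.
pose phi u := f (pi u) 1.
have phiE y : conf T' y -> exists2 z, conf T z & phi \o y = z /\ pi \o y = block n.+1 z.
  move=> /pim/T1P[z [zE zP]].
  exists z; last first.
    split=> //; apply: funext => g.
    rewrite /= /phi -[pi (y g)]/((pi \o y) g) zE /block fP //.
    by rewrite /translate mul1g.
  move=> g i; have [y' cy' ag] := zP g.
  have <- : y' 1 = z g by rewrite -ag // /translate mul1g.
  have <- : y' (gen (i, false) * 1) = z (gen (i, false) * g) by rewrite -ag mulg1.
  exact: cy'.
exists T', phi; split=> //.
  by move=> y /phiE[z cz [-> _]].
move=> y y' /phiE[z _ [-> zE]] /phiE[z' _ [-> z'E]] yy'.
have : code_window n.+1 (translate 1 z) = code_window n.+1 (translate 1 z').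
  by rewrite -[LHS]/(block n.+1 z 1) -zE -[RHS]/(block n.+1 z' 1) -z'E /= yy'.
move=> /code_windowP ag w wn; have := ag w (leqW wn).
by rewrite /translate mulg1.
Qed.

Definition pair_code (u v : nat) : nat := choice.pickle (u, v).
Definition pair_decode n : nat * nat := odflt (0, 0) (choice.unpickle n).

Lemma pair_codeK u v : pair_decode (pair_code u v) = (u, v).
Proof. by rewrite /pair_decode choice.pickleK. Qed.

Lemma fiber_product T1 T2 (phi1 phi2 : nat -> nat) (y1 y2 : G -> nat) :
  conf T1 y1 -> conf T2 y2 -> phi1 \o y1 = phi2 \o y2 ->
  exists T pi1 pi2, [/\ min_tiles T, tiles_map T T1 pi1, tiles_map T T2 pi2 &
    forall y, conf T y -> phi1 \o pi1 \o y = phi2 \o pi2 \o y].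
Proof.
move=> c1 c2 y12.
(* The last clause keeps [E] finite, since [pair_decode] may send several numbers to one pair. *)
pose E := [set e : 'I_d * (nat * nat) |
  [/\ (e.1, ((pair_decode e.2.1).1, (pair_decode e.2.2).1)) \in T1,
      (e.1, ((pair_decode e.2.1).2, (pair_decode e.2.2).2)) \in T2,
      phi1 (pair_decode e.2.1).1 = phi2 (pair_decode e.2.1).2 &
      exists u v u' v', e.2 = (pair_code u u', pair_code v v')]].
have /finite_seqP[T TE] : finite_set E.
  apply: (@sub_finite_set _ _ [set` [seq (e1.1, (pair_code e1.2.1 e2.2.1,
      pair_code e1.2.2 e2.2.2)) | e1 <- T1, e2 <- T2]]); last exact: finite_seq.
  move=> [i uv] [/= + + _ [u [v [u' [v' uvE]]]]].
  rewrite uvE /= !pair_codeK /= => h1 h2; apply/allpairsP.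
  by exists ((i, (u, v)), (i, (u', v'))).
have TP e : e \in T <-> E e by rewrite TE.
have cx : conf T (fun g => pair_code (y1 g) (y2 g)).
  move=> g i; apply/TP; rewrite /E /= !pair_codeK /=; split.
  - exact: c1.
  - exact: c2.
  - by have := congr1 (fun f => f g) y12.
  - by exists (y1 g), (y1 (gen (i, false) * g)), (y2 g), (y2 (gen (i, false) * g)).
have [T' [pi [mT' pim _]]] := minimal_tiles 0 cx.
exists T', (fun u => (pair_decode (pi u)).1), (fun u => (pair_decode (pi u)).2).
split=> //.
- by move=> y /pim cy g i; have /TP[] := cy g i.
- by move=> y /pim cy g i; have /TP[] := cy g i.
- by move=> y /pim cy; apply: funext => g; have /TP[] := cy g i0.
Qed.

End MinimalTiles.

(** * Clopen algebras and good flows *)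

Section SubalgVal.
Local Open Scope order_scope.
Variables (G : groupType) (M : boolGalg G) (S : subalg M).
Implicit Types x y : balg_of_subalg S.
Lemma val_meet x y : val (x `&` y) = val x `&` val y. Proof. by []. Qed.
Lemma val_join x y : val (x `|` y) = val x `|` val y. Proof. by []. Qed.
Lemma val_bot : val (\bot : balg_of_subalg S) = \bot. Proof. by []. Qed.
Lemma val_top : val (\top : balg_of_subalg S) = \top. Proof. by []. Qed.
Lemma val_act g x : val (balg_act g x) = balg_act g (val x). Proof. by []. Qed.
Lemma val_compl x : val (~` x) = ~` (val x).
Proof.
have h1 : val x `&` val (~` x) = \bot by rewrite -val_meet meetxC.
have h2 : val x `|` val (~` x) = \top by rewrite -val_join joinxC.
rewrite -[LHS]meet1x -(joinxC (val x)) meetUl h1 join0x.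
by rewrite -[RHS]meetx1 -h2 meetUr meetCx join0x.
Qed.
End SubalgVal.

Section ClopenTerms.
Variables (G : groupType) (Z : flow G).
Local Notation B := (clopen_balg Z).

Definition member (U : B) (z : Z) : bool := `[< (val U : set Z) z >].

Lemma member_locconst (U : B) : locconst (member U).
Proof. by apply: clopen_locconst; exact: set_mem (valP U). Qed.

Definition clopen_of (U : set Z) (cU : clopen U) : B := exist _ U (mem_set cU).

Lemma memberE U (cU : clopen U) z : member (clopen_of cU) z = `[< U z >].
Proof. by []. Qed.

Lemma member_inj (U V : B) : member U =1 member V -> U = V.
Proof.
move=> UV; apply/val_inj/seteqP; split=> z Uz.
  by have /asboolP : member V z by rewrite -UV; apply/asboolP.
by have /asboolP : member U z by rewrite UV; apply/asboolP.
Qed.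

Lemma member_bot z : member \bot%O z = false.
Proof. by apply/asboolP; rewrite /= => -[]. Qed.

Lemma member_top z : member \top%O z.
Proof. exact/asboolP. Qed.

Lemma member_meet (U V : B) z : member (U `&` V)%O z = member U z && member V z.
Proof.
by rewrite /member val_meet; apply/asboolP/andP=> -[/asboolP h1 /asboolP h2].
Qed.

Lemma member_join (U V : B) z : member (U `|` V)%O z = member U z || member V z.
Proof.
rewrite /member val_join; apply/asboolP/orP.
  by move=> [] h; [left|right]; apply/asboolP.
by move=> [] /asboolP h; [left|right].
Qed.

Lemma member_compl (U : B) z : member (~` U)%O z = ~~ member U z.
Proof.
rewrite /member val_compl (_ : (~` val U)%O = (~` (val U : set Z))%classic).
  by apply/asboolP/negP => [nz /asboolP|nz /asboolP].
exact: complEset.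
Qed.

Lemma bot_member (U : B) : U = \bot%O <-> forall z, ~~ member U z.
Proof.
split=> [-> z|nU]; first by rewrite member_bot.
by apply: member_inj => z; rewrite member_bot; apply/negbTE.
Qed.

Definition bits (xs : seq B) (z : Z) := [seq member U z | U <- xs].

Lemma bits_locconst xs : locconst (bits xs).
Proof.
move=> z; rewrite /bits; elim: xs => [|U xs IH] /=; first exact: filterE.
by apply: filterS (filterI (member_locconst U z) IH) => y /= [-> ->].
Qed.

End ClopenTerms.

Section Satisfaction.
Variable G : groupType.

(** Whether a point belongs to the value of a term depends on its itinerary alone; [TAct g] asks for
    the subterm at [g^-1 z], whose itinerary is the translated one. *)
Fixpoint sat (t : term G) (b : G -> seq bool) : bool :=
  match t with
  | TVar n => nth false (b 1) n
  | TTop => true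
  | TMeet t1 t2 => sat t1 b && sat t2 b
  | TCompl t1 => ~~ sat t1 b
  | TAct g t1 => sat t1 (fun h => b (h * g^-1))
  end.

Lemma member_eval (Z : flow G) (xs : seq (clopen_balg Z)) t z :
  member (term_eval xs t) z = sat t (fun g => bits xs (flow_act g z)).
Proof.
elim: t z => [n||t1 IH1 t2 IH2|t IH|g t IH] z /=.
- rewrite flow_act1; have [nx|nx] := ltnP n (size xs).
    by rewrite (nth_map \bot%O).
  by rewrite !nth_default ?size_map // member_bot.
- exact: member_top.
- by rewrite member_meet IH1 IH2.
- by rewrite member_compl IH.
- rewrite -[LHS]/(member (term_eval xs t) (flow_act g^-1 z)) IH; congr sat.
  by apply: funext => h; rewrite flow_actM.
Qed.

Lemma term_eval_neq_bot (Z : flow G) (xs : seq (clopen_balg Z)) t :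
  term_eval xs t <> \bot%O <-> exists z, sat t (fun g => bits xs (flow_act g z)).
Proof.
rewrite bot_member; split=> [/existsNP[z /negP]|[z tz] /(_ z)].
  by rewrite negbK member_eval; exists z.
by rewrite member_eval tz.
Qed.

(** Agreement at finitely many places is a conjunction of literals. The common length [k] is imposed
    because [nth] with a default does not see where a list ends. *)
Lemma pattern_term (b0 : G -> seq bool) k (s : seq G) : (forall g, size (b0 g) = k) ->
  exists t, forall b, (forall g, size (b g) = k) ->
    sat t b <-> forall g, g \in s -> b g = b0 g.
Proof.
move=> sb0.
have lit (g : G) : exists t, forall b, (forall g, size (b g) = k) -> sat t b <-> b g = b0 g.
  suff [t tP] : exists t, forall b, sat t b <->
      forall i, i < k -> nth false (b g) i = nth false (b0 g) i.
    exists t => b sb; rewrite tP; split=> [e|-> //].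
    by apply: (@eq_from_nth _ false); rewrite ?sb ?sb0 // => i; exact: e.
  elim: k {sb0} => [|k [t tP]]; first by exists (TTop G).
  pose v := TAct g^-1 (TVar G k).
  exists (TMeet t (if nth false (b0 g) k then v else TCompl v)) => b.
  have vE : sat (if nth false (b0 g) k then v else TCompl v) b <->
      nth false (b g) k = nth false (b0 g) k.
    by case: (nth false (b0 g) k); rewrite /= invgK mul1g; case: (nth _ _ _).
  rewrite /=; split=> [/andP[/tP h /vE h'] i|h].
    by rewrite ltnS leq_eqVlt => /orP[/eqP->|/h].
  by apply/andP; split; [apply/tP => i /leqW/h | apply/vE/h].
elim: s => [|g s [t tP]]; first by exists (TTop G).
have [u uP] := lit g; exists (TMeet t u) => b sb /=; split.
  move=> /andP[/(tP _ sb) h /(uP _ sb) h'] g'.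
  by rewrite inE => /orP[/eqP->|/h].
move=> h; apply/andP; split; first by apply/(tP _ sb) => g' g's; apply: h; rewrite inE g's orbT.
by apply/(uP _ sb)/h; exact: mem_head.
Qed.

End Satisfaction.

Section GoodFlows.
Variable d : nat.
Variable i0 : 'I_d.
Local Notation G := (free_group d).
Implicit Types (Z : flow G) (T : tiles d).

Definition code Z (W : Type) (rho : Z -> W) (z : Z) : G -> W :=
  fun g => rho (flow_act g z).

Definition tiled Z T (rho : Z -> nat) := forall z, conf T (code rho z).

Lemma code_translate Z (rho : Z -> nat) g z :
  code rho (flow_act g z) = translate g (code rho z).
Proof. by apply: funext => h; rewrite /code /translate flow_actM. Qed.

Lemma code_locconst Z W (rho : Z -> W) g : locconst rho -> locconst (fun z => code rho z g).
Proof. by move=> lr; apply: locconst_cont lr (@flow_cont _ Z g). Qed.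

Definition refinable Z := forall gamma : Z -> nat, locconst gamma ->
  exists T rho pi, [/\ min_tiles T, locconst rho, tiled T rho & gamma = pi \o rho].

Definition liftable Z := forall T T' pi (rho : Z -> nat), min_tiles T -> min_tiles T' ->
  tiles_map T' T pi -> locconst rho -> tiled T rho ->
  exists sigma : Z -> nat, [/\ locconst sigma, tiled T' sigma & pi \o sigma = rho].

Section Compact.
Variable Z : flow G.
Hypothesis cZ : compact [set: Z].

Lemma code_compact (rho : Z -> nat) y : locconst rho ->
  (forall n, exists z, agree n (code rho z) y) -> exists z, code rho z = y.
Proof.
move=> lr yP.
have [|||z _ zP] := @compact_nested Z setT (fun n => [set z | agree n (code rho z) y]) cZ.
- move=> n; have lf : locconst (fun z => [seq code rho z w | w <- wball d n]).
    apply: locconst_map => g; exact: code_locconst.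
  have [_] := locconst_clopen [set [seq y w | w <- wball d n]] lf; congr closed.
  apply/seteqP; split=> z /=.
    by move=> /eq_in_map e w wn; apply: e; rewrite mem_wball.
  by move=> e; apply/eq_in_map => w; rewrite mem_wball; exact: e.
- by move=> n z /= zP w wn; apply: zP; exact: leqW.
- by move=> n; have [z zP] := yP n; exists z.
- by exists z; apply: funext => g; apply: (zP _ g (leqnn _)).
Qed.

Lemma code_onto T (rho : Z -> nat) (z0 : Z) : min_tiles T -> locconst rho -> tiled T rho ->
  forall y, conf T y -> exists z, code rho z = y.
Proof.
move=> [_ mT] lr tr y cy; apply: code_compact => // n.
have [g gP] := mT _ _ (tr z0) cy n.
by exists (flow_act g z0); rewrite code_translate.
Qed.

End Compact.

Lemma good_extendable Z Z' (z0 : Z) (z0' : Z') : compact [set: Z] -> compact [set: Z'] ->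
  refinable Z -> refinable Z' -> liftable Z' ->
  extendable (clopen_balg Z) (clopen_balg Z').
Proof.
move=> cZ cZ' rZ rZ' lZ' p pe a.
set xs := unzip1 p; set ys := unzip2 p.
pose dec u : seq bool := odflt [::] (choice.unpickle u).
have decK bs : dec (choice.pickle bs) = bs by rewrite /dec choice.pickleK.
have [T1 [rho1 [pi1 [mT1 lr1 tr1 e1]]]] :=
  rZ _ (locconst_comp choice.pickle (bits_locconst (a :: xs))).
have [T2 [rho2 [pi2 [mT2 lr2 tr2 e2]]]] :=
  rZ' _ (locconst_comp choice.pickle (bits_locconst ys)).
have b1 z : bits (a :: xs) z = dec (pi1 (rho1 z)).
  by rewrite -[pi1 _]/((pi1 \o rho1) z) -e1 decK.
have b2 z : bits ys z = dec (pi2 (rho2 z)).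
  by rewrite -[pi2 _]/((pi2 \o rho2) z) -e2 decK.
(* Forgetting the bit of [a] makes both [T1] and [T2] map to itineraries of the lists already
   matched. *)
pose phi1 u := choice.pickle (behead (dec (pi1 u))).
have szx z : size (bits xs z) = size p by rewrite !size_map.
have szy z : size (bits ys z) = size p by rewrite !size_map.
(* Each finite pattern in the itinerary of [z0] is a term that does not vanish on [xs], hence not on
   [ys]. Compactness of [Z'] then gives a point with the same full itinerary, so the fibre product
   is nonempty. *)
have [z' z'P] : exists z', code (choice.pickle \o bits ys) z' = phi1 \o code rho1 z0.
  apply: code_compact => //; first exact/locconst_comp/bits_locconst.
  move=> n; have [t tP] := pattern_term (b0 := fun g => bits xs (flow_act g z0))
    (wball d n) (fun g => szx _).
  have nx : term_eval xs t <> \bot%O.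
    by apply/term_eval_neq_bot; exists z0; apply/tP.
  have /term_eval_neq_bot[z' /tP z'P] : term_eval ys t <> \bot%O.
    by move=> e; apply: nx; apply/(pe t).
  exists z' => w wn.
  by rewrite /code /= z'P ?mem_wball // /phi1 -b1.
have [P [al [be [mP alm bem ab]]]] : exists T pi1' pi2', [/\ min_tiles T, tiles_map T T1 pi1',
    tiles_map T T2 pi2' & forall y, conf T y -> phi1 \o pi1' \o y = pi2 \o pi2' \o y].
  apply: (fiber_product i0 (tr1 z0) (tr2 z')).
  rewrite -z'P; apply: funext => g.
  exact: (congr1 (fun f => f (flow_act g z')) e2).
(* Lifting [rho2] to the fibre product and projecting to [T1] gives a coding of [Z'] that reproduces
   the bits of [ys] and supplies one for the new element. *)
have [sg [lsg tsg esg]] := lZ' _ _ _ _ mT2 mP bem lr2 tr2.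
pose rho' := al \o sg.
have tr' : tiled T1 rho' by move=> z; exact: (alm _ (tsg z)).
have lr' : locconst rho' by exact: locconst_comp.
pose bset := [set z | head false (dec (pi1 (rho' z)))].
have cb : clopen bset.
  apply: (@locconst_clopen _ _ (fun z => head false (dec (pi1 (rho' z)))) [set b | b]).
  exact: (locconst_comp (fun u => head false (dec (pi1 u)))).
exists (clopen_of cb).
have b' z : bits (clopen_of cb :: ys) z = dec (pi1 (rho' z)).
  have [x xz] := code_onto cZ z0 mT1 lr1 tr1 (tr' z).
  have rz : rho' z = rho1 x.
    by have := congr1 (fun f => f 1) xz; rewrite /code !flow_act1.
  rewrite /= memberE b2.
  have := congr1 (fun f => f 1) (ab _ (tsg z)).
  rewrite /= /code flow_act1 -/(rho' z) => /(congr1 dec).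
  rewrite /phi1 decK -[pi2 _]/((pi2 \o (be \o sg)) z) esg /= => <-.
  have dz : dec (pi1 (rho' z)) = bits (a :: xs) x by rewrite rz b1.
  by rewrite -/(rho' z) /bset /= dz /= asboolb.
(* Both [rho1] and [rho'] code onto all configurations of [T1], so a term is satisfied in [Z]
   exactly when it is in [Z']. *)
apply: pequiv_neq => t.
pose s (y : G -> nat) := sat t (fun g => dec (pi1 (y g))).
rewrite !term_eval_neq_bot; split=> -[z].
  rewrite (_ : sat t _ = s (code rho1 z)); last by congr sat; apply: funext => g; exact: b1.
  have [x <-] := code_onto cZ' z0' mT1 lr' tr' (tr1 z).
  move=> sx; exists x; rewrite (_ : sat t _ = s (code rho' x)) //.
  by congr sat; apply: funext => g; exact: b'.
rewrite (_ : sat t _ = s (code rho' z)); last by congr sat; apply: funext => g; exact: b'.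
have [x <-] := code_onto cZ z0 mT1 lr1 tr1 (tr' z).
move=> sx; exists x; rewrite (_ : sat t _ = s (code rho1 x)) //.
by congr sat; apply: funext => g; exact: b1.
Qed.

End GoodFlows.

(** * Generated subalgebras and Fraisse limits *)

Section Embeddings.
Local Open Scope order_scope.
Variable G : groupType.
Implicit Types M N P : boolGalg G.

Definition embedding M N (f : M -> N) :=
  [/\ bool_morphism f, forall g x, f (balg_act g x) = balg_act g (f x) & injective f].

Lemma iso_embedding M N (f : M -> N) : is_balg_iso f -> embedding f.
Proof. by case=> mf af /bij_inj. Qed.

Lemma val_embedding M (S : subalg M) : embedding (val : balg_of_subalg S -> M).
Proof.
split; [|exact: val_act|exact: val_inj].
by split; [exact: val_meet|exact: val_join|exact: val_compl|exact: val_bot|exact: val_top].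
Qed.

Lemma embedding_comp M N P (f : M -> N) (h : N -> P) :
  embedding f -> embedding h -> embedding (h \o f).
Proof.
move=> [[fI fU fC f0 f1] fA fi] [[hI hU hC h0 h1] hA hi]; split.
- by split=> [x y|x y|x||] /=; rewrite ?fI ?hI ?fU ?hU ?fC ?hC ?f0 ?h0 ?f1 ?h1.
- by move=> g x /=; rewrite fA hA.
- exact: inj_comp.
Qed.

Lemma term_eval_map M N (f : M -> N) xs t : embedding f ->
  term_eval (map f xs) t = f (term_eval xs t).
Proof.
move=> [[fI fU fC f0 f1] fA _].
elim: t => [n||t1 IH1 t2 IH2|t IH|g t IH] /=.
- have [nx|nx] := ltnP n (size xs); first by rewrite (nth_map \bot).
  by rewrite !nth_default ?size_map.
- by [].
- by rewrite fI IH1 IH2.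
- by rewrite fC IH.
- by rewrite fA IH.
Qed.

Lemma pequiv_embedding M N P (f : M -> N) (h : M -> P) xs :
  embedding f -> embedding h -> pequiv [seq (f x, h x) | x <- xs].
Proof.
move=> ef eh t; rewrite /unzip1 /unzip2 -!map_comp.
have eqb M' N' (k : M' -> N') u : embedding k -> k u = \bot <-> u = \bot.
  by move=> [[_ _ _ k0 _] _ ki]; split=> [e|->//]; apply: ki; rewrite k0.
rewrite (term_eval_map (f := f)) // (term_eval_map (f := h)) //.
by split=> [/(eqb _ _ _ _ ef)->|/(eqb _ _ _ _ eh)->]; apply/eqb.
Qed.

Lemma iso_sym M N : balg_iso M N -> balg_iso N M.
Proof.
move=> [f [[fI fU fC f0 f1] fA [h fh hf]]]; exists h; split; last by exists f.
- split=> [x y|x y|x||]; apply: (can_inj fh).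
  + by rewrite fI !hf.
  + by rewrite fU !hf.
  + by rewrite fC !hf.
  + by rewrite f0 hf.
  + by rewrite f1 hf.
- by move=> g x; apply: (can_inj fh); rewrite fA !hf.
Qed.

Lemma iso_trans M N P : balg_iso M N -> balg_iso N P -> balg_iso M P.
Proof.
move=> [f fi] [h hi]; exists (h \o f).
have [mf af inf] := embedding_comp (iso_embedding fi) (iso_embedding hi).
by split=> //; apply: bij_comp; [case: hi|case: fi].
Qed.

Lemma range_term_eval_subalg M (xs : seq M) : is_subalg (range (term_eval xs)).
Proof.
split=> [x y [t _ <-] [u _ <-]|x y [t _ <-] [u _ <-]|x [t _ <-]||g x [t _ <-]].
- by exists (TMeet t u).
- by exists (TJoin t u) => //; rewrite term_eval_join.
- by exists (TCompl t).
- by split; [exists (TBot G) => //; exact: term_eval_bot|exists (TTop G)].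
- by exists (TAct g t).
Qed.

Definition generated M (xs : seq M) : subalg M := Subalg (range_term_eval_subalg xs).

Lemma generated_smallest M (xs : seq M) :
  range (term_eval xs) = smallest (@is_subalg G M) [set` xs].
Proof.
apply/seteqP; split=> [x [t _ <-] S [[SI SU SC [S0 S1] SA] xsS]|]; last first.
  apply: smallest_sub; first exact: range_term_eval_subalg.
  move=> x /= xxs; exists (TVar G (index x xs)) => //=.
  by rewrite nth_index.
elim: t => [n||t1 IH1 t2 IH2|t IH|g t IH] /=; [|by []|exact: SI|exact: SC|exact: SA].
have [nx|nx] := ltnP n (size xs); first by apply: xsS => /=; exact: mem_nth.
by rewrite nth_default.
Qed.

Lemma generated_fg M (xs : seq M) : finitely_generated (generated xs).
Proof. by exists [set` xs]; [exact: finite_seq|exact: generated_smallest]. Qed.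

Lemma fg_generated M (S : subalg M) : finitely_generated S ->
  exists xs, subalg_set S = range (term_eval xs).
Proof.
by move=> [E /finite_seqP[xs ->] ->]; exists xs; rewrite generated_smallest.
Qed.

Lemma generated_lift M (S : subalg M) (xs : seq M) : {subset xs <= (S : set M)} ->
  exists xs' : seq (balg_of_subalg S), map val xs' = xs.
Proof.
elim: xs => [|x xs IH] xsS; first by exists [::].
have [xs' <-] : exists xs' : seq (balg_of_subalg S), map val xs' = xs.
  by apply: IH => y yxs; apply: xsS; rewrite inE yxs orbT.
by exists (exist _ x (xsS _ (mem_head _ _)) :: xs').
Qed.

Lemma mem_generated M (xs : seq M) : {subset xs <= (generated xs : set M)}.
Proof.
move=> x xxs; rewrite inE; exists (TVar G (index x xs)) => //=.
by rewrite nth_index.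
Qed.

(** Values of the same term correspond; [pequiv_eq] read in its two directions makes this well
    defined and injective. *)
Lemma pequiv_iso M N (p : seq (M * N)) : pequiv p ->
  exists2 f : balg_of_subalg (generated (unzip1 p)) ->
              balg_of_subalg (generated (unzip2 p)),
    is_balg_iso f & forall x t, val x = term_eval (unzip1 p) t ->
      val (f x) = term_eval (unzip2 p) t.
Proof.
move=> pe; set S := generated _; set T := generated _.
have ev (P : boolGalg G) (zs : seq P) (x : balg_of_subalg (generated zs)) :
    exists t, val x = term_eval zs t.
  by have /set_mem[t _ <-] := valP x; exists t.
have elt (P : boolGalg G) (zs : seq P) t : term_eval zs t \in (generated zs : set P).
  by rewrite inE; exists t.
have fex (x : balg_of_subalg S) : exists y : balg_of_subalg T,
    forall t, val x = term_eval (unzip1 p) t -> val y = term_eval (unzip2 p) t.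
  have [t xt] := ev _ _ x; exists (exist _ (term_eval (unzip2 p) t) (elt _ _ t)).
  by move=> u xu /=; apply/(pequiv_eq pe); rewrite -xt xu.
have [f fP] := choice fex.
exists f; last exact: fP.
split.
- split=> [x y|x y|x||]; apply/val_inj.
  + have [t xt] := ev _ _ x; have [u yu] := ev _ _ y.
    rewrite val_meet (fP _ _ xt) (fP _ _ yu); apply: (fP _ (TMeet t u)).
    by rewrite val_meet xt yu.
  + have [t xt] := ev _ _ x; have [u yu] := ev _ _ y.
    rewrite val_join (fP _ _ xt) (fP _ _ yu) -term_eval_join; apply: fP.
    by rewrite term_eval_join val_join xt yu.
  + have [t xt] := ev _ _ x.
    rewrite val_compl (fP _ _ xt); apply: (fP _ (TCompl t)).
    by rewrite val_compl xt.
  + by rewrite (fP _ (TBot G)) ?term_eval_bot.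
  + by rewrite (fP _ (TTop G)).
- move=> g x; apply/val_inj; have [t xt] := ev _ _ x.
  rewrite val_act (fP _ _ xt); apply: (fP _ (TAct g t)).
  by rewrite val_act xt.
- rewrite -setTT_bijective; split=> //.
  + move=> x y _ _ fxy; apply/val_inj; have [t xt] := ev _ _ x; have [u yu] := ev _ _ y.
    by rewrite xt yu; apply/(pequiv_eq pe); rewrite -(fP _ _ xt) -(fP _ _ yu) fxy.
  + move=> y _; have [t yt] := ev _ _ y.
    exists (exist _ (term_eval (unzip1 p) t) (elt _ _ t)) => //.
    by apply/val_inj; rewrite yt; exact: fP.
Qed.

Section Uniqueness.
Variable K : boolGalg G -> Prop.
Variables M N : boolGalg G.
Hypotheses (fM : fraisse_limit K M) (fN : fraisse_limit K N).

(** Universality realises in [M] the subalgebra generated by [a] and the first components.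
    Homogeneity of [M] moves the copies of these components onto the second ones, and the copy of
    [a] goes along. *)
Lemma fraisse_extendable : extendable N M.
Proof.
move=> p pe a; have [_ _ uM hM] := fM; have [_ aN _ _] := fN.
have [T fT [g gi]] := uM _ (aN _ (generated_fg (a :: unzip1 p))).
have [[|a' xs'] xsE] := generated_lift (@mem_generated N (a :: unzip1 p)); first by [].
have xsE0 := xsE; case: xsE => aE xsE.
pose h : balg_of_subalg (generated (a :: unzip1 p)) -> M := fun x => val (g x).
have eh : embedding h.
  exact: embedding_comp (iso_embedding gi) (val_embedding T).
have evh t : term_eval (a :: unzip1 p) t = \bot <-> term_eval (map h (a' :: xs')) t = \bot.
  have z1 : unzip1 [seq (val x, h x) | x <- a' :: xs'] = a :: unzip1 p.
    by rewrite /unzip1 -map_comp; exact: xsE0.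
  have z2 : unzip2 [seq (val x, h x) | x <- a' :: xs'] = map h (a' :: xs').
    by rewrite /unzip2 -map_comp.
  have := pequiv_embedding (a' :: xs') (val_embedding _) eh t.
  by rewrite z1 z2.
have sz : size xs' = size p by rewrite -(size_map val) xsE size_map.
pose q := zip (map h xs') (unzip2 p).
have q1 : unzip1 q = map h xs' by rewrite unzip1_zip // !size_map sz.
have q2 : unzip2 q = unzip2 p by rewrite unzip2_zip // !size_map sz.
(* Renumbering the variables makes a term in the old generators a term in the list enlarged by
   [a]. *)
pose shiftt := fix sh (t : term G) : term G := match t with
  | TVar n => TVar G n.+1 | TTop => TTop G | TMeet t1 t2 => TMeet (sh t1) (sh t2)
  | TCompl t1 => TCompl (sh t1) | TAct g t1 => TAct g (sh t1) end.
have shE (P : boolGalg G) (c : P) zs t : term_eval (c :: zs) (shiftt t) = term_eval zs t.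
  by elim: t => //= [t1 -> t2 ->|t ->|k t ->].
have qe : pequiv q.
  move=> t; rewrite q1 q2 -[X in _ <-> X](pe t) -(shE _ (h a')) -(shE _ a).
  by rewrite evh.
have [f fi fE] := pequiv_iso qe.
have [F Fi FE] := hM _ _ (generated_fg _) (generated_fg _) f fi.
have Fq : map F (unzip1 q) = unzip2 q.
  have := @mem_generated M (unzip1 q); move=> sub.
  apply: (@eq_from_nth _ \bot) => [|i]; first by rewrite !size_map.
  rewrite !size_map => iq.
  have iq' : (i < size (unzip1 q))%N by rewrite size_map.
  have mi := sub _ (mem_nth \bot iq').
  pose x0 : balg_of_subalg (generated (unzip1 q)) :=
    exist (fun z => z \in (generated (unzip1 q) : set M)) _ mi.
  have e : F (nth \bot (unzip1 q) i) = val (f x0) := FE x0.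
  rewrite (nth_map \bot) // e.
  exact: (fE x0 (TVar G i)).
exists (F (h a')) => t.
suff : term_eval (a :: unzip1 p) t = \bot <-> term_eval (F (h a') :: unzip2 p) t = \bot by [].
rewrite -q2 -Fq q1 -[F (h a') :: _]/(map F (map h (a' :: xs'))).
rewrite (term_eval_map _ _ (iso_embedding Fi)) evh.
have [[[_ _ _ F0 _] _ Fb]] := (Fi, tt).
by split=> [->//|e]; apply: (bij_inj Fb); rewrite F0.
Qed.

End Uniqueness.

Lemma closed_term t : exists b : bool, forall M, term_eval [::] t = if b then \top else \bot :> M.
Proof.
elim: t => [n||t1 [b1 IH1] t2 [b2 IH2]|t [b IH]|g t [b IH]].
- by exists false => M /=; rewrite nth_nil.
- by exists true.
- exists (b1 && b2) => M /=; rewrite IH1 IH2.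
  by case: b1 {IH1}; rewrite ?meet1x ?meet0x.
- by exists (~~ b) => M /=; rewrite IH; case: b {IH}; rewrite ?compl1 ?compl0.
- exists b => M /=; rewrite IH.
  by have [_ _ _ g0 g1] := @balg_act_morph G M g; case: b {IH}.
Qed.

(** Over the empty list a term evaluates to top or bottom alike in all algebras, so the
    back-and-forth between nontrivial ones may start from nothing. *)
Lemma pequiv_nil M N : \top != \bot :> M -> \top != \bot :> N ->
  pequiv ([::] : seq (M * N)).
Proof.
move=> /eqP nM /eqP nN t; have [b bP] := closed_term t.
by rewrite /= !bP; case: b {bP}.
Qed.

Lemma fraisse_unique (K : boolGalg G -> Prop) M N :
  (forall B : boolGalg G, K B -> \top != \bot :> B) ->
  fraisse_limit K M -> fraisse_limit K N -> balg_iso N M.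
Proof.
move=> nK fM fN.
have nt P : fraisse_limit K P -> \top != \bot :> P.
  move=> [_ /(_ _ (generated_fg [::]))/nK nP _ _].
  by apply: contra_neq nP => e; apply/val_inj; rewrite val_top val_bot.
have [cM _ _ _] := fM; have [cN _ _ _] := fN.
have [F Fi _] := back_forth cN cM (fraisse_extendable fM fN)
  (fraisse_extendable fN fM) (pequiv_nil (nt _ fN) (nt _ fM)).
by exists F.
Qed.

Lemma extendable_homogeneous M : countable [set: M] -> extendable M M ->
  forall S T : subalg M, finitely_generated S ->
  forall f : balg_of_subalg S -> balg_of_subalg T, is_balg_iso f ->
  exists2 F : M -> M, is_balg_iso F &
    forall x : balg_of_subalg S, F (val x) = val (f x).
Proof.
move=> cM eM S T fS f fi; have [xs SE] := fg_generated fS.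
have [|xs' xsE] := @generated_lift M S xs.
  by move=> x xxs; rewrite SE; exact: mem_generated.
have ef := embedding_comp (iso_embedding fi) (val_embedding T).
have pe := pequiv_embedding xs' (val_embedding S) ef.
have [F Fi FE] := back_forth cM cM eM eM pe.
exists F => // x.
have [t xt] : exists t, x = term_eval xs' t.
  have Sx : (range (term_eval xs)) (val x) by rewrite -SE; exact: set_mem (valP x).
  case: Sx => t _ e; exists t; apply/val_inj.
  by rewrite -(term_eval_map _ _ (val_embedding S)) xsE e.
rewrite xt -(term_eval_map _ _ (val_embedding S)) -(term_eval_map _ _ (iso_embedding Fi)).
rewrite -[RHS]/((val \o f) _) -(term_eval_map _ _ ef) -map_comp; congr term_eval.
apply/eq_in_map => y yxs /=; apply: FE.
by apply/mapP; exists y.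
Qed.

End Embeddings.

(** * Factors onto subshifts *)

Section Compactness.

(** Otherwise the pairs equal under [w n] but separated by [f] form nested nonempty closed sets; a
    common point contradicts that the [w n] together determine [f]. *)
Lemma locconst_factor (Z : topologicalType) (W : nat -> Type) (w : forall n, Z -> W n)
    (V : Type) (f : Z -> V) : compact [set: Z] -> (forall n, locconst (w n)) ->
  (forall n z z', w n.+1 z = w n.+1 z' -> w n z = w n z') -> locconst f ->
  (forall z z', (forall n, w n z = w n z') -> f z = f z') ->
  exists n, forall z z', w n z = w n z' -> f z = f z'.
Proof.
move=> cZ lw dw lf wf; apply/not_existsP => nf.
have cZZ : compact [set: Z * Z] by rewrite -setXTT; exact: compact_setX.
have lfst U (h : Z -> U) : locconst h -> locconst (fun p : Z * Z => h p.1).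
  by move=> lh; apply: locconst_cont lh _ => p; exact: cvg_fst.
have lsnd U (h : Z -> U) : locconst h -> locconst (fun p : Z * Z => h p.2).
  by move=> lh; apply: locconst_cont lh _ => p; exact: cvg_snd.
pose A n := [set p : Z * Z | w n p.1 = w n p.2 /\ f p.1 <> f p.2].
have [|||[z z'] _ zA] := @compact_nested _ _ A cZZ.
- move=> n; have [_] := locconst_clopen
    [set q : (W n * W n) * (V * V) | q.1.1 = q.1.2 /\ q.2.1 <> q.2.2]
    (locconst_pair (locconst_pair (lfst _ _ (lw n)) (lsnd _ _ (lw n)))
                   (locconst_pair (lfst _ _ lf) (lsnd _ _ lf))).
  by [].
- by move=> n [z z'] /= [/dw].
- move=> n; have /existsNP[z /existsNP[z' /not_implyP h]] := nf n.
  by exists (z, z').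
have [_] := zA 0; apply; apply: wf => n; by have [] := zA n.
Qed.

Lemma compact_set_type (X : topologicalType) (A : set X) : compact A -> compact [set: A].
Proof.
move=> cA F FF _.
have FA : (set_val @ F) A 
  by apply: (@filterS _ F _ setT) filterT => x _; exact: set_mem (valP x).
have [p [Ap clp]] := cA _ (fmap_proper_filter set_val FF) FA.
exists (exist _ p (mem_set Ap)); split=> // B C FB.
rewrite nbhsE => -[_ [[W oW <-]] Wp WC].
have FB' : (set_val @ F) (set_val @` B).
  by apply: (@filterS _ F _ B) FB => b Bb; exists b.
have nW : nbhs p W by apply: open_nbhs_nbhs.
have [_ [[b Bb <-] Wb]] := clp _ _ FB' nW.
by exists b; split=> //; exact: WC.
Qed.

Lemma locconst_continuous (X : topologicalType) (V : choiceType) (f : X -> V) :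
  locconst f -> continuous (f : X -> discrete_topology V).
Proof.
move=> lf x U nU; apply: filterS (lf x) => y /= ->; exact: nbhs_singleton nU.
Qed.

Lemma full_shift_compact (G : groupType) (A : finType) : compact [set: full_shift G A].
Proof.
have := @tychonoff G (fun=> discrete_topology A) (fun=> setT)
  (fun=> @finite_compact (discrete_topology A) setT (@finite_finset A setT)).
by congr compact; apply/seteqP.
Qed.

Lemma full_shift_hausdorff (G : groupType) (A : finType) : hausdorff_space (full_shift G A).
Proof. by apply: hausdorff_product => g; exact: discrete_hausdorff. Qed.

End Compactness.

(** * Clopen sets generated by a finite list *)

Section Definable.
Variable d : nat.
Local Notation G := (free_group d).
Variable Z : flow G.
Hypothesis cZ : compact [set: Z].

Lemma definable (xs : seq (clopen_balg Z)) (U : clopen_balg Z) :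
  (range (term_eval xs)) U <->
  forall z z', (forall g, bits xs (flow_act g z) = bits xs (flow_act g z')) ->
    member U z = member U z'.
Proof.
split=> [[t _ <-] z z' e|inv].
  by rewrite !member_eval; congr sat; apply: funext.
pose w n z := [seq bits xs (flow_act g z) | g <- wball d n].
have lw n : locconst (w n).
  by apply: locconst_map => g; exact: code_locconst (bits_locconst xs).
have [||n nP] := locconst_factor cZ lw _ (member_locconst U).
- move=> n z z' /eq_in_map e; apply/eq_in_map => g gn; apply: e.
  by move: gn; rewrite !mem_wball => /leqW.
- move=> z z' e; apply: inv => g; have /eq_in_map := e (size (word g)); apply.
  by rewrite mem_wball.
have [k kP] := compact_locconst cZ (locconst_comp choice.pickle (lw n)).
(* [U] depends on one finite window, so it is a union of patterns. The term is assembled by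
   induction on the codes of windows, bounded by [k]. *)
suff [t tP] : exists t, forall z, member (term_eval xs t) z =
    (choice.pickle (w n z) < k) && member U z.
  by exists t => //; apply: member_inj => z; rewrite tP kP.
elim: k {kP} => [|k [t tP]].
  by exists (TBot G) => z; rewrite term_eval_bot member_bot.
have [[z0 [z0k Uz0]]|nz] := pselect (exists z, choice.pickle (w n z) = k /\ member U z).
  have [u uP] := pattern_term (b0 := fun g => bits xs (flow_act g z0)) (wball d n)
    (fun g => size_map _ _).
  exists (TJoin t u) => z; rewrite term_eval_join member_join tP.
  rewrite [in RHS]ltnS [in RHS]leq_eqVlt andb_orl [RHS]orbC.
  congr (_ || _); rewrite member_eval; apply/idP/andP.
    move=> /uP-/(_ (fun g => size_map _ _)) e.
    have wz : w n z = w n z0 by apply/eq_in_map.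
    by rewrite wz z0k (nP _ _ wz).
  move=> [/eqP + _]; rewrite -z0k => /(pcan_inj choice.pickleK)/eq_in_map e.
  by apply/uP => // g; rewrite size_map.
exists t => z; rewrite tP [in RHS]ltnS [in RHS]leq_eqVlt andb_orl.
have [zk|//] := eqVneq.
case Uz: (member U z) => //=; first by case: nz; exists z.
Qed.

End Definable.

(** * Factor maps onto subshifts and their dual embeddings *)

Section Factor.
Variable G : groupType.
Variables (Z : flow G) (A : finType) (phi : Z -> full_shift G A).
Hypothesis cZ : compact [set: Z].
Hypothesis minZ : minimal Z.
Variable z0 : Z.
Hypothesis lphi : locconst (fun z => phi z 1).
Hypothesis phiE : forall g z, phi (flow_act g z) = shift g (phi z).

Lemma factor_coord z h : phi z h = phi (flow_act h^-1 z) 1.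
Proof. by rewrite phiE /shift invgK mulg1. Qed.

Lemma factor_cont : continuous phi.
Proof.
apply: prod_continuousP => h; apply: locconst_continuous.
rewrite (_ : (fun z => _) = (fun z => phi (flow_act h^-1 z) 1)).
  exact: locconst_cont lphi (@flow_cont _ Z h^-1).
by apply: funext => z; exact: factor_coord.
Qed.

Lemma factor_closed : closed (range phi).
Proof.
apply: compact_closed; first exact: full_shift_hausdorff.
apply: continuous_compact => //; exact/continuous_subspaceT/factor_cont.
Qed.

Lemma factor_inv g : shift g @` range phi `<=` range phi.
Proof. by move=> _ [_ [z _ <-] <-]; exists (flow_act g z) => //; rewrite phiE. Qed.

Lemma factor_neq0 : range phi !=set0.
Proof. by exists (phi z0), z0. Qed.

Definition factor_subshift : subshift G A := Subshift factor_closed factor_neq0 factor_inv.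

Variable X : subshift G A.
Hypothesis rX : range phi = X.

Lemma in_factor z : phi z \in (X : set (full_shift G A)).
Proof. by rewrite inE -rX; exists z. Qed.

Definition to_factor z : subshift_flow X := exist _ (phi z) (in_factor z).

Lemma to_factor_cont : continuous to_factor.
Proof. by apply: initial_continuousP; exact: factor_cont. Qed.

Lemma to_factor_act g z : to_factor (flow_act g z) = flow_act g (to_factor z).
Proof. by apply/val_inj; rewrite /= phiE. Qed.

Lemma to_factor_onto x : exists z, to_factor z = x.
Proof.
have : range phi (val x) by rewrite rX; exact: set_mem (valP x).
by case=> z _ zx; exists z; apply/val_inj.
Qed.

Lemma factor_minimal : minimal (subshift_flow X).
Proof.
move=> C clC [x Cx] invC; apply/seteqP; split=> // x' _.
have : to_factor @^-1` C = setT.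
  apply: minZ.
  - by apply: preimage_closed => // z _; exact: to_factor_cont.
  - by have [z zx] := to_factor_onto x; exists z; rewrite /preimage /= zx.
  - move=> g _ [z Cz <-] /=; rewrite to_factor_act; apply: invC.
    by exists (to_factor z).
have [z <-] := to_factor_onto x'.
by move=> /seteqP[_]; apply.
Qed.

Definition pullback_set (V : clopen_balg (subshift_flow X)) : set Z :=
  to_factor @^-1` (val V : set _).

Lemma pullback_clopen V : clopen (pullback_set V).
Proof.
by apply: preimage_clopen; [exact: set_mem (valP V)|exact: to_factor_cont].
Qed.

Definition pullback V : clopen_balg Z := clopen_of (pullback_clopen V).

Lemma member_pullback V z : member (pullback V) z = member V (to_factor z).
Proof. by []. Qed.

Lemma member_act (Y : flow G) g (U : clopen_balg Y) y :
  member (balg_act g U) y = member U (flow_act g^-1 y).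
Proof. by []. Qed.

Lemma pullback_embedding : embedding pullback.
Proof.
split.
- split=> [U V|U V|U||]; apply: member_inj => z.
  + by rewrite member_pullback !member_meet !member_pullback.
  + by rewrite member_pullback !member_join !member_pullback.
  + by rewrite member_pullback !member_compl member_pullback.
  + by rewrite member_pullback !member_bot.
  + by rewrite member_pullback !member_top.
- move=> g U; apply: member_inj => z.
  by rewrite member_pullback !member_act member_pullback to_factor_act.
- move=> U V UV; apply: member_inj => x; have [z <-] := to_factor_onto x.
  by rewrite -!member_pullback UV.
Qed.

End Factor.

(** The embedding dual to the factor map reaches every clopen set saturated for [phi]: the images of
    such a set and of its complement are closed, disjoint and cover [X]. *)
Lemma factor_iso (G : groupType) (Z : flow G) (A : finType) (phi : Z -> full_shift G A)
    (cZ : compact [set: Z]) (lphi : locconst (fun z => phi z 1))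
    (phiE : forall g z, phi (flow_act g z) = shift g (phi z))
    (X : subshift G A) (rX : range phi = X) (S : subalg (clopen_balg Z)) :
  (forall U, (S : set _) U <-> forall z z', phi z = phi z' -> member U z = member U z') ->
  balg_iso (clopen_balg (subshift_flow X)) (balg_of_subalg S).
Proof.
move=> SP; pose pb := pullback lphi phiE rX.
have pbS V : pb V \in (S : set (clopen_balg Z)).
  rewrite inE; apply/SP => z z' e; rewrite !member_pullback; congr (member V).
  by apply/val_inj.
pose f V : balg_of_subalg S := exist _ (pb V) (pbS V).
have [[pI pU pC p0 p1] pA pi] := pullback_embedding lphi phiE rX.
exists f; split.
- split=> [U V|U V|U||]; apply/val_inj.
  + by rewrite val_meet; exact: pI.
  + by rewrite val_join; exact: pU.
  + by rewrite val_compl; exact: pC.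
  + by rewrite val_bot; exact: p0.
  + by rewrite val_top; exact: p1.
- by move=> g U; apply/val_inj; rewrite val_act; exact: pA.
- rewrite -setTT_bijective; split=> //; first by move=> U V _ _ /(congr1 val)/pi.
  move=> U _; have /SP SU := set_mem (valP U).
  pose im (W : set Z) := to_factor rX @` W.
  have hX : hausdorff_space (subshift_flow X).
    move=> x y cxy; apply/val_inj; apply: full_shift_hausdorff.
    move=> P Q nP nQ.
    have cv : continuous (set_val : X -> full_shift G A) by exact: initial_continuous.
    have [w [Pw Qw]] := cxy _ _ (cv x _ nP) (cv y _ nQ).
    by exists (val w).
  have imcl W : closed W -> closed (im W).
    move=> clW; apply: compact_closed; first exact: hX.
    apply: continuous_compact.
      exact/continuous_subspaceT/to_factor_cont.
    exact: subclosed_compact clW cZ _.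
  pose W : set Z := val (val U : clopen_balg Z).
  have cW : clopen W by exact: set_mem (valP (val U : clopen_balg Z)).
  have WE z z' : phi z = phi z' -> W z -> W z'.
    move=> e Wz; have : member (val U) z' by rewrite -(SU z z' e); exact/asboolP.
    by move/asboolP.
  have imC : ~` im W = im (~` W).
    apply/seteqP; split=> x.
      have [z <-] := to_factor_onto rX x; move=> nW; exists z => // Wz.
      by apply: nW; exists z.
    move=> [z nWz <-] [z' Wz' /(congr1 val) /= e]; apply: nWz; exact: WE e Wz'.
  have cV : clopen (im W).
    split; last by apply: imcl; case: cW.
    rewrite -[im W]setCK openC imC; apply: imcl.
    by rewrite closedC; case: cW.
  exists (@clopen_of _ (subshift_flow X) (im W) cV) => //.
  apply/val_inj/member_inj => z; rewrite -[LHS]/(member (pb _) z) member_pullback memberE.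
  apply/asboolP/asboolP => [[z' Wz' /(congr1 val) /= e]|Wz]; first exact: WE e Wz'.
  by exists z.
Qed.

Lemma cylinderP (G : groupType) (A : finType) (p : pattern G A) (x : full_shift G A) :
  cylinder p x <-> forall h u, fnd p h = Some u -> x h = u.
Proof.
split=> [xp h u|xp [h hp]].
  by case: fndP => // kp [<-]; exact: (xp (FSetSub kp)).
by apply: xp; rewrite in_fnd; congr (Some (p _)); apply/val_inj.
Qed.

(** * Tile systems as subshifts of finite type *)

Section TilesSFT.
Variable d : nat.
Variable i0 : 'I_d.
Local Notation G := (free_group d).

Lemma tiles_SFT (T : tiles d) k : (exists x, conf T x) ->
  (forall x g, conf T x -> x g < k) ->
  exists2 Y : subshift G 'I_k, is_SFT Y &
    forall y, (Y : set _) y <-> conf T (fun g => val (y g^-1)).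
Proof.
move=> [x cx] xk.
pose Yset := [set y : full_shift G 'I_k | conf T (fun g => val (y g^-1))].
have clY : closed Yset.
  have -> : Yset = \bigcap_(gi in [set: G * 'I_d]) [set y : full_shift G 'I_k |
      (gi.2, (val (y gi.1^-1), val (y (gen (gi.2, false) * gi.1)^-1))) \in T].
    by apply/seteqP; split=> y h; [move=> [g i] _; exact: h|move=> g i; exact: (h (g, i) I)].
  apply: closed_bigI => -[g i] _ /=.
  have lc h := @coord_locconst G (fun=> discrete_topology 'I_k) h.
  have [_] := locconst_clopen [set uv : 'I_k * 'I_k | (i, (val uv.1, val uv.2)) \in T]
    (locconst_pair (lc g^-1) (lc (gen (i, false) * g)^-1)).
  by [].
have nY : Yset !=set0.
  exists (fun g => Ordinal (xk x g^-1 cx)) => g i /=.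
  by rewrite !invgK; exact: cx.
have iY g : shift g @` Yset `<=` Yset.
  move=> _ [y cy <-] h i; rewrite /shift -!invgM -!mulgA; exact: cy.
exists (Subshift clY nY iY); last by [].
(* The configuration attached to [y] reads [y] at inverses, so the edge from [1] along the generator
   [i] becomes the pair of cells [1] and [gen (i, true)]. *)
pose pat (t : 'I_d * ('I_k * 'I_k)) : pattern G 'I_k :=
  ([fmap].[(1 : G) <- t.2.1].[gen (t.1, true) <- t.2.2])%fmap.
have patP t (y : full_shift G 'I_k) : cylinder (pat t) y <->
    y 1 = t.2.1 /\ y (gen (t.1, true)) = t.2.2.
  have ne : (1 == gen (t.1, true) :> G) = false by [].
  rewrite cylinderP; split=> [yp|[y1 y2] h u].
    by split; apply: yp; rewrite !fnd_set ?eqxx // ne.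
  rewrite !fnd_set; case: eqP => [-> [<-]//|_]; case: eqP => [-> [<-]//|_].
  by rewrite fnd_fmap0.
exists (pat @` [set t | (t.1, (val t.2.1, val t.2.2)) \notin T]).
  exact/finite_image/finite_finset.
apply/seteqP; split=> y.
  move=> cy [_ [t /= tT <-] [g _ [u /patP[u1 u2] uy]]].
  move/negP: tT; apply.
  have := cy g^-1 t.1; rewrite invgK invgM -gen_inv invgK -uy /shift.
  by rewrite mulVg mulKg u1 u2.
move=> ny g i; apply: contrapT => /negP nT; apply: ny.
pose t := (i, (y g^-1, y (gen (i, false) * g)^-1)).
exists (pat t); first by exists t.
exists g^-1 => //; exists (shift g y); last by rewrite -shiftM mulVg shift1.
apply/patP; rewrite /shift mulg1; split=> //=.
by rewrite invgM -gen_inv.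
Qed.

End TilesSFT.

(** * Cyclic tilings *)

Section CyclicTiles.
Variable d : nat.
Variable i0 : 'I_d.
Local Notation G := (free_group d).
Variable k : nat.
Hypothesis k_gt0 : 0 < k.

(** Codes the action on the integers mod [k] in which each generator adds one. For [k = 1] this is a
    terminal tile system; large [k] will produce orbits with many points. *)
Definition cyclic_tiles : tiles d :=
  [seq (i, (u, u.+1 %% k)) | i <- enum 'I_d, u <- iota 0 k].

Lemma cyclic_conf (x : G -> nat) : conf cyclic_tiles x <->
  forall g i, x g < k /\ x (gen (i, false) * g) = (x g).+1 %% k.
Proof.
split=> cx g i.
  have /allpairsP[[j u] /= [_ + [_ -> ->]]] := cx g i.
  by rewrite mem_iota.
have [xk ->] := cx g i; apply/allpairsP; exists (i, x g) => /=.
by rewrite mem_enum mem_iota xk.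
Qed.

Let step (a : letter d) := if a.2 then k.-1 else 1%N.

Lemma cyclic_step (x : G -> nat) a g : conf cyclic_tiles x ->
  x (gen a * g) = (x g + step a) %% k.
Proof.
move=> /cyclic_conf cx; case: a => i [|]; rewrite /step /=; last first.
  by have [_ ->] := cx g i; rewrite addn1.
have [xk] := cx (gen (i, true) * g) i; rewrite (genKV (i, false)) => ->.
by rewrite modnDml addSnnS prednK // modnDr modn_small.
Qed.

Lemma cyclic_onto (x : G -> nat) u : conf cyclic_tiles x -> u < k -> exists g, x g = u.
Proof.
move=> cx uk.
have reach j : exists g, x g = (x 1 + j) %% k.
  elim: j => [|j [g xg]].
    by exists 1; rewrite addn0 modn_small //; have [] := (cyclic_conf x).1 cx 1 i0.
  exists (gen (i0, false) * g); have [_ ->] := (cyclic_conf x).1 cx g i0.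
  by rewrite xg -addn1 modnDml addn1 addnS.
have [xk _] := (cyclic_conf x).1 cx 1 i0.
have [g xg] := reach (k - x 1 + u); exists g.
by rewrite xg addnA subnKC ?(ltnW xk) // modnDl modn_small.
Qed.

Lemma cyclic_min_tiles : min_tiles cyclic_tiles.
Proof.
split.
  pose ex (w : seq (letter d)) := foldr (fun a s => (s + step a) %% k) 0 w.
  have exk w : ex w < k by case: w => //= a w; rewrite ltn_pmod.
  exists (fun g => ex (word g)); apply/cyclic_conf => g i; split=> //.
  rewrite word_gen; case: (word g) => [//|b w].
  rewrite [cons_reduced _ _]/=; case: eqP => [->|_]; last by rewrite [LHS]/= addn1.
  rewrite [ex (_ :: w)]/= -[X in X %% k]addn1 modnDml -addnA.
  by rewrite /step /= addn1 prednK // modnDr modn_small.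
move=> x y cx cy n.
have [yk _] := (cyclic_conf y).1 cy 1 i0.
have [g xg] := cyclic_onto cx yk.
exists g => w _; rewrite /translate.
elim/word_ind: w => [|a w _ _ IH].
  by rewrite mul1g.
by rewrite -mulgA !cyclic_step // IH.
Qed.

End CyclicTiles.

(** Every flow is coded by the one-symbol system, to which every tile system maps; the constant
    coding is lifted. *)
Lemma liftable_tiled d (i0 : 'I_d) (Z : flow (free_group d)) (T : tiles d) :
  liftable Z -> min_tiles T -> exists2 sigma : Z -> nat, locconst sigma & tiled T sigma.
Proof.
move=> lZ mT; have m1 := cyclic_min_tiles i0 (ltn0Sn 0).
have c1 (y : free_group d -> nat) : (forall g, y g = 0) -> conf (cyclic_tiles d 1) y.
  by move=> y0; apply/cyclic_conf => // g i; rewrite !y0.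
have [|||sg [lsg tsg _]] := lZ (cyclic_tiles d 1) T (fun=> 0) (fun=> 0) m1 mT.
- by move=> y _; exact: c1.
- by move=> x; exact: filterE.
- by move=> x; exact: c1.
by exists sg.
Qed.

(** * The clopen algebra of a good flow is the Fraisse limit *)

Section GoodFraisse.
Variable d : nat.
Variable i0 : 'I_d.
Local Notation G := (free_group d).

(* Recode by blocks covering the forbidden patterns and the window of the local
   rule of the factor map. *)
Lemma sofic_tiles (A : finType) (X : subshift G A) : sofic X ->
  exists T (F : nat -> A), min_tiles T /\ forall x, conf T x -> (X : set _) (fun h => F (x h^-1)).
Proof.
move=> [B [Y [f [[P finP YE] cf fE rf]]]].
have [ps psE] := (finite_seqP P).1 finP.
have YP y : (Y : set _) y <-> forall g p, P p -> ~ cylinder p (shift g y).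
  rewrite YE; split=> [ny g p Pp c|ny [p Pp [g _ [u c uy]]]].
    apply: ny; exists p => //; exists g^-1 => //; exists (shift g y) => //.
    by rewrite -shiftM mulVg shift1.
  by apply: (ny g^-1 p Pp); rewrite -uy -shiftM mulVg shift1.
have [n1 n1P] : exists n, forall p, P p -> forall h, h \in domf p -> size (word h) <= n.
  have [n nP] : exists n, forall p, p \in ps -> forall h, h \in domf p -> size (word h) <= n.
    elim: (ps) => [|p s [n nP]]; first by exists 0.
    have [m mP] : exists m, forall h, h \in domf p -> size (word h) <= m.
      have [m mP] : exists m, forall h, h \in (domf p : seq G) -> size (word h) <= m.
        elim: (domf p : seq G) => [|h u [m mP]]; first by exists 0.
        exists (maxn (size (word h)) m) => h'; rewrite inE leq_max.
        by case/orP => [/eqP->|/mP->]; rewrite ?leqnn ?orbT.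
      by exists m => h hp; apply: mP.
    exists (maxn n m) => q; rewrite inE => /orP[/eqP-> h /mP hm|/nP qn h /qn hn].
      by rewrite leq_max hm orbT.
    by rewrite leq_max hn.
  by exists n => p Pp; apply: nP; move: Pp; rewrite psE.
have cY : compact [set: Y].
  apply: compact_set_type; apply: subclosed_compact (@full_shift_compact G B) _ => //.
  exact: subshift_closed.
have lcoord h : locconst (fun y : Y => (val y : full_shift G B) h).
  apply: (@locconst_cont _ (full_shift G B) _ (fun x => x h) (set_val : Y -> _)).
    exact: (@coord_locconst G (fun=> discrete_topology B)).
  exact: initial_continuous.
have lf : locconst (fun y : Y => f y 1).
  apply: (@locconst_cont Y (full_shift G A) _ (fun x => x 1) f) => //.
  exact: (@coord_locconst G (fun=> discrete_topology A)).
(* The local rule of the factor map: by compactness the letter of [f y] at [1] depends on [y]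
   through a ball. *)
have [|||n2 n2P] := locconst_factor (w := fun n (y : Y) =>
    [seq (val y : full_shift G B) h | h <- wball d n]) cY _ _ lf.
- by move=> n; apply: locconst_map.
- move=> n y y' /eq_in_map e; apply/eq_in_map => g gn; apply: e.
  by move: gn; rewrite !mem_wball => /leqW.
- move=> y y' e; congr (f _ 1); apply/val_inj/funext => h.
  have /eq_in_map := e (size (word h)); apply; by rewrite mem_wball.
pose n := maxn n1 n2.
have szV (v : G) : size (word v^-1) = size (word v) by rewrite /= size_map size_rev.
pose enc (y : full_shift G B) : G -> nat := fun g => enum_rank (y g^-1).
have enc_inj y y' g g' : enc y g = enc y' g' -> y g^-1 = y' g'^-1.
  by move/val_inj/enum_rank_inj.
have encT y g : translate g (enc y) = enc (shift g y).
  by apply: funext => h; rewrite /translate /enc /shift invgM.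
pose Ys := [set x | exists2 y, (Y : set _) y & x = enc y].
have Yshift g y : (Y : set _) y -> (Y : set _) (shift g y).
  by move=> Yy; apply: (@subshift_inv _ _ Y g); exists y.
have [||T [TE TP]] := block_tiles i0 (Y := Ys) n (k := #|B|).
- by move=> _ h [y Yy ->]; rewrite encT; exists (shift h y) => //; exact: Yshift.
- by move=> _ g [y Yy ->]; rewrite /enc; exact: ltn_ord.
have [y0 Yy0] := subshift_neq0 Y.
have cy0 : conf T (block n (enc y0)) by apply: TE; exists y0.
(* A minimal system over the block system suffices: only containment in [X] is claimed, and a
   minimal [X] is filled by any nonempty closed invariant image. *)
have [T' [pi [mT' pim _]]] := minimal_tiles i0 0 cy0.
pose liftY y (Yy : (Y : set _) y) : Y := exist _ y (mem_set Yy).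
have FE u : exists a, forall y (Yy : (Y : set _) y), u = code_window n (enc y) ->
    a = f (liftY y Yy) 1.
  have [[y [Yy uy]]|nu] := pselect (exists y (Yy : (Y : set _) y), u = code_window n (enc y)).
    exists (f (liftY y Yy) 1) => y' Yy'; rewrite uy => /code_windowP ag.
    apply: n2P; apply/eq_in_map => h; rewrite mem_wball => hn /=.
    rewrite -(invgK h); apply: enc_inj; apply: ag.
    by rewrite szV; apply: leq_trans hn _; rewrite leq_maxr.
  exists (f (liftY y0 Yy0) 1) => y Yy uy; case: nu; by exists y, Yy.
have [F FP] := choice FE.
exists T', (F \o pi); split=> // x /pim/TP[v [vE vP]].
have [b0 _] : exists b : B, True by exists (y0 1).
pose y : full_shift G B := fun h => odflt b0 (omap (@enum_val B predT) (insub (v h^-1))).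
have vy : v = enc y.
  apply: funext => g; have [x' [y' _ ->] /(_ 1 (leq0n _))] := vP g.
  rewrite /translate mul1g /enc /y invgK => ->.
  by rewrite (valK (enum_rank _)) /= enum_rankK.
(* Every window of [y] occurs in a point of [Y], and radius [n] covers the forbidden patterns. *)
have Yy : (Y : set _) y.
  apply/YP => g p Pp /cylinderP c.
  have [x' [y' Yy' ->] ag] := vP g.
  have := (YP y').1 Yy' 1 p Pp; apply; apply/cylinderP => h b hb; rewrite shift1.
  rewrite -(c h b hb) -(invgK h) -[y' _](@enc_inj y' y' h^-1 h^-1) //.
  apply: enc_inj; rewrite -encT -vy ag // szV.
  by apply: leq_trans (leq_maxl n1 n2); apply: (n1P p Pp); rewrite -fndSome hb.
have -> : (fun h => (F \o pi) (x h^-1)) = f (liftY y Yy).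
  apply: funext => h; rewrite /= -[pi _]/((pi \o x) h^-1) vE.
  rewrite /block vy encT (FP _ _ (Yshift h^-1 y Yy) erefl).
  have -> : liftY _ (Yshift h^-1 y Yy) = subshift_act h^-1 (liftY y Yy) by exact/val_inj.
  by rewrite fE /shift invgK mulg1.
by rewrite -rf; exists (liftY y Yy).
Qed.

Variable Z : flow G.
Hypothesis cZ : compact [set: Z].
Hypothesis minZ : minimal Z.
Variable z0 : Z.
Hypothesis rZ : refinable Z.
Hypothesis lZ : liftable Z.

(** A coding of [Z] by tiles for [X] is an equivariant map into [X], onto because [X] is minimal.
    The image of its dual embedding is generated by the preimages of the letters. *)
Lemma good_universal B : sofic_minimal_balg G B ->
  exists2 S : subalg (clopen_balg Z), finitely_generated S & balg_iso B (balg_of_subalg S).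
Proof.
move=> [A [X [/sofic_tiles[T [F [mT TX]]] minX BX]]].
have [sg lsg tsg] := liftable_tiled i0 lZ mT.
pose phi z : full_shift G A := fun h => F (sg (flow_act h^-1 z)).
have lphi : locconst (fun z => phi z 1).
  apply: (locconst_comp F); rewrite (_ : (fun z => _) = sg) //.
  by apply: funext => z; rewrite invg1 flow_act1.
have phiE g z : phi (flow_act g z) = shift g (phi z).
  by apply: funext => h; rewrite /phi /shift invgM invgK flow_actM.
have sub : range phi `<=` X by move=> _ [z _ <-]; exact: (TX _ (tsg z)).
have rX : range phi = X.
  apply/seteqP; split=> // x Xx.
  pose C : set (subshift_flow X) := set_val @^-1` range phi.
  have CT : C = setT.
    apply: minX.
    - apply: preimage_closed; first by move=> y _; exact: initial_continuous.
      exact: factor_closed.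
    - by exists (exist _ (phi z0) (mem_set (sub _ (imageP phi I)))); exists z0.
    - move=> g _ [[y Xy] /= [z _ zy] <-]; exists (flow_act g z) => //.
      by rewrite phiE zy.
  have : C (exist _ x (mem_set Xx)) by rewrite CT.
  by [].
have cl a : clopen [set z | phi z 1 = a] by exact: (locconst_clopen [set a] lphi).
have [sA sAP] : exists sA : seq A, forall a, a \in sA.
  by exists (enum A) => a; rewrite mem_enum.
pose xs : seq (clopen_balg Z) := [seq clopen_of (cl a) | a <- sA].
have bitsE z z' : bits xs z = bits xs z' <-> phi z 1 = phi z' 1.
  rewrite /bits -!map_comp; split=> [/eq_in_map e|e].
    have := e _ (sAP (phi z 1)); rewrite /= !memberE.
    by rewrite asboolT // => /esym/asboolP.
  by apply/eq_in_map => a _ /=; rewrite !memberE /= e.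
exists (generated xs); first exact: generated_fg.
apply: iso_trans BX _; apply: (factor_iso cZ lphi phiE rX) => U.
rewrite -[X in X <-> _]/((range (term_eval xs)) U) definable //.
split=> inv z z' e; apply: inv.
  by move=> g; apply/bitsE; rewrite !phiE e.
by apply: funext => h; rewrite (factor_coord phiE z) (factor_coord phiE z'); exact/bitsE/e.
Qed.

(** The itineraries of [xs] form a factor of [Z], hence a minimal subshift, with the right clopen
    algebra; refinability presents it as the image of a tile system. *)
Lemma good_sofic (S : subalg (clopen_balg Z)) : finitely_generated S ->
  sofic_minimal_balg G (balg_of_subalg S).
Proof.
move=> /fg_generated[xs SE].
pose A : finType := ((size xs).-tuple bool : finType).
pose dec u : A := insubd [tuple of nseq (size xs) false] (odflt [::] (choice.unpickle u)).
have [T [rho [pi [mT lr tr e]]]] := rZ (locconst_comp choice.pickle (bits_locconst xs)).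
pose F u : A := dec (pi u).
have FE z : val (F (rho z)) = bits xs z.
  have he : pi (rho z) = choice.pickle (bits xs z) := esym (congr1 (fun f => f z) e).
  rewrite /F /dec he choice.pickleK val_insubd.
  by rewrite size_map eqxx.
pose phi z : full_shift G A := fun h => F (rho (flow_act h^-1 z)).
have lphi : locconst (fun z => phi z 1).
  apply: (locconst_comp F); rewrite (_ : (fun z => _) = rho) //.
  by apply: funext => z; rewrite invg1 flow_act1.
have phiE g z : phi (flow_act g z) = shift g (phi z).
  by apply: funext => h; rewrite /phi /shift invgM invgK flow_actM.
have phiP z z' : phi z = phi z' <-> forall g, bits xs (flow_act g z) = bits xs (flow_act g z').
  split=> [h g|h].
    by rewrite -!FE; have := congr1 (fun f => val (f g^-1)) h; rewrite /phi invgK.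
  by apply: funext => g; apply/val_inj; rewrite !FE.
pose X := factor_subshift cZ z0 lphi phiE.
have rX : range phi = X by [].
exists A, X; split.
- have [k kP] := symbols_bound i0 T.
  have [Y sY YP] := tiles_SFT (T := T) (k := k) mT.1 (fun x g cx => kP x g cx).
  pose f (y : Y) : full_shift G A := fun h => F (val ((val y : full_shift G 'I_k) h)).
  exists 'I_k, Y, f; split=> //.
  + apply: prod_continuousP => h; apply: locconst_continuous.
    apply: (@locconst_cont _ (full_shift G 'I_k) _ (fun x => F (val (x h))) (set_val : Y -> _)).
      apply: (locconst_comp (fun u : 'I_k => F (val u))).
      exact: (@coord_locconst G (fun=> discrete_topology 'I_k)).
    exact: initial_continuous.
  + rewrite -rX; apply/seteqP; split=> [_ [y _ <-]|_ [z _ <-]].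
      have /YP/(code_onto cZ z0 mT lr tr)[z zE] := set_mem (valP y).
      exists z => //; apply: funext => h.
      have := congr1 (fun u => u h^-1) zE; rewrite /= invgK => zh.
      by rewrite /f -[X in F X]zh.
    have lt h : rho (flow_act h z) < k by have := kP _ h (tr z).
    pose y : full_shift G 'I_k := fun h => Ordinal (lt h^-1).
    have Yy : (Y : set _) y.
      apply/YP; rewrite (_ : (fun g => _) = code rho z) //.
      by apply: funext => g; rewrite /= invgK.
    by exists (exist _ y (mem_set Yy)).
- exact: (factor_minimal minZ lphi phiE rX).
- apply: iso_sym; apply: (factor_iso cZ lphi phiE rX) => U.
  rewrite SE definable //; split=> inv z z' h; apply: inv.
    exact/phiP.
  exact/phiP.
Qed.

Lemma good_fraisse : countable [set: clopen_balg Z] ->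
  fraisse_limit (sofic_minimal_balg G) (clopen_balg Z).
Proof.
move=> cB; split=> //.
- exact: good_sofic.
- exact: good_universal.
- move=> S T fS _; apply: extendable_homogeneous => //.
  exact: (good_extendable i0 z0 z0).
Qed.

End GoodFraisse.

Lemma sofic_minimal_nontrivial (G : groupType) (B : boolGalg G) :
  sofic_minimal_balg G B -> (\top != \bot :> B)%O.
Proof.
move=> [A [X [_ _ [f fi]]]]; apply/eqP => e.
have [[_ _ _ f0 f1] _ _] := iso_embedding fi.
have [x Xx] := subshift_neq0 X.
have := @member_top _ (subshift_flow X) (exist _ x (mem_set Xx)).
by rewrite -f1 e f0 member_bot.
Qed.

(** * Stone duality and homeomorphisms of Cantor-like spaces *)

Section Stone.
Variable G : groupType.
Implicit Types Z : flow G.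

Lemma clopen_separate Z (x y : Z) : zero_dimensional Z ->
  (forall U : clopen_balg Z, member U x = member U y) -> x = y.
Proof.
move=> zd e; apply/eqP/negPn/negP => /zd[U [cU Ux nUy]].
have := e (clopen_of cU); rewrite !memberE asboolT // => /esym/asboolP.
by [].
Qed.

(** The dual of [F] goes from [Z'] to [Z], and [f z] is chosen in its fibre over [z]. The fibre is
    nonempty by compactness, since an embedding sends the clopen neighbourhoods of [z] to nonempty
    sets. *)
Lemma stone_map Z Z' (F : clopen_balg Z -> clopen_balg Z') : compact [set: Z'] ->
  embedding F -> exists f : Z -> Z', forall U z, member (F U) (f z) = member U z.
Proof.
move=> cZ' [[FI FU FC F0 F1] _ Fi].
suff fE z : exists z', forall U, member U z -> member (F U) z'.
  have [f fP] := choice fE; exists f => U z; apply/idP/idP; last exact: fP.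
  apply: contraTT; rewrite -member_compl => /fP.
  by rewrite FC member_compl.
pose FF := filter_from [set U : clopen_balg Z | member U z] (fun U => val (F U) : set Z').
have PF : ProperFilter FF.
  apply: filter_from_proper.
    apply: filter_from_filter; first by exists \top%O; exact: member_top.
    move=> U V Uz Vz; exists (U `&` V)%O; first by rewrite /= member_meet Uz Vz.
    by rewrite FI val_meet.
  move=> U Uz; have : F U <> \bot%O.
    move=> e; have : U = \bot%O by apply: Fi; rewrite F0.
    by move=> U0; move: Uz; rewrite /= U0 member_bot.
  by move/bot_member/existsNP => [z' /negP/negPn/asboolP]; exists z'.
have [|z' [_ clz']] := cZ' FF _; first by exists \top%O => //; exact: member_top.
exists z' => U Uz; apply/asboolP.
have [_ clU] : clopen (val (F U) : set Z') := set_mem (valP (F U)).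
rewrite (iffLR (closure_id _) clU) => B; apply: clz'.
by exists U.
Qed.


Lemma stone_iso Z Z' (F : clopen_balg Z -> clopen_balg Z') :
  compact [set: Z] -> hausdorff_space Z -> zero_dimensional Z ->
  compact [set: Z'] -> hausdorff_space Z' -> zero_dimensional Z' ->
  is_balg_iso F -> exists (f : Z -> Z') (f' : Z' -> Z),
    [/\ cancel f f', cancel f' f, continuous f, continuous f' &
        (forall U z, member (F U) (f z) = member U z) /\
        forall g z, f (flow_act g z) = flow_act g (f z)].
Proof.
move=> cZ hZ zZ cZ' hZ' zZ' Fi.
have eF := iso_embedding Fi; have [mF aF [F' FK FK']] := Fi.
have [f fE] := stone_map cZ' eF.
have eF' : embedding F'.
  have [[fI fU fC f0 f1] fA _] := eF; split.
  - split=> [x y|x y|x||]; apply: (can_inj FK).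
    + by rewrite fI !FK'.
    + by rewrite fU !FK'.
    + by rewrite fC !FK'.
    + by rewrite f0 FK'.
    + by rewrite f1 FK'.
  - by move=> g x; apply: (can_inj FK); rewrite fA !FK'.
  - exact: can_inj FK'.
have [f' f'E] := stone_map cZ eF'.
have cont (Y Y' : flow G) (H : clopen_balg Y -> clopen_balg Y') H' (h : Y -> Y') :
    cancel H' H -> compact [set: Y'] -> hausdorff_space Y' -> zero_dimensional Y' ->
    (forall U z, member (H U) (h z) = member U z) -> continuous h.
  move=> HK cY' hY' zY' hE z N /(zero_dimensional_cvg hY' zY' cY')[V [Vz cV] VN].
  pose U := H' (clopen_of cV).
  have Uz : (val U : set Y) z.
    have : member U z by rewrite -hE /U HK memberE; apply/asboolP.
    by move/asboolP.
  have [oU _] : clopen (val U : set Y) := set_mem (valP U).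
  have nU : nbhs z (val U : set Y) by apply: open_nbhs_nbhs.
  apply: filterS nU => y Uy; apply: VN.
  have : member U y by apply/asboolP.
  by rewrite -hE /U HK memberE => /asboolP.
exists f, f'; split.
- by move=> z; apply: clopen_separate => // U; rewrite -{1}(FK U) f'E fE.
- by move=> z; apply: clopen_separate => // U; rewrite -{1}(FK' U) fE f'E.
- exact: cont FK' cZ' hZ' zZ' fE.
- exact: cont FK cZ hZ zZ f'E.
- split=> // g z; apply: clopen_separate => // U.
  have actE (Y : flow G) (V : clopen_balg Y) y :
      member V (flow_act g y) = member (balg_act g^-1 V) y.
    by rewrite member_act invgK.
  by rewrite -[U]FK' fE !actE -aF fE.
Qed.

End Stone.

(* Trivial actions turn the back-and-forth argument into the uniqueness of the
   countable atomless Boolean algebra. *)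
Section CantorAlgebra.
Variable G : groupType.

Definition trivial_flow (X : topologicalType) : flow G :=
  @Flow G X (fun _ x => x) (fun _ _ => cvg_id) (fun _ => erefl) (fun _ _ _ => erefl).

Lemma cantor_extendable (X X' : topologicalType) : cantor_like X -> cantor_like X' ->
  extendable (clopen_balg (trivial_flow X)) (clopen_balg (trivial_flow X')).
Proof.
move=> [_ cX _ _] [pX' cX' hX' zX'] p pe a.
set xs := unzip1 p; set ys := unzip2 p.
have szx z : size (bits xs z) = size p by rewrite !size_map.
have szy z : size (bits ys z) = size p by rewrite !size_map.
have ev (Y : topologicalType) (us : seq (clopen_balg (trivial_flow Y))) t :
    term_eval us t <> \bot%O <-> exists y, sat t (fun _ => bits us y) by exact: term_eval_neq_bot.
have patE (v : seq bool) : size v = size p ->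
    (exists x, bits xs x = v) <-> exists x', bits ys x' = v.
  move=> sv; have [t tP] := pattern_term (b0 := fun _ : G => v) [:: 1] (fun=> sv).
  have tE (b : G -> seq bool) : (forall g, size (b g) = size p) -> sat t b <-> b 1 = v.
    move=> sb; rewrite tP //; split=> [|e g]; first by apply; exact: mem_head.
    by rewrite inE => /eqP->.
  have h1 : (exists x, bits xs x = v) <-> term_eval xs t <> \bot%O.
    by rewrite ev; split=> -[x h]; exists x; move: h; rewrite (tE _ (fun=> szx x)).
  have h2 : (exists x, bits ys x = v) <-> term_eval ys t <> \bot%O.
    by rewrite ev; split=> -[x h]; exists x; move: h; rewrite (tE _ (fun=> szy x)).
  by rewrite h1 h2; split=> h e; apply: h; apply/(pe t).
(* Atoms are treated one at a time: if [a] cuts an atom of [X] in two, perfectness splits the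
   matching atom of [X']; otherwise the whole atom or nothing is taken. *)
have splitE (v : seq bool) : exists U : clopen_balg (trivial_flow X'), forall e : bool,
    (exists x, bits xs x = v /\ member a x = e) <->
    (exists x', bits ys x' = v /\ member U x' = e).
  have [sv|nsv] := eqVneq (size v) (size p); last first.
    exists \top%O => e; split=> -[x [xv _]]; case/eqP: nsv; by rewrite -xv.
  have h := patE v sv.
  have [[x [xv ax]]|nx] := pselect (exists x, bits xs x = v /\ member a x = true).
    have [[y [yv ay]]|ny] := pselect (exists x, bits xs x = v /\ member a x = false).
      have [x' x'v] : exists x', bits ys x' = v by apply/h; exists x.
      have oV : open [set x' : X' | bits ys x' = v].
        by have [] := locconst_clopen [set v] (bits_locconst ys).
      have [x1 [x2 [x1v x2v /zX'[U [cU Ux1 nUx2]]]]] :=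
        (iffLR perfectTP_ex) pX' _ oV (ex_intro _ x' x'v).
      exists (@clopen_of _ (trivial_flow X') _ cU) => -[].
        by split=> _; [exists x1|exists x]; split=> //; rewrite memberE; apply/asboolP.
      by split=> _; [exists x2|exists y]; split=> //; rewrite memberE; apply/asboolP.
    exists \top%O => -[]; split.
    - by move=> [z [zv _]]; have [|z' z'v] := h.1; [by exists z|exists z'; rewrite member_top].
    - by move=> _; exists x.
    - by move=> hf; case: ny.
    - by move=> [z' [_]]; rewrite member_top.
  exists \bot%O => -[]; split.
  - by move=> hf; case: nx.
  - by move=> [z' [_]]; rewrite member_bot.
  - by move=> [z [zv _]]; have [|z' z'v] := h.1; [by exists z|exists z'; rewrite member_bot].
  - move=> [z' [z'v _]]; have [|z zv] := h.2; [by exists z'|exists z; split=> //].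
    by apply/negbTE/negP => az; case: nx; exists z.
have [U UP] := choice splitE.
pose bf (x' : X') := member (U (bits ys x')) x'.
have lbf : locconst bf.
  move=> x'; apply: filterS (filterI (bits_locconst ys x')
    (member_locconst (U (bits ys x')) x')) => y [/= e1 e2].
  by rewrite /bf e1 e2.
have cb : clopen [set x' : X' | bf x'] by exact: (locconst_clopen [set e | is_true e] lbf).
pose b := @clopen_of _ (trivial_flow X') _ cb; exists b.
have bE x' : member b x' = bf x' by rewrite memberE asboolb.
have UP' v e : (exists x, bits (a :: xs) x = e :: v) <->
    exists x', bits (b :: ys) x' = e :: v.
  have := UP v e; rewrite /= => h; split.
    move=> [x [ax xv]]; have [|x' [x'v Ux']] := h.1; first by exists x.
    by exists x'; rewrite bE /bf x'v Ux'.
  move=> [x' [+ x'v]]; rewrite bE /bf x'v => Ux'.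
  by have [|x [xv ax]] := h.2; [by exists x'|exists x; rewrite ax xv].
apply: pequiv_neq => t.
rewrite !ev; split=> -[x tx].
  have [|x' x'E] := (UP' (bits xs x) (member a x)).1; first by exists x.
  by exists x'; rewrite x'E.
have [|x' x'E] := (UP' (bits ys x) (member b x)).2; first by exists x.
by exists x'; rewrite x'E.
Qed.

Lemma countable_clopen_balg (Z : flow G) : countable [set U : set Z | clopen U] ->
  countable [set: clopen_balg Z].
Proof.
move=> /countable_injP[f fi]; apply/countable_injP; exists (fun U => f (val U)).
move=> U V _ _ /fi e; apply/val_inj; apply: e; rewrite inE; exact: set_mem (valP _).
Qed.

(** The back-and-forth starts from the matched fibres of the labellings; whether a Boolean
    combination of fibres vanishes depends on the range alone. *)
Lemma cantor_homeo (X X' : topologicalType) (gamma : X -> nat) (gamma' : X' -> nat) :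
  cantor_like X -> cantor_like X' ->
  countable [set U : set X | clopen U] -> countable [set U : set X' | clopen U] ->
  locconst gamma -> locconst gamma' -> range gamma = range gamma' ->
  exists (f : X -> X') (f' : X' -> X), [/\ cancel f f', cancel f' f,
    continuous f, continuous f' & gamma' \o f = gamma].
Proof.
move=> lX lX' cX cX' lg lg' rg.
pose Y := trivial_flow X; pose Y' := trivial_flow X'.
have [_ kX hX zX] := lX; have [_ kX' hX' zX'] := lX'.
have [k kP] := compact_locconst kX lg.
pose U v := @clopen_of _ Y _ (locconst_clopen [set v] lg).
pose U' v := @clopen_of _ Y' _ (locconst_clopen [set v] lg').
pose p := [seq (U v, U' v) | v <- iota 0 k].
have bitsE x : bits (unzip1 p) x = [seq gamma x == v | v <- iota 0 k].
  rewrite /bits /unzip1 /p -!map_comp; apply: eq_map => v /=.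
  by rewrite memberE; apply/asboolP/eqP.
have bitsE' x : bits (unzip2 p) x = [seq gamma' x == v | v <- iota 0 k].
  rewrite /bits /unzip2 /p -!map_comp; apply: eq_map => v /=.
  by rewrite memberE; apply/asboolP/eqP.
have pe : pequiv p.
  apply: pequiv_neq => t; rewrite !term_eval_neq_bot; split=> -[x tx].
    have [x' _ e] : range gamma' (gamma x) by rewrite -rg; exists x.
    have bb : bits (unzip2 p) x' = bits (unzip1 p) x by rewrite bitsE' e bitsE.
    by exists x'; rewrite -[is_true _]/(is_true (sat t (fun=> bits (unzip2 p) x'))) bb.
  have [x' _ e] : range gamma (gamma' x) by rewrite rg; exists x.
  have bb : bits (unzip1 p) x' = bits (unzip2 p) x by rewrite bitsE' bitsE e.
  by exists x'; rewrite -[is_true _]/(is_true (sat t (fun=> bits (unzip1 p) x'))) bb.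
have [F Fi FE] := back_forth (countable_clopen_balg (Z := Y) cX)
  (countable_clopen_balg (Z := Y') cX') (cantor_extendable lX lX')
  (cantor_extendable lX' lX) pe.
have [f [f' [fK fK' cf cf' [fE _]]]] := @stone_iso _ Y Y' F kX hX zX kX' hX' zX' Fi.
exists f, f'; split=> //; apply: funext => x /=.
have FU : F (U (gamma x)) = U' (gamma x).
  by apply: FE; apply/mapP; exists (gamma x); rewrite // mem_iota kP.
have := fE (U (gamma x)) x; rewrite FU !memberE => e.
by have /asboolP : `[< (gamma' @^-1` [set gamma x]) (f x) >] by rewrite e; apply/asboolP.
Qed.

End CantorAlgebra.

Lemma countable_clopen (X : topologicalType) (w : nat -> X -> nat) :
  compact [set: X] -> (forall n, locconst (w n)) ->
  (forall n x y, w n.+1 x = w n.+1 y -> w n x = w n y) ->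
  (forall x y, (forall n, w n x = w n y) -> x = y) ->
  countable [set U : set X | clopen U].
Proof.
move=> cX lw dw sw.
pose dec (c : nat * seq nat) := [set x | w c.1 x \in c.2].
apply: (@sub_countable _ _ _ (range dec)); last first.
  exact/(card_le_trans (card_image_le _ _))/countableP.
apply: subset_card_le => U cU.
have [|n nP] := locconst_factor cX lw dw (clopen_locconst cU).
  by move=> x y /sw ->.
have [k kP] := compact_locconst cX (lw n).
exists (n, [seq u <- iota 0 k | `[< exists2 x, w n x = u & U x >]]) => //.
apply/seteqP; split=> x; rewrite /dec /= mem_filter mem_iota kP leq0n !andbT.
  move=> /asboolP[y e Uy]; apply/asboolP; rewrite -(nP y x e); exact/asboolP.
by move=> Ux; apply/asboolP; exists x.
Qed.

Lemma cantor_window_separates (x y : cantor_space) :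
  (forall n, [seq x i | i <- iota 0 n] = [seq y i | i <- iota 0 n]) -> x = y.
Proof.
move=> e; apply: funext => i; have /eq_in_map := e i.+1; apply.
by rewrite mem_iota /= add0n.
Qed.

Lemma cantor_window_locconst n : locconst (fun x : cantor_space => [seq x i | i <- iota 0 n]).
Proof. by apply: locconst_map => i; exact: (@coord_locconst nat (fun=> bool)). Qed.

Lemma cantor_countable_clopen : countable [set U : set cantor_space | clopen U].
Proof.
apply: (@countable_clopen cantor_space (fun n x => choice.pickle [seq x i | i <- iota 0 n])).
- exact: cantor_space_compact.
- by move=> n; apply: locconst_comp; exact: cantor_window_locconst.
- move=> n x y /(pcan_inj choice.pickleK)/eq_in_map e; congr choice.pickle.
  apply/eq_in_map => i; rewrite mem_iota => /andP[_ ni]; apply: e.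
  by rewrite mem_iota /= leqW.
- move=> x y e; apply: cantor_window_separates => n.
  exact: (pcan_inj choice.pickleK) (e n).
Qed.

(** * Construction of a good action *)

Section Chain.
Variable d : nat.
Variable i0 : 'I_d.
Local Notation G := (free_group d).

(** A request to lift the coding by stage [m] along the map [nth 0 s] defined on [T']. Tabulating
    the map as a list keeps tasks countable. *)
Definition task := (nat * (nat * (tiles d * seq nat)))%type.

(* [P m] maps the current stage to the stage [m]; the first component of a task is
   a dummy, making every task recur at arbitrarily late stages. *)
Lemma chain_step n (Q : tiles d) (P : nat -> nat -> nat) (c : task) : min_tiles Q ->
  exists (Q' : tiles d) (phi : nat -> nat), [/\ min_tiles Q', tiles_map Q' Q phi,
    forall y y', conf Q' y -> conf Q' y' -> y 1 = y' 1 -> agree 1 (phi \o y) (phi \o y') &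
    let: (m, (T', s)) := c.2 in
    (m <= n)%N -> min_tiles T' ->
    (exists T, [/\ min_tiles T, tiles_map Q T (P m) & tiles_map T' T (nth 0 s)]) ->
    exists2 sg, tiles_map Q' T' sg & forall y, conf Q' y ->
      nth 0 s \o sg \o y = P m \o phi \o y].
Proof.
move=> mQ; case: c => _ [m [T' s]] /=.
have [[[T [mT QT T'T]] mT']|nv] := pselect ((exists T, [/\ min_tiles T, tiles_map Q T (P m) &
    tiles_map T' T (nth 0 s)]) /\ min_tiles T'); last first.
  have [Q' [phi [mQ' Qphi agr]]] := min_tiles_refine i0 1 mQ.
  by exists Q', phi; split=> // _ mT' vT; case: nv.
have [[x cx] _] := mQ.
have [y cy yx] := tiles_map_onto i0 mT T'T mT'.1 (QT _ cx).
(* The fibre product of the current stage and [T'] over [T] solves the task; the radius-one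
   refinement is what will let the stages separate points of the limit. *)
have [T1 [a [b [mT1 Qa Tb ab]]]] := fiber_product i0 cx cy (esym yx).
have [Q' [phi [mQ' Qphi agr]]] := min_tiles_refine i0 1 mT1.
exists Q', (a \o phi); split=> //.
- by move=> z cz; exact: (Qa _ (Qphi _ cz)).
- by move=> z z' cz cz' zz' w wn /=; congr a; exact: agr.
- move=> _ _ _; exists (b \o phi); first by move=> z cz; exact: (Tb _ (Qphi _ cz)).
  by move=> z cz; apply/esym; exact: (ab _ (Qphi _ cz)).
Qed.

Lemma chain_exists (tasks : nat -> task) : exists (Q : nat -> tiles d)
    (phi : nat -> nat -> nat) (P : nat -> nat -> nat -> nat),
  [/\ forall n, min_tiles (Q n), forall n, tiles_map (Q n.+1) (Q n) (phi n),
    forall n y y', conf (Q n.+1) y -> conf (Q n.+1) y' -> y 1 = y' 1 ->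
      agree 1 (phi n \o y) (phi n \o y'),
    (forall n, P n n = id) /\ (forall n m, (m <= n)%N -> P n.+1 m = P n m \o phi n) &
    forall n, let: (m, (T', s)) := (tasks n).2 in
    (m <= n)%N -> min_tiles T' ->
    (exists T, [/\ min_tiles T, tiles_map (Q n) T (P n m) & tiles_map T' T (nth 0 s)]) ->
    exists2 sg, tiles_map (Q n.+1) T' sg & forall y, conf (Q n.+1) y ->
      nth 0 s \o sg \o y = P n.+1 m \o y].
Proof.
have stepE (c : nat * (tiles d * (nat -> nat -> nat))) : exists r : tiles d * (nat -> nat),
    min_tiles c.2.1 -> [/\ min_tiles r.1, tiles_map r.1 c.2.1 r.2,
    forall y y', conf r.1 y -> conf r.1 y' -> y 1 = y' 1 ->
      agree 1 (r.2 \o y) (r.2 \o y') &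
    let: (m, (T', s)) := (tasks c.1).2 in
    (m <= c.1)%N -> min_tiles T' ->
    (exists T, [/\ min_tiles T, tiles_map c.2.1 T (c.2.2 m) & tiles_map T' T (nth 0 s)]) ->
    exists2 sg, tiles_map r.1 T' sg & forall y, conf r.1 y ->
      nth 0 s \o sg \o y = c.2.2 m \o r.2 \o y].
  have [mQ|nQ] := pselect (min_tiles c.2.1); last by exists ([::], id).
  have [Q' [phi h]] := chain_step c.1 c.2.2 (tasks c.1) mQ.
  by exists (Q', phi).
have [st stP] := choice stepE.
pose S := fix S n : tiles d * (nat -> nat -> nat) :=
  if n is m.+1 then
    let r := st (m, S m) in
    (r.1, fun l => if (l <= m)%N then (S m).2 l \o r.2 else id)
  else (cyclic_tiles d 1, fun _ => id).
have mS n : min_tiles (S n).1.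
  by elim: n => [|n IH] /=; [exact: cyclic_min_tiles|have [] := stP (n, S n) IH].
exists (fun n => (S n).1), (fun n => (st (n, S n)).2), (fun n => (S n).2); split=> //.
- by move=> n; have [] := stP (n, S n) (mS n).
- by move=> n; have [] := stP (n, S n) (mS n).
- by split=> [[|n] //=|n m mn /=]; rewrite ?ltnn // mn.
- move=> n; have [_ _ _] := stP (n, S n) (mS n).
  rewrite /=; case: (tasks n) => _ [m [T' s]] /= h mn mT' vT.
  have [sg sg1 sg2] := h mn mT' vT; exists sg => // y cy.
  by rewrite mn; exact: sg2.
Qed.

End Chain.

(** * The inverse limit of a chain of tile systems *)

Section Limit.
Variable d : nat.
Variable i0 : 'I_d.
Local Notation G := (free_group d).

Lemma task_recurs (T : tiles d) (s : seq nat) m : exists n, m <= n /\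
  exists j, choice.unpickle n = Some (j, (m, (T, s))) :>
    option (nat * (nat * (seq ('I_d * (nat * nat)) * seq nat))).
Proof.
pose f j := choice.pickle ((j, (m, (T, s))) : nat * (nat * (seq ('I_d * (nat * nat)) * seq nat))).
have fi : injective f by move=> i j /(pcan_inj choice.pickleK)[].
have [j mj] : exists j, m <= f j.
  apply: contrapT => /forallNP nf.
  have fm j : f j < m by rewrite ltnNge; apply/negP/nf.
  have : injective (fun j : 'I_m.+1 => Ordinal (fm j)).
    by move=> i j [/fi]; exact: val_inj.
  by move=> /leq_card; rewrite !card_ord ltnn.
by exists (f j); split=> //; exists j; rewrite choice.pickleK.
Qed.

Variables (Q : nat -> tiles d) (phi : nat -> nat -> nat) (P : nat -> nat -> nat -> nat).
Hypothesis mQ : forall n, min_tiles (Q n).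
Hypothesis phiQ : forall n, tiles_map (Q n.+1) (Q n) (phi n).
Hypothesis phi_agree : forall n y y', conf (Q n.+1) y -> conf (Q n.+1) y' ->
  y 1 = y' 1 -> agree 1 (phi n \o y) (phi n \o y').
Hypothesis Pid : forall n, P n n = id.
Hypothesis Pstep : forall n m, (m <= n)%N -> P n.+1 m = P n m \o phi n.
Hypothesis Qtask : forall m T' s, min_tiles T' ->
  (exists T, [/\ min_tiles T, (forall n, m <= n -> tiles_map (Q n) T (P n m)) &
     tiles_map T' T (nth 0 s)]) ->
  exists n sg, [/\ m <= n, tiles_map (Q n) T' sg & forall y, conf (Q n) y ->
      nth 0 s \o sg \o y = P n m \o y].

Definition big_space := prod_topology (fun _ : nat * G => discrete_topology nat).

Definition limit_set : set big_space :=
  [set z | forall n, conf (Q n) (fun g => z (n, g)) /\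
     forall g, z (n, g) = phi n (z (n.+1, g))].

Lemma big_coord (ng : nat * G) : locconst (fun z : big_space => z ng).
Proof. exact: (@coord_locconst _ (fun _ => discrete_topology nat)). Qed.

Lemma limit_closed : closed limit_set.
Proof.
have -> : limit_set = \bigcap_(c in [set: nat * (G * 'I_d)]) [set z : big_space |
    (c.2.2, (z (c.1, c.2.1), z (c.1, gen (c.2.2, false) * c.2.1))) \in Q c.1 /\
    z (c.1, c.2.1) = phi c.1 (z (c.1.+1, c.2.1))].
  apply/seteqP; split=> z h.
    by move=> [n [g i]] _ /=; have [cz zE] := h n; split; [exact: cz|exact: zE].
  move=> n; split; first by move=> g i; have [] := h (n, (g, i)) I.
  by move=> g; have [] := h (n, (g, i0)) I.
apply: closed_bigI => -[n [g i]] _ /=.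
have [_] := locconst_clopen [set u : (nat * nat) * nat | (i, u.1) \in Q n /\ u.1.1 = phi n u.2]
  (locconst_pair (locconst_pair (big_coord (n, g)) (big_coord (n, gen (i, false) * g)))
    (big_coord (n.+1, g))).
by [].
Qed.

Lemma limit_compact : compact [set: limit_set].
Proof.
apply: compact_set_type.
pose K := [set z : big_space | forall ng, [set` symbols (Q ng.1)] (z ng)].
have cK : compact K.
  apply: (@tychonoff (nat * G)%type (fun _ => discrete_topology nat)
    (fun ng => [set` symbols (Q ng.1)])) => ng.
  by apply: finite_compact; exact: finite_seq.
apply: (subclosed_compact limit_closed cK) => z zL [n g] /=.
have [cz _] := zL n; exact: (conf_symbols i0 g cz).
Qed.

Lemma limit_act_subproof g (z : limit_set) :
  (fun ng => val z (ng.1, ng.2 * g)) \in limit_set.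
Proof.
rewrite inE => n; have [cz zE] := set_mem (valP z) n; split=> [h i|h] /=.
  by rewrite -mulgA; exact: cz.
exact: zE.
Qed.

Definition limit_act g (z : limit_set) : limit_set :=
  exist (fun z => z \in limit_set) _ (limit_act_subproof g z).

Lemma limit_coord (ng : nat * G) : locconst (fun z : limit_set => val z ng).
Proof.
apply: (@locconst_cont _ big_space _ (fun z => z ng) (set_val : limit_set -> _)).
  exact: big_coord.
exact: initial_continuous.
Qed.

Lemma limit_act_cont g : continuous (limit_act g).
Proof.
apply: initial_continuousP; apply: prod_continuousP => -[n h].
apply: locconst_continuous; exact: (limit_coord (n, h * g)).
Qed.

Lemma limit_act1 z : limit_act 1 z = z.
Proof. by apply/val_inj/funext => -[n g]; rewrite /= mulg1. Qed.

Lemma limit_actM g h z : limit_act (g * h) z = limit_act g (limit_act h z).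
Proof. by apply/val_inj/funext => -[n k]; rewrite /= mulgA. Qed.

Definition limit_flow : flow G := Flow limit_act_cont limit_act1 limit_actM.
Local Notation Z := limit_flow.

Definition stage n (z : Z) : nat := (val z : big_space) (n, 1).

Lemma stage_code n (z : Z) : code (stage n) z = fun g => (val z : big_space) (n, g).
Proof. by apply: funext => g; rewrite /code /stage /= mul1g. Qed.

Lemma stage_tiled n : tiled (Q n) (stage n).
Proof. by move=> z; rewrite stage_code; have [] := set_mem (valP z) n. Qed.

Lemma stage_locconst n : locconst (stage n).
Proof. exact: limit_coord. Qed.

Lemma stage_phi n z : stage n z = phi n (stage n.+1 z).
Proof. by have [_ zE] := set_mem (valP z) n; exact: zE. Qed.

Lemma stage_P n m z : m <= n -> stage m z = P n m (stage n z).
Proof.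
elim: n => [|n IH]; first by rewrite leqn0 => /eqP->; rewrite Pid.
rewrite leq_eqVlt => /orP[/eqP->|]; first by rewrite Pid.
by rewrite ltnS => mn; rewrite Pstep //= -stage_phi IH.
Qed.

Lemma stage_refine n (z z' : Z) : stage n.+1 z = stage n.+1 z' -> stage n z = stage n z'.
Proof. by rewrite (stage_phi n z) (stage_phi n z') => ->. Qed.

(** By [phi_agree], a symbol at level [n.+1] determines the level [n] symbols at the neighbouring
    nodes. Induction along words spreads equality from the root to every node. *)
Lemma stage_sep (z z' : Z) : (forall n, stage n z = stage n z') -> z = z'.
Proof.
move=> e; apply/val_inj/funext => -[n g].
elim/word_ind: g n => [|a g _ _ IH] n; first exact: e.
have trans (x : Z) : conf (Q n.+1) (translate g (fun h => (val x : big_space) (n.+1, h))).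
  by have [cz _] := set_mem (valP x) n.+1; exact: conf_translate.
have := phi_agree (trans z) (trans z'); rewrite /translate mul1g => /(_ (IH n.+1)).
move=> /(_ (gen a) isT) /=.
have [_ zE] := set_mem (valP z) n; have [_ zE'] := set_mem (valP z') n.
by rewrite -zE -zE'.
Qed.

Lemma limit_neq0 : exists z : Z, True.
Proof.
have ex (c : nat * (G -> nat)) : exists y, conf (Q c.1) c.2 ->
    conf (Q c.1.+1) y /\ phi c.1 \o y = c.2.
  have [cc|nc] := pselect (conf (Q c.1) c.2); last by exists c.2.
  have [y cy yE] := tiles_map_onto i0 (mQ c.1) (@phiQ c.1) (mQ c.1.+1).1 cc.
  by exists y.
have [nx nxP] := choice ex.
have [[y0 cy0] _] := mQ 0.
pose y := fix y n := if n is m.+1 then nx (m, y m) else y0.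
have cy n : conf (Q n) (y n).
  by elim: n => //= n IH; have [] := nxP (n, y n) IH.
have yL : (fun ng => y ng.1 ng.2) \in limit_set.
  rewrite inE => n; split; first exact: cy.
  move=> g /=; have [_ e] := nxP (n, y n) (cy n).
  by rewrite -[LHS]/((n, y n).2 g) -e.
by exists (exist (fun z => z \in limit_set) _ yL).
Qed.

Lemma stage_factor W (f : Z -> W) : locconst f -> exists n, forall z z',
  stage n z = stage n z' -> f z = f z'.
Proof.
move=> lf; apply: (locconst_factor limit_compact stage_locconst stage_refine lf).
by move=> z z' /stage_sep->.
Qed.

Lemma stage_factorE (f : Z -> nat) : locconst f -> exists n psi, f = psi \o stage n.
Proof.
move=> /stage_factor[n nP].
have ex u : exists v, forall z, stage n z = u -> f z = v.
  have [[z zu]|nz] := pselect (exists z, stage n z = u).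
    by exists (f z) => z' z'u; apply: nP; rewrite zu.
  by exists 0 => z zu; case: nz; exists z.
have [psi psiP] := choice ex; exists n, psi.
by apply: funext => z /=; exact: psiP.
Qed.

Lemma limit_refinable : refinable Z.
Proof.
move=> gamma /stage_factorE[n [psi ->]].
by exists (Q n), (stage n), psi; split=> //; [exact: stage_locconst|exact: stage_tiled].
Qed.

Lemma stage_onto n y : conf (Q n) y -> exists z, code (stage n) z = y.
Proof.
move=> cy; have [z0 _] := limit_neq0.
exact: (@code_onto _ Z limit_compact _ _ z0 (mQ n) (@stage_locconst n) (@stage_tiled n) _ cy).
Qed.

Lemma P_tiles_map n m : m <= n -> tiles_map (Q n) (Q m) (P n m).
Proof.
move=> mn y /stage_onto[z <-].
have -> : P n m \o code (stage n) z = code (stage m) z.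
  by apply: funext => g; rewrite /code /= -stage_P.
exact: stage_tiled.
Qed.

(** Tasks lift a stage itself, whereas [rho] is only a function [psi] of stage [m]. The fibre
    product of [Q m] and [T'] over [T] bridges this: a lift of stage [m] to it also lifts [rho]. *)
Lemma limit_liftable : liftable Z.
Proof.
move=> T T' pi rho mT mT' piT lr tr.
have [m [psi rE]] := stage_factorE lr.
have psiT : tiles_map (Q m) T psi.
  move=> y /stage_onto[z <-].
  have -> : psi \o code (stage m) z = code rho z by rewrite rE.
  exact: tr.
have [[x cx] _] := mQ m.
have [y cy yx] := tiles_map_onto i0 mT piT mT'.1 (psiT _ cx).
have [T1 [a [b [mT1 Qa Tb ab]]]] := fiber_product i0 cx cy (esym yx).
have [k kP] := symbols_bound i0 T1.
pose s := [seq a u | u <- iota 0 k].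
have sE z : conf T1 z -> nth 0 s \o z = a \o z.
  move=> cz; apply: funext => g /=; have zk := kP _ g cz.
  by rewrite (nth_map 0) ?size_iota // nth_iota.
have [|n [sg [mn sgT sgE]]] := @Qtask m T1 s mT1.
  exists (Q m); split=> //; first by move=> n; exact: P_tiles_map.
  by move=> z cz; rewrite sE //; exact: Qa.
exists (b \o sg \o stage n); split.
- apply: (locconst_comp (b \o sg)); exact: stage_locconst.
- move=> z; apply: (Tb (sg \o code (stage n) z)); apply: sgT; exact: stage_tiled.
- apply: funext => z.
  have cz := stage_tiled n z; have csz := sgT _ cz.
  have e1 := congr1 (fun f => f 1) (ab _ csz).
  have e2 := congr1 (fun f => f 1) (sgE _ cz).
  have e3 := congr1 (fun f => f 1) (sE _ csz).
  move: e1 e2 e3; rewrite /= /code flow_act1 => e1 e2 e3.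
  by rewrite /= -e1 -e3 e2 -stage_P // rE.
Qed.

Lemma limit_minimal : minimal Z.
Proof.
move=> C clC [c0 Cc0] invC; apply/seteqP; split=> // z _.
have cC : compact C by exact: (subclosed_compact clC limit_compact).
have [|||c Cc cz] := @compact_nested Z C (fun n => stage n @^-1` [set stage n z]) cC.
- by move=> n; have [] := locconst_clopen [set stage n z] (stage_locconst n).
- by move=> n c /=; exact: stage_refine.
- move=> n; have [_ /(_ _ _ (stage_tiled n c0) (stage_tiled n z) 0)[g gP]] := mQ n.
  exists (flow_act g c0); split; first by apply: invC; exists c0.
  have := gP 1 isT; rewrite /translate mul1g /code flow_act1.
  by [].
- by have <- : c = z by apply: stage_sep.
Qed.

Lemma limit_zero_dimensional : zero_dimensional Z.
Proof.
move=> z z' /eqP zz'.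
have [n nz] : exists n, stage n z <> stage n z'.
  by apply/not_existsP => h; apply: zz'; apply: stage_sep => n; apply: contrapT; exact: h.
exists (stage n @^-1` [set stage n z]); split=> //; last by move=> /= e; exact: nz.
exact: locconst_clopen (stage_locconst n).
Qed.

Lemma zero_dimensional_hausdorff (X : topologicalType) : zero_dimensional X -> hausdorff_space X.
Proof.
move=> zX x y cxy; apply/eqP/negPn/negP => /zX[U [[oU cU] Ux nUy]].
have [z [Uz nUz]] : U `&` ~` U !=set0.
  apply: cxy; apply: open_nbhs_nbhs; split=> //.
  by rewrite openC.
exact: nUz.
Qed.

(** Every orbit meets an isolated point [z], by compactness within a bounded time, so the orbit of
    [z] is finite; but liftability provides cyclic codings of every period. *)
Lemma limit_perfect : perfect_set [set: Z].
Proof.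
apply/perfectTP => z oz.
have hZ : hausdorff_space Z by exact/zero_dimensional_hausdorff/limit_zero_dimensional.
have cz : clopen [set z].
  split=> //; exact/accessible_closed_set1/hausdorff_accessible.
have [N NP] : exists N, forall x, exists2 g, g \in wball d N & flow_act g x = z.
  apply: contrapT => /forallNP nN.
  have [|||x _ xP] := @compact_nested Z setT (fun n => [set x | forall g, g \in wball d n ->
      flow_act g x <> z]) limit_compact.
  - move=> n; rewrite (_ : [set _ | _] = \bigcap_(g in [set g | g \in wball d n])
        [set x | flow_act g x <> z]); last first.
      by apply/seteqP; split=> x h; [move=> g; exact: h|move=> g gn; exact: (h g gn)].
    apply: closed_bigI => g _.
    have lc := locconst_cont (clopen_locconst cz) (@flow_cont _ Z g).
    have [_] := locconst_clopen [set b | ~~ b] lc; congr closed.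
    by apply/seteqP; split=> x /= /asboolPn.
  - by move=> n x xP g gn; apply: xP; move: gn; rewrite !mem_wball => /leqW.
  - move=> n; have /existsNP[x nx] := nN n; exists x; split=> // g gn gx.
    by apply: nx; exists g.
  have orb : \bigcup_(g in [set: G]) [set x | flow_act g x = z] = setT.
    have oV : open (\bigcup_(g in [set: G]) [set x : Z | flow_act g x = z]).
      apply: bigcup_open => g _.
      have lc := locconst_cont (clopen_locconst cz) (@flow_cont _ Z g).
      have := locconst_open [set b | is_true b] lc; congr open.
      by apply/seteqP; split=> y /= /asboolP.
    apply: contrapT => nT.
    have : ~` (\bigcup_(g in [set: G]) [set x : Z | flow_act g x = z]) = setT.
      apply: limit_minimal.
      - by rewrite closedC.
      - apply: contrapT => ne; apply: nT; apply/seteqP; split=> // y _.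
        by apply: contrapT => ny; apply: ne; exists y.
      - move=> g _ [y ny <-] [h _ hy]; apply: ny; exists (h * g) => //.
        exact: etrans (flow_actM h g y) hy.
    move=> /seteqP[_ /(_ z I)]; apply; exists 1 => //; exact: flow_act1.
  have : (\bigcup_(g in [set: G]) [set y | flow_act g y = z]) x by rewrite orb.
  case=> g _ /= gx; apply: (xP (size (word g)) g) => //.
  by rewrite mem_wball.
(* One more than a bound for the size of the orbit of [z]. *)
pose k := (size (wball d N)).+1.
have mk : min_tiles (cyclic_tiles d k) by exact: cyclic_min_tiles.
have [sg lsg tsg] := liftable_tiled i0 limit_liftable mk.
have sub : {subset iota 0 k <= [seq sg (flow_act g^-1 z) | g <- wball d N]}.
  move=> u; rewrite mem_iota add0n => /= uk.
  have [g gu] := cyclic_onto i0 (tsg z) uk.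
  have [h hN hg] := NP (flow_act g z).
  have e : flow_act h^-1 z = flow_act g z by rewrite -[in LHS]hg -flow_actM mulVg flow_act1.
  have eu : u = sg (flow_act h^-1 z) by rewrite e -gu.
  by apply/mapP; exists h; [exact: hN|exact: eu].
have := uniq_leq_size (iota_uniq 0 k) sub.
by rewrite size_iota size_map ltnn.
Qed.

Lemma limit_cantor_like : cantor_like Z.
Proof.
split; [exact: limit_perfect|exact: limit_compact| |exact: limit_zero_dimensional].
exact/zero_dimensional_hausdorff/limit_zero_dimensional.
Qed.

Lemma limit_countable : countable [set U : set Z | clopen U].
Proof.
apply: (countable_clopen limit_compact stage_locconst stage_refine stage_sep).
Qed.

End Limit.

Lemma good_flow_exists d (i0 : 'I_d) : exists (Z : flow (free_group d)) (_ : Z),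
  [/\ cantor_like Z, countable [set U : set Z | clopen U], minimal Z,
      refinable Z & liftable Z].
Proof.
pose tasks n : task d := odflt (0, (0, ([::], [::])))
  (choice.unpickle n : option (nat * (nat * (seq ('I_d * (nat * nat)) * seq nat)))).
have [Q [phi [P [mQ phiQ phia [Pid Pstep] Qt]]]] := chain_exists i0 tasks.
have Qtask m T' s : min_tiles T' ->
  (exists T, [/\ min_tiles T, (forall n, m <= n -> tiles_map (Q n) T (P n m)) &
     tiles_map T' T (nth 0 s)]) ->
  exists n sg, [/\ m <= n, tiles_map (Q n) T' sg & forall y, conf (Q n) y ->
      nth 0 s \o sg \o y = P n m \o y].
  move=> mT' [T [mT QT T'T]].
  have [n [mn [j nj]]] := task_recurs T' s m.
  have := Qt n; rewrite /tasks nj /= => /(_ mn mT')[].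
    by exists T; split=> //; exact: QT.
  by move=> sg sg1 sg2; exists n.+1, sg; split=> //; exact: leqW.
have [z0 _] := limit_neq0 i0 mQ phiQ.
exists (limit_flow Q phi), z0; split.
- exact: limit_cantor_like.
- exact: limit_countable.
- exact: limit_minimal.
- exact: limit_refinable.
- exact: limit_liftable.
Qed.

(** * The topology of the space of actions *)

Section UniformTopology.

(** A Lebesgue number argument. With [entourage_locconst] in the other direction, uniform closeness
    becomes equality of finite windows. *)
Lemma locconst_entourage (X : uniformType) W (gamma : X -> W) : compact [set: X] ->
  locconst gamma -> entourage [set ab : X * X | gamma ab.1 = gamma ab.2].
Proof.
move=> /compact_near_coveringP cX lg.
pose F := filter_from (@entourage X) (fun E => [set E' : set (X * X) | E' `<=` E]).
have FF : Filter F.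
  apply: filter_from_filter; first by exists setT; exact: entourageT.
  by move=> A B eA eB; exists (A `&` B); [exact: filterI|move=> C CAB; split=> p /CAB[]].
have [|E entE /(_ E (fun _ => id)) EP] :=
    cX _ F (fun E x => forall y, E (x, y) -> gamma x = gamma y) FF.
  move=> x _; have := lg x; rewrite -nbhs_entourageE => -[D entD DP].
  have entD' := entourage_split_ent entD.
  exists (xsection (split_ent D) x, [set E' | E' `<=` split_ent D]).
    split; last by exists (split_ent D).
    by rewrite -nbhs_entourageE; exists (split_ent D).
  move=> [a E'] [/= /xsectionP xa E'D] b /E'D ab.
  have -> : gamma a = gamma x.
    by apply: DP; apply/xsectionP; exact: split_ent_subset entD _ xa.
  apply/esym/DP/xsectionP; exact: entourage_split entD xa ab.
by apply: filterS entE => -[a b] /= ab; exact: EP.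
Qed.

Lemma entourage_locconst (X : uniformType) (w : nat -> X -> nat) (E : set (X * X)) :
  compact [set: X] -> (forall n, locconst (w n)) ->
  (forall n x y, w n.+1 x = w n.+1 y -> w n x = w n y) ->
  (forall x y, (forall n, w n x = w n y) -> x = y) ->
  entourage E -> exists n, forall x y, w n x = w n y -> E (x, y).
Proof.
move=> cX lw dw sw entE; apply/not_existsP => nE.
have cXX : compact [set: X * X] by rewrite -setXTT; exact: compact_setX.
pose D := (split_ent E) `&` (split_ent E)^-1%relation.
have entD : entourage D by apply: filterI; [|apply: entourage_inv]; exact: entourage_split_ent.
have oE (x : X) : nbhs (x, x) E.
  exists (xsection D x, xsection D x).
    by split; rewrite -nbhs_entourageE; exists D.
  move=> [a b] [/= /xsectionP [_ ax] /xsectionP [xb _]].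
  exact: entourage_split entE ax xb.
have lfst n : locconst (fun p : X * X => w n p.1).
  by apply: locconst_cont (lw n) _ => p; exact: cvg_fst.
have lsnd n : locconst (fun p : X * X => w n p.2).
  by apply: locconst_cont (lw n) _ => p; exact: cvg_snd.
have [|||[x y] _ xA] := @compact_nested _ setT
    (fun n => [set p : X * X | w n p.1 = w n p.2] `&` ~` E^°) cXX.
- move=> n; apply: closedI.
    have [_] := locconst_clopen [set q : nat * nat | q.1 = q.2] (locconst_pair (lfst n) (lsnd n)).
    by [].
  by rewrite closedC; exact: open_interior.
- by move=> n [x y] /= [/dw].
- move=> n; have /existsNP[x /existsNP[y /not_implyP[wxy nxy]]] := nE n.
  by exists (x, y); split=> //; split=> //= /interior_subset.
have e : x = y by apply: sw => n; have [] := xA n.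
by have [_ /=] := xA 0; apply; rewrite e; exact: oE.
Qed.

Lemma initial_cvg (S : choiceType) (T : topologicalType) (f : S -> T) (F : set_system S) s :
  Filter F -> f @ F --> f s -> F --> (s : initial_topology f).
Proof.
move=> FF cf N; rewrite nbhsE => -[_ [[B oB <-]] Bs BN].
have FB : (f @ F) B by apply: cf; apply: open_nbhs_nbhs.
exact: filterS BN FB.
Qed.

End UniformTopology.

Definition window n (x : cantor_space) : nat := choice.pickle [seq x i | i <- iota 0 n].

Lemma window_locconst n : locconst (window n).
Proof. by apply: locconst_comp; exact: cantor_window_locconst. Qed.

Lemma window_refine n x y : window n.+1 x = window n.+1 y -> window n x = window n y.
Proof.
move/(pcan_inj choice.pickleK)/eq_in_map => e; congr choice.pickle.
apply/eq_in_map => i; rewrite mem_iota => /andP[_ ni]; apply: e.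
by rewrite mem_iota /= leqW.
Qed.

Lemma window_sep x y : (forall n, window n x = window n y) -> x = y.
Proof.
move=> e; apply: cantor_window_separates => n; exact: (pcan_inj choice.pickleK) (e n).
Qed.

Lemma window_mono m n x y : m <= n -> window n x = window n y -> window m x = window m y.
Proof.
elim: n => [|n IH]; first by rewrite leqn0 => /eqP->.
rewrite leq_eqVlt => /orP[/eqP->//|]; rewrite ltnS => mn /window_refine; exact: IH.
Qed.

Lemma locconst_window W (gamma : cantor_space -> W) : locconst gamma ->
  exists n, forall x y, window n x = window n y -> gamma x = gamma y.
Proof.
move=> lg; apply: (locconst_factor cantor_space_compact window_locconst window_refine lg).
by move=> x y /window_sep->.
Qed.

Section ActionSpace.
Variable d : nat.
Local Notation G := (free_group d).

Lemma homeo_locconst W (gamma : cantor_space -> W) : locconst gamma ->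
  locconst (fun f : homeo cantor_space => gamma \o f).
Proof.
move=> lg f.
have cu : continuous ((fun f : homeo cantor_space => (f : cantor_space -> cantor_space)
    : {uniform cantor_space -> cantor_space}) : homeo cantor_space -> _).
  exact: initial_continuous.
have nf : nbhs (f : {uniform cantor_space -> cantor_space})
    [set h | forall y, gamma (f y) = gamma (h y)].
  apply/uniform_nbhs; exists [set ab | gamma ab.1 = gamma ab.2]; split.
    exact: locconst_entourage cantor_space_compact lg.
  by move=> h hP y; exact: hP.
have nf' : nbhs f [set h : homeo cantor_space | forall y, gamma (f y) = gamma (h y)].
  exact: cu f _ nf.
by apply: filterS nf' => h hP; apply: funext => y /=; rewrite hP.
Qed.

(** A label read after acting by one element does not change under small perturbations of the
    action; this is the source of all openness below. *)
Lemma action_locconst W (gamma : cantor_space -> W) (g : G) : locconst gamma ->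
  locconst (fun x : Xi_min G => gamma \o (val (val x) g : homeo cantor_space)).
Proof.
move=> lg.
apply: (@locconst_cont _ (homeo cantor_space) _ (fun f => gamma \o f)
  (fun x : Xi_min G => val (val x) g)); first exact: homeo_locconst.
have c1 : continuous (set_val : Xi_min G -> Xi G) by exact: initial_continuous.
have c2 : continuous (set_val : Xi G -> prod_topology (fun _ : G => homeo cantor_space)).
  exact: initial_continuous.
have c3 : continuous (proj g : prod_topology (fun _ : G => homeo cantor_space) -> _).
  exact: proj_continuous.
move=> x; apply: (@continuous_comp _ _ _ (set_val : Xi_min G -> Xi G)
  (fun y : Xi G => val y g)); first exact: c1.
apply: (@continuous_comp _ _ _ (set_val : Xi G -> _) (proj g)); first exact: c2.
exact: c3.
Qed.

Lemma action_nbhs (x : Xi_min G) (N : set (Xi_min G)) : nbhs x N ->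
  exists m n, forall y : Xi_min G,
    (forall w, w \in wball d n -> forall z, window m ((val (val y) w : homeo _) z) =
                                     window m ((val (val x) w : homeo _) z)) -> N y.
Proof.
pose B (c : nat * nat) := [set y : Xi_min G | forall w, w \in wball d c.2 -> forall z,
  window c.1 ((val (val y) w : homeo _) z) = window c.1 ((val (val x) w : homeo _) z)].
pose F := filter_from [set: nat * nat] B.
have FF : Filter F.
  apply: filter_from_filter; first by exists (0, 0).
  move=> [m n] [m' n'] _ _; exists (maxn m m', maxn n n') => // y yB; split=> w wn z.
    apply: window_mono (yB w _ z); first exact: leq_maxl.
    by move: wn; rewrite !mem_wball leq_max => ->.
  apply: window_mono (yB w _ z); first exact: leq_maxr.
  by move: wn; rewrite !mem_wball leq_max => ->; rewrite orbT.
suff Fx : F --> x by move=> /Fx[[m n] _ mnN]; exists m, n => y yB; apply: mnN.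
apply: initial_cvg; apply: initial_cvg; apply/cvg_sup => g.
apply: initial_cvg; apply: initial_cvg => U /uniform_nbhs[E [entE EU]].
have [m mE] := entourage_locconst cantor_space_compact window_locconst window_refine
  window_sep entE.
exists (m, size (word g)) => // y yB; apply: EU => z _.
by apply/mE/esym/yB; rewrite mem_wball.
Qed.

End ActionSpace.

(** * The generic conjugacy class *)

Section FlowIso.
Variable d : nat.
Local Notation G := (free_group d).
Implicit Types Z : flow G.

Definition flow_iso Z Z' (f : Z -> Z') (f' : Z' -> Z) :=
  [/\ cancel f f', cancel f' f, continuous f, continuous f' &
      forall g z, f (flow_act g z) = flow_act g (f z)].

Lemma flow_iso_sym Z Z' (f : Z -> Z') f' : flow_iso f f' -> flow_iso f' f.
Proof.
move=> [fK fK' cf cf' fE]; split=> // g z.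
by apply: (can_inj fK); rewrite fE !fK'.
Qed.

Definition good Z := [/\ minimal Z, refinable Z & liftable Z].

Lemma good_iso Z Z' (f : Z -> Z') f' : flow_iso f f' -> good Z -> good Z'.
Proof.
move=> fi [mZ rZ lZ]; have [_ _ _ _ f'E] := flow_iso_sym fi.
have [fK fK' cf cf' fE] := fi; split.
- move=> C clC [c Cc] invC; apply/seteqP; split=> // z' _.
  have : f @^-1` C = setT.
    apply: mZ.
    - by apply: preimage_closed => // z _; exact: cf.
    - by exists (f' c); rewrite /preimage /= fK'.
    - by move=> g _ [z Cz <-]; rewrite /preimage /= fE; apply: invC; exists (f z).
  by move=> /seteqP[_ /(_ (f' z') I)]; rewrite /preimage /= fK'.
- move=> gamma lg; have [T [rho [pi [mT lr tr e]]]] := rZ _ (locconst_cont lg cf).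
  exists T, (rho \o f'), pi; split=> //.
  + exact: locconst_cont lr cf'.
  + move=> z'; rewrite (_ : code _ z' = code rho (f' z')) //.
    by apply: funext => g; rewrite /code /= f'E.
  + apply: funext => z'; rewrite -{1}(fK' z').
    exact: (congr1 (fun u => u (f' z')) e).
- move=> T T' pi rho mT mT' pT lr tr.
  have tr' : tiled T (rho \o f).
    move=> z; rewrite (_ : code _ z = code rho (f z)) //.
    by apply: funext => g; rewrite /code /= fE.
  have [sg [lsg tsg e]] := lZ _ _ _ _ mT mT' pT (locconst_cont lr cf) tr'.
  exists (sg \o f'); split=> //.
  + exact: locconst_cont lsg cf'.
  + move=> z'; rewrite (_ : code _ z' = code sg (f' z')) //.
    by apply: funext => g; rewrite /code /= f'E.
  + apply: funext => z'; rewrite -{2}(fK' z').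
    exact: (congr1 (fun u => u (f' z')) e).
Qed.

Lemma flow_iso_balg Z Z' (f : Z -> Z') f' : flow_iso f f' ->
  balg_iso (clopen_balg Z) (clopen_balg Z').
Proof.
move=> fi; have [fK fK' cf cf' fE] := fi; have [_ _ _ _ f'E] := flow_iso_sym fi.
have cl (Y Y' : flow G) (h : Y -> Y') (ch : continuous h) (U : clopen_balg Y') :
    clopen (h @^-1` (val U : set Y')).
  by apply: preimage_clopen => //; exact: set_mem (valP U).
pose F U := clopen_of (cl _ _ _ cf' U); pose F' U := clopen_of (cl _ _ _ cf U).
have FE U z : member (F U) z = member U (f' z) by [].
exists F; split.
- split=> [U V|U V|U||]; apply: member_inj => z.
  + by rewrite FE !member_meet !FE.
  + by rewrite FE !member_join !FE.
  + by rewrite FE !member_compl FE.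
  + by rewrite FE !member_bot.
  + by rewrite FE !member_top.
- by move=> g U; apply: member_inj => z; rewrite FE !member_act FE f'E.
- exists F' => U; apply: member_inj => z.
    by rewrite -[LHS]/(member U (f' (f z))) fK.
  by rewrite -[LHS]/(member U (f (f' z))) fK'.
Qed.

(** Without a bound, compactness gives [z] and a point whose orbit avoids the label of [z]; such
    points form a closed invariant set that misses [z]. *)
Lemma minimal_syndetic Z (gamma : Z -> nat) : compact [set: Z] -> minimal Z ->
  locconst gamma -> exists N, forall z y, exists2 v, size (word v) <= N &
    gamma (flow_act v y) = gamma z.
Proof.
move=> cZ mZ lg; apply: contrapT => /forallNP nN.
have cZZ : compact [set: Z * Z] by rewrite -setXTT; exact: compact_setX.
have lcg v : locconst (fun y => gamma (flow_act v y)).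
  exact: locconst_cont lg (@flow_cont _ Z v).
have [|||[z y] _ A] := @compact_nested _ setT (fun n => [set p : Z * Z |
    forall v, v \in wball d n -> gamma (flow_act v p.2) <> gamma p.1]) cZZ.
- move=> n; rewrite (_ : [set _ | _] = \bigcap_(v in [set v | v \in wball d n])
      [set p : Z * Z | gamma (flow_act v p.2) <> gamma p.1]); last first.
    by apply/seteqP; split=> x h; [move=> g; exact: h|move=> g gn; exact: (h g gn)].
  apply: closed_bigI => v _.
  have l1 : locconst (fun p : Z * Z => gamma (flow_act v p.2)).
    by apply: locconst_cont (lcg v) _ => p; exact: cvg_snd.
  have l2 : locconst (fun p : Z * Z => gamma p.1).
    by apply: locconst_cont lg _ => p; exact: cvg_fst.
  have [_] := locconst_clopen [set q : nat * nat | q.1 <> q.2] (locconst_pair l1 l2).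
  by [].
- by move=> n p pn v vn; apply: pn; move: vn; rewrite !mem_wball => /leqW.
- move=> n; have /existsNP[z /existsNP[y nzy]] := nN n; exists (z, y); split=> // v vn e.
  by apply: nzy; exists v => //; rewrite -mem_wball.
have : [set x | forall v, gamma (flow_act v x) <> gamma z] = setT.
  apply: mZ.
  - rewrite (_ : [set _ | _] = \bigcap_(v in [set: G])
        [set x | gamma (flow_act v x) <> gamma z]); last first.
      by apply/seteqP; split=> x h; [move=> g _; exact: h|move=> g; exact: (h g I)].
    apply: closed_bigI => v _.
    by have [_] := locconst_clopen [set u | u <> gamma z] (lcg v).
  - exists y => v; apply: (A (size (word v)) v); by rewrite mem_wball.
  - by move=> g _ [x xV <-] v; rewrite -flow_actM; exact: xV.
by move=> /seteqP[_ /(_ z I 1)]; rewrite flow_act1.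
Qed.

Lemma tiledP Z (T : tiles d) (rho : Z -> nat) : tiled T rho <->
  forall i z, (i, (rho z, rho (flow_act (gen (i, false)) z))) \in T.
Proof.
split=> [tr i z|h z g i]; last by rewrite /code flow_actM; exact: h.
by have := tr z 1 i; rewrite /code flow_act1 mulg1.
Qed.

End FlowIso.

Section CantorActions.
Variable d : nat.
Variable i0 : 'I_d.
Local Notation G := (free_group d).

Lemma conj_flow_iso (xi eta : Xi G) : conj_class xi eta ->
  exists (f : action_flow xi -> action_flow eta) f', flow_iso f f'.
Proof.
move=> [f fE]; exists (f : cantor_space -> _), (homeo_inv f); split.
- exact: homeoK.
- exact: homeoVK.
- exact: homeo_cont.
- exact: homeoV_cont.
- move=> g z; rewrite /= /cantor_act fE /=.
  by rewrite (homeoK f).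
Qed.

Lemma flow_iso_conj (xi eta : Xi G) (f : action_flow xi -> action_flow eta) f' :
  flow_iso f f' -> conj_class xi eta.
Proof.
move=> [fK fK' cf cf' fE]; exists (Homeo fK fK' cf cf') => g.
apply: homeoP => z /=; rewrite -[RHS]/(f (flow_act g (f' z))) fE.
by rewrite fK'.
Qed.

Lemma good_conj (xi eta : Xi G) : good (action_flow xi) -> good (action_flow eta) ->
  conj_class xi eta.
Proof.
move=> [mx rx lx] [me re le].
have z0 : cantor_space := fun=> false.
have cO := cantor_space_compact; have hO := cantor_space_hausdorff.
have zO := cantor_zero_dimensional.
have nt (x : Xi G) : (\top != \bot :> clopen_balg (action_flow x))%O.
  apply/eqP => e; have := @member_top _ (action_flow x) z0.
  by rewrite e member_bot.
have cc (x : Xi G) : countable [set: clopen_balg (action_flow x)].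
  exact: (@countable_clopen_balg _ (action_flow x) cantor_countable_clopen).
have [F Fi _] := back_forth (cc xi) (cc eta)
  (@good_extendable _ i0 (action_flow xi) (action_flow eta) z0 z0 cO cO rx re le)
  (@good_extendable _ i0 (action_flow eta) (action_flow xi) z0 z0 cO cO re rx lx)
  (pequiv_nil (nt xi) (nt eta)).
have [f [f' [fK fK' cf cf' [_ fE]]]] :=
  @stone_iso _ (action_flow xi) (action_flow eta) F cO hO zO cO hO zO Fi.
by apply: (@flow_iso_conj xi eta f f').
Qed.

Lemma good_action_exists : exists xi : Xi G, good (action_flow xi).
Proof.
have [Z [z0 [clZ cnZ mZ rZ lZ]]] := good_flow_exists i0.
have rg : range (fun _ : Z => 0) = range (fun _ : cantor_space => 0).
  by apply/seteqP; split=> _ [_ _ <-]; [exists (fun=> false)|exists z0].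
have lc (X : topologicalType) : locconst (fun _ : X => 0) by move=> x; exact: filterE.
have [f [f' [fK fK' cf cf' _]]] := cantor_homeo G clZ cantor_like_cantor_space
  cnZ cantor_countable_clopen (lc _) (lc _) rg.
have actK g : cancel (@flow_act _ Z g) (flow_act g^-1).
  by move=> z; rewrite -flow_actM mulVg flow_act1.
have actVK g : cancel (@flow_act _ Z g^-1) (flow_act g).
  by move=> z; rewrite -flow_actM mulgV flow_act1.
have cc g : continuous (f \o @flow_act _ Z g \o f').
  move=> x; apply: (@continuous_comp _ _ _ f' (f \o @flow_act _ Z g)); first exact: cf'.
  apply: (@continuous_comp _ _ _ (@flow_act _ Z g) f); first exact: flow_cont.
  exact: cf.
have hK g : cancel (f \o @flow_act _ Z g \o f') (f \o @flow_act _ Z g^-1 \o f').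
  by move=> x; rewrite /= fK actK fK'.
have hVK g : cancel (f \o @flow_act _ Z g^-1 \o f') (f \o @flow_act _ Z g \o f').
  by move=> x; rewrite /= fK actVK fK'.
have xiX : (fun g => Homeo (hK g) (hVK g) (cc g) (cc g^-1)) \in Xi G.
  by rewrite inE => g h; apply: homeoP => x; rewrite /= fK flow_actM.
pose xi : Xi G := exist (fun u => u \in Xi G) _ xiX.
exists xi; have fi : @flow_iso d Z (action_flow xi) f f'.
  by split=> // g z; rewrite /= /cantor_act /= fK.
exact: good_iso fi _.
Qed.

(** * Density of the class of a good action *)

Section Density.
Variable xi0 : Xi G.
Hypothesis gxi0 : good (action_flow xi0).

(** The good action receives labels with the same range as the radius-[n] labels of [x], so a
    homeomorphism matches the two labellings. A label records the values of [gamma] along a whole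
    ball of group elements, so the conjugate action imitates [x] there. *)
Lemma conj_dense (O : set (Xi_min G)) (x : Xi_min G) : nbhs x O ->
  exists2 y : Xi_min G, O y & conj_class xi0 (val y).
Proof.
move=> /action_nbhs[m [n Oy]].
pose Z := action_flow (val x); have mZ : minimal Z := set_mem (valP x).
have cO : compact [set: Z] := cantor_space_compact.
pose gamma : Z -> nat := window m.
have lg : locconst gamma by exact: window_locconst.
have [k kP] := compact_locconst cO lg.
have [||T [TE TP]] := block_tiles i0 (Y := range (code gamma)) n (k := k).
- by move=> _ h [z _ <-]; exists (flow_act h z) => //; rewrite code_translate.
- by move=> _ g [z _ <-]; exact: kP.
pose Gam (z : Z) := code_window n (code gamma z).
have codeG z : code Gam z = block n (code gamma z).
  by apply: funext => g; rewrite /block -code_translate.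
have lG : locconst Gam.
  apply: (locconst_comp choice.pickle); apply: locconst_map => g.
  exact: code_locconst.
have [N NP] := minimal_syndetic cO mZ lG.
have z0 : Z := (fun=> false) : cantor_space.
have c0 : conf T (code Gam z0) by rewrite codeG; apply: TE; exists z0.
(* A visit to a given label must be reached without starting in the direction [s]: [N.+1] steps away
   from [s], then at most [N] return steps, too few to undo the first one. *)
have [T' [pi [mT' pim piall]]] := minimal_tiles i0 (N + N.+1) c0.
have [_ _ lxi0] := gxi0.
have [rho lr tr] := liftable_tiled i0 lxi0 mT'.
pose Gam' := pi \o rho.
(* Every label of [x] must occur, not only those allowed by [T]; [piall] provides this. *)
have rG : range Gam' = range Gam.
  apply/seteqP; split=> [_ [z' _ <-]|_ [z _ <-]].
    have /TP[y [yE /(_ 1)[_ [z _ <-] ag]]] := pim _ (tr z').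
    exists z => //; have -> : Gam' z' = block n y 1.
      by rewrite -yE -[RHS]/(pi (rho (flow_act 1 z'))) flow_act1.
    by apply/code_windowP => w wn; rewrite -ag.
  have [h hE] : exists h, pi (code rho z0 h) = Gam z.
    apply: piall (tr z0) => g s.
    have [u [su oku]] := far_path s N.
    have [v vN vE] := NP z (flow_act (u * g) z0).
    exists (v * u); split.
    - by apply: leq_trans (size_mulg _ _) _; rewrite su leq_add2r.
    - by apply: okw_cancel oku; rewrite su ltnS.
    - by rewrite /code -mulgA flow_actM.
  by exists (@flow_act _ (action_flow xi0) h z0).
have [f [f' [fK fK' cf cf' fG]]] := cantor_homeo G cantor_like_cantor_space
  cantor_like_cantor_space cantor_countable_clopen cantor_countable_clopen
  (locconst_comp pi lr) lG rG.
pose F : homeo cantor_space := Homeo fK fK' cf cf'.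
have etaXi : (fun g => F * (val xi0 g : homeo cantor_space) * F^-1) \in Xi G.
  rewrite inE => g h; have xM := set_mem (valP xi0).
  by rewrite (xM g h); apply: homeoP => z; rewrite /= fK.
pose eta : Xi G := exist (fun u => u \in Xi G) _ etaXi.
have ceta : conj_class xi0 eta by exists F.
have [f1 [f1' fi1]] := conj_flow_iso ceta.
have geta : good (action_flow eta) by exact: good_iso fi1 gxi0.
have eta_min : eta \in Xi_min G by rewrite inE; case: geta.
exists (exist (fun u => u \in Xi_min G) eta eta_min) => //; apply: Oy => w wn z /=.
have [y [yE _]] := TP _ (pim _ (tr (f' z))).
have key u : Gam (F (val xi0 u (homeo_inv F z))) = code_window n (translate u y).
  rewrite -[RHS]/(block n y u) -yE.
  exact: (congr1 (fun v => v (val xi0 u (f' z))) fG).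
have k1 : gamma (F (val xi0 w (homeo_inv F z))) = y w.
  have /code_windowP/(_ 1 (leq0n _)) := key w.
  by rewrite /code /translate mul1g flow_act1.
rewrite -[LHS]/(gamma (F (val xi0 w (homeo_inv F z)))) k1.
have := key 1; have -> : F (val xi0 1 (homeo_inv F z)) = z.
  rewrite -[val xi0 1 _]/(cantor_act xi0 1 (homeo_inv F z)) cantor_act1.
  exact: fK'.
move=> /code_windowP/(_ w); rewrite -mem_wball => /(_ wn).
by rewrite /code /translate mulg1 => <-.
Qed.

End Density.

(** Countably many codes exhaust the locally constant labellings, so that goodness becomes a
    countable family of conditions. *)
Definition labelling (c : nat * seq nat) (z : cantor_space) : nat := nth 0 c.2 (window c.1 z).

Lemma labelling_locconst c : locconst (labelling c).
Proof. by apply: (locconst_comp (nth 0 c.2)); exact: window_locconst. Qed.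

Lemma labelling_onto (gamma : cantor_space -> nat) : locconst gamma ->
  exists c, gamma = labelling c.
Proof.
move=> lg; have [n nP] := locconst_window lg.
have [k kP] := compact_locconst cantor_space_compact (@window_locconst n).
have ex u : exists v, forall z, window n z = u -> gamma z = v.
  have [[z zu]|nz] := pselect (exists z, window n z = u).
    by exists (gamma z) => z' z'u; apply: nP; rewrite zu.
  by exists 0 => z zu; case: nz; exists z.
have [psi psiP] := choice ex; exists (n, mkseq psi k).
by apply: funext => z; rewrite /labelling /= nth_mkseq //; exact: psiP.
Qed.

Local Notation flowx x := (action_flow (val x)).

Lemma tiled_near (x : Xi_min G) T (rho : cantor_space -> nat) : locconst rho ->
  nbhs x [set y : Xi_min G | tiled (Z := flowx x) T rho <-> tiled (Z := flowx y) T rho].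
Proof.
move=> lr.
have lm : locconst (fun y : Xi_min G =>
    [seq rho \o (val (val y) (gen (i, false)) : homeo cantor_space) | i <- enum 'I_d]).
  by apply: locconst_map => i; exact: action_locconst.
apply: filterS (lm x) => y /eq_in_map e.
have {}e i z : rho (val (val y) (gen (i, false)) z) = rho (val (val x) (gen (i, false)) z).
  by have := e i; rewrite mem_enum => /(_ isT)/(congr1 (fun u => u z)).
by rewrite /= !tiledP; split=> h i z; have := h i z; rewrite /= /cantor_act e.
Qed.

Definition refine_at (c : nat * seq nat) : set (Xi_min G) :=
  [set x | exists T (rho : flowx x -> nat) pi,
     [/\ min_tiles T, locconst rho, tiled T rho & labelling c = pi \o rho]].

Definition lift_at (c : nat * seq nat) (T T' : tiles d) (s : seq nat) : set (Xi_min G) :=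
  [set x | min_tiles T -> min_tiles T' -> tiles_map T' T (nth 0 s) ->
     tiled (Z := flowx x) T (labelling c) ->
     exists sigma : flowx x -> nat,
       [/\ locconst sigma, tiled T' sigma & nth 0 s \o sigma = labelling c]].

Lemma refine_at_open c : open (refine_at c).
Proof.
rewrite openE => x [T [rho [pi [mT lr tr e]]]].
apply: filterS (tiled_near x T lr) => y [h _].
by exists T, rho, pi; split=> //; exact: h.
Qed.

(** A lift found at [x] stays tiled nearby. A premise that fails at [x] is either independent of the
    action or is tiledness, which is locally constant, so it fails nearby too. *)
Lemma lift_at_open c T T' s : open (lift_at c T T' s).
Proof.
rewrite openE => x xU.
have [[mT mT' mor tx]|nv] := pselect [/\ min_tiles T, min_tiles T', tiles_map T' T (nth 0 s) &
    tiled (Z := flowx x) T (labelling c)].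
  have [sg [lsg tsg e]] := xU mT mT' mor tx.
  apply: filterS (tiled_near x T' lsg) => y [h _] _ _ _ _.
  by exists sg; split=> //; exact: h.
apply: filterS (tiled_near x T (@labelling_locconst c)) => y [_ h] mT mT' mor ty.
by case: nv; split=> //; exact: h.
Qed.

Lemma good_at (x : Xi_min G) : good (flowx x) ->
  (forall c, refine_at c x) /\ (forall c T T' s, lift_at c T T' s x).
Proof.
move=> [_ rx lx]; split=> [c|c T T' s mT mT' mor tx].
  exact: (rx _ (@labelling_locconst c)).
exact: (lx _ _ _ _ mT mT' mor (@labelling_locconst c) tx).
Qed.

Lemma at_good (x : Xi_min G) : (forall c, refine_at c x) ->
  (forall c T T' s, lift_at c T T' s x) -> good (flowx x).
Proof.
move=> rx lx; split; first exact: set_mem (valP x).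
  by move=> gamma /labelling_onto[c ->]; exact: rx.
move=> T T' pi rho mT mT' mor /labelling_onto[c ->] tx.
(* Only the values of [pi] on the symbols of [T'] matter, and a list records them. *)
have [k kP] := symbols_bound i0 T'.
have sE y : conf T' y -> nth 0 (mkseq pi k) \o y = pi \o y.
  by move=> cy; apply: funext => g /=; rewrite nth_mkseq //; exact: kP.
have mor' : tiles_map T' T (nth 0 (mkseq pi k)) by move=> y cy; rewrite sE //; exact: mor.
have [sg [lsg tsg e]] := lx c T T' (mkseq pi k) mT mT' mor' tx.
exists sg; split=> //; rewrite -e; apply: funext => z.
have := congr1 (fun u => u 1) (sE _ (tsg z)).
by rewrite /= /code flow_act1.
Qed.

(** Goodness is invariant under conjugation, so each open condition contains the dense class; an
    action meeting all of them is good, hence conjugate to [xi0]. *)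
Lemma conj_comeager (xi0 : Xi G) : good (action_flow xi0) ->
  comeager (set_val @^-1` conj_class xi0 : set (Xi_min G)).
Proof.
move=> g0.
pose index := ((nat * seq nat) * option ((seq ('I_d * (nat * nat)) *
  seq ('I_d * (nat * nat))) * seq nat))%type.
pose V (j : index) : set (Xi_min G) := match j with
  | (c, None) => refine_at c
  | (c, Some (TT, s)) => lift_at c TT.1 TT.2 s end.
exists (fun n => if (choice.unpickle n : option index) is Some j then V j else setT).
  move=> n; case: (choice.unpickle n : option index) => [[c [[TT s]|]]|] /=; split.
  - exact: lift_at_open.
  - move=> O [x Ox] oO; have nx : nbhs x O by exact: open_nbhs_nbhs.
    have [y Oy cy] := conj_dense g0 nx; exists y; split=> //.
    have [f [f' fi]] := conj_flow_iso cy.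
    by have [_] := good_at (good_iso fi g0); apply.
  - exact: refine_at_open.
  - move=> O [x Ox] oO; have nx : nbhs x O by exact: open_nbhs_nbhs.
    have [y Oy cy] := conj_dense g0 nx; exists y; split=> //.
    have [f [f' fi]] := conj_flow_iso cy.
    by have [+ _] := good_at (good_iso fi g0); apply.
  - exact: openT.
  - by move=> O [x Ox] oO; exists x.
move=> x xU; apply: good_conj => //; apply: at_good => [c|c T T' s].
  by have := xU (choice.pickle ((c, None) : index)) I; rewrite choice.pickleK.
by have := xU (choice.pickle ((c, Some ((T, T'), s)) : index)) I; rewrite choice.pickleK.
Qed.

End CantorActions.

Theorem corollary1p3 (d : nat) (hd : (1 <= d)%N) :
  exists M : boolGalg (free_group d),
    [/\ fraisse_limit (sofic_minimal_balg (free_group d)) M,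
        (forall N : boolGalg (free_group d),
           fraisse_limit (sofic_minimal_balg (free_group d)) N ->
           balg_iso N M) &
        exists2 xi : Xi (free_group d), Xi_min (free_group d) xi &
          comeager (set_val @^-1` conj_class xi : set (Xi_min (free_group d)))
          /\ (forall eta : Xi (free_group d), conj_class xi eta ->
                balg_iso (clopen_balg (action_flow eta)) M)].
Proof.
have i0 : 'I_d := Ordinal hd.
have [xi gxi] := good_action_exists i0; have [mx rx lx] := gxi.
have fM : fraisse_limit (sofic_minimal_balg (free_group d)) (clopen_balg (action_flow xi)).
  apply: (@good_fraisse _ i0 (action_flow xi) cantor_space_compact mx (fun=> false) rx lx).
  exact: (@countable_clopen_balg _ (action_flow xi) cantor_countable_clopen).
exists (clopen_balg (action_flow xi)); split=> //.
  move=> N fN; apply: fraisse_unique fM fN; exact: sofic_minimal_nontrivial.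
exists xi => //; split; first exact: (conj_comeager i0 gxi).
move=> eta /conj_flow_iso[f [f' fi]]; apply: flow_iso_balg (flow_iso_sym fi).
Qed.
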